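(* Let $n\geq 3$ and let $(M,g)$ be a Riemannian $n$-manifold with positive definite curvature operator, with curvature tensor $R_{abcd}$. Let $C^{*}_{abcd}$ and $P^{*}_{ab}$ be the Weyl and Schouten tensors of $R^{*}_{ab}{}^{cd}=\ln(R_{ab}{}^{cd})$. Then $M$ admits a local isometric immersion in $\mathbb{R}^{n+1}$ if and only if: when $n=3$, $(e^{P^{*}})_{a[b;c]}=0$; and when $n>3$, $C^{*}_{abcd}=0$.
   Context: All manifolds, metrics and functions are smooth. '';'' is covariant differentiation with respect to the Levi-Civita connection of $g$, and $T_{a[b;c]}=\frac12(T_{ab;c}-T_{ac;b})$. $(M,g)$ admits a local isometric immersion in $\mathbb{R}^{m}$ if every point has an open neighbourhood on which there are scalar fields $u^{(1)},\dots,u^{(m)}$ with $\sum_{\tau} u^{(\tau)}_{;a}u^{(\tau)}_{;b}=g_{ab}$. Curvature sign convention: the unit round sphere has $R_{abcd}=g_{ac}g_{bd}-g_{ad}g_{bc}$. Any tensor $T_{abcd}$ antisymmetric in $ab$ and in $cd$ and satisfying $T_{abcd}=T_{cdab}$ is regarded as a self-adjoint operator on $2$-forms by $\omega_{ab}\mapsto \frac12 T_{ab}{}^{cd}\omega_{cd}$ (so $g_{ac}g_{bd}-g_{ad}g_{bc}$ is the identity operator), and conversely. The curvature operator is the operator associated with $R_{abcd}$. When it is positive definite, $R^{*}_{ab}{}^{cd}=\ln(R_{ab}{}^{cd})$ is its (pointwise) operator logarithm, regarded again as a tensor $R^{*}_{abcd}$. Put $R^{*}_{ij}=R^{*\,k}{}_{ikj}$,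 $\rho^{*}=R^{*\,a}{}_{a}$. The Schouten tensor of $R^{*}$ is $$P^{*}_{ab}=\frac{1}{n-2}\left(R^{*}_{ab}-\frac{\rho^{*}}{2(n-1)}g_{ab}\right),$$ and the Weyl tensor of $R^{*}$ is $$C^{*}_{abcd}=R^{*}_{abcd}-\left(g_{ac}P^{*}_{bd}+P^{*}_{ac}g_{bd}-P^{*}_{ad}g_{bc}-g_{ad}P^{*}_{bc}\right).$$ $e^{P^{*}}$ is the exponential of the endomorphism $P^{*}_{a}{}^{b}$, with its index lowered by $g$, giving a symmetric tensor $(e^{P^{*}})_{ab}$. *)

(* Defs.v *)
(* Tensor fields on a manifold are handled through their components in the
   charts of the atlas; tensor indices range over ['I_n]. *)
From mathcomp Require Import all_boot all_order all_algebra.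
From mathcomp Require Import all_classical all_reals all_analysis.
Set Implicit Arguments.
Unset Strict Implicit.
Unset Printing Implicit Defensive.
Import Order.TTheory GRing.Theory Num.Theory.
Import numFieldNormedType.Exports.
Local Open Scope classical_set_scope.
Local Open Scope ring_scope.

Section SmoothFunctions.
Context {R : realType} {n : nat}.
Implicit Types (U : set 'rV[R]_n) (f : 'rV[R]_n -> R).

Definition pder (i : 'I_n) f : 'rV[R]_n -> R :=
  fun x => 'D_(delta_mx 0 i) f x.

(* For open [U]: [f] has all iterated partial derivatives of order <= k on
   [U], and they are continuous there. *)
Fixpoint Ck (k : nat) U f : Prop :=
  (forall x, U x -> {for x, continuous f}) /\
  (if k is k'.+1 then
     forall i, (forall x, U x -> derivable f x (delta_mx 0 i)) /\
               Ck k' U (pder i f)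
   else True).

Definition smooth_on U f : Prop := forall k, Ck k U f.

End SmoothFunctions.

(* The maps [chart_map] and [chart_inv] are total; they are meaningful only on
   [chart_dom] and on [chart_map @` chart_dom] respectively. *)
Record chart (R : realType) (n : nat) (M : topologicalType) := Chart {
  chart_dom : set M;
  chart_map : M -> 'rV[R]_n;
  chart_inv : 'rV[R]_n -> M;
  chart_dom_open : open chart_dom;
  chart_cod_open : open (chart_map @` chart_dom);
  chart_mapK : forall p, chart_dom p -> chart_inv (chart_map p) = p;
  chart_map_cont : forall p, chart_dom p -> {for p, continuous chart_map};
  chart_inv_cont : forall x, (chart_map @` chart_dom) x -> {for x, continuous chart_inv}
}.

Definition chart_cod (R : realType) (n : nat) (M : topologicalType)
  (c : chart R n M) : set 'rV[R]_n := chart_map c @` chart_dom c.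

Definition transition (R : realType) (n : nat) (M : topologicalType)
    (c c' : chart R n M) (i : 'I_n) : 'rV[R]_n -> R :=
  fun x => chart_map c' (chart_inv c x) 0 i.

(* The atlas need not be maximal: every notion below that quantifies over the
   charts of the atlas is invariant under a smooth change of coordinates. *)
Record manifold (R : realType) (n : nat) := Manifold {
  carrier :> topologicalType;
  carrier_hausdorff : hausdorff_space carrier;
  carrier_second_countable : @second_countable carrier;
  atlas : set (chart R n carrier);
  atlas_cover : forall p : carrier, exists2 c, atlas c & chart_dom c p;
  atlas_smooth : forall c c', atlas c -> atlas c' -> forall i,
    smooth_on (chart_map c @` (chart_dom c `&` chart_dom c')) (transition c c' i)
}.

Definition posdefmx (R : realType) (n : nat) (g : 'M[R]_n) : Prop :=
  forall v : 'rV[R]_n, v != 0 -> 0 < (v *m g *m v^T) 0 0.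

(* [metric_mx c x] is the matrix [g_ab] in the chart [c] at the point with
   coordinates [x]. *)
Record riemannian_metric (R : realType) (n : nat) (M : manifold R n) :=
  RiemannianMetric {
  metric_mx : chart R n M -> 'rV[R]_n -> 'M[R]_n;
  metric_smooth : forall c, atlas c -> forall a b,
    smooth_on (chart_cod c) (fun x => metric_mx c x a b);
  metric_sym : forall c, atlas c -> forall x, chart_cod c x ->
    (metric_mx c x)^T = metric_mx c x;
  metric_posdef : forall c, atlas c -> forall x, chart_cod c x ->
    posdefmx (metric_mx c x);
  metric_transform : forall c c', atlas c -> atlas c' ->
    forall x, (chart_map c @` (chart_dom c `&` chart_dom c')) x -> forall a b,
    metric_mx c x a b =
      \sum_(i < n) \sum_(j < n)
        pder a (transition c c' i) x * pder b (transition c c' j) x *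
        metric_mx c' (chart_map c' (chart_inv c x)) i j
}.

Section PointwiseAlgebra.
Context {R : realType} {n : nat}.
Implicit Types (g A : 'M[R]_n).

(* Covariant components [T_abcd] at a point. *)
Definition tensor4 := 'I_n -> 'I_n -> 'I_n -> 'I_n -> R.
Implicit Types (T K L : tensor4).

(* The power series of the exponential. *)
Definition expmx A : 'M[R]_n :=
  limn (series (fun k : nat => (k`!%:R)^-1 *: A ^+ k)).

Definition two_form (w : 'M[R]_n) : Prop := w^T = - w.

(* 1/2 T_ab^cd w_cd *)
Definition op_of_tensor g T (w : 'M[R]_n) : 'M[R]_n :=
  \matrix_(a, b) (2^-1 * \sum_(c < n) \sum_(d < n) \sum_(e < n) \sum_(f < n)
    T a b e f * invmx g e c * invmx g f d * w c d).

(* 1/2 v_ab w^ab *)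
Definition form_dot g (v w : 'M[R]_n) : R :=
  2^-1 * \sum_(a < n) \sum_(b < n) \sum_(c < n) \sum_(d < n)
    v a b * invmx g a c * invmx g b d * w c d.

Definition op_symmetric T : Prop :=
  [/\ forall a b c d, T a b c d = - T b a c d,
      forall a b c d, T a b c d = - T a b d c &
      forall a b c d, T a b c d = T c d a b].

Definition op_posdef g T : Prop :=
  forall w, two_form w -> w != 0 -> 0 < form_dot g w (op_of_tensor g T w).

(* The functional calculus of the logarithm: [L] is self-adjoint and acts as
   multiplication by [ln l] on the eigenspace of [K] for each eigenvalue [l].
   A positive definite self-adjoint [K] is diagonalizable, so there is exactly
   one such [L]. *)
Definition is_op_log g K L : Prop :=
  op_symmetric L /\
  forall (w : 'M[R]_n) (l : R), two_form w ->
    op_of_tensor g K w = l *: w -> op_of_tensor g L w = ln l *: w.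

Definition op_log g K : tensor4 :=
  xget (fun _ _ _ _ => 0) [set L | is_op_log g K L].

(* R_ij = R^k_ikj *)
Definition ricci_of g T : 'M[R]_n :=
  \matrix_(i, j) \sum_(k < n) \sum_(l < n) invmx g k l * T l i k j.

Definition scalar_of g T : R :=
  \sum_(a < n) \sum_(b < n) invmx g a b * ricci_of g T a b.

Definition schouten_of g T : 'M[R]_n :=
  (n%:R - 2)^-1 *:
    (ricci_of g T - (scalar_of g T / (2 * (n%:R - 1))) *: g).

Definition weyl_of g T : tensor4 := fun a b c d =>
  let P := schouten_of g T in
  T a b c d - (g a c * P b d + P a c * g b d - P a d * g b c - g a d * P b c).

(* The exponential of the endomorphism [A_a^b], with its index lowered. *)
Definition exp_sym g A : 'M[R]_n := expmx (A *m invmx g) *m g.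

End PointwiseAlgebra.

Section LocalGeometry.
Context {R : realType} {n : nat}.
Variable G : 'rV[R]_n -> 'M[R]_n.
Implicit Types x : 'rV[R]_n.

(* [christoffel k i j x] is Gamma^k_ij. *)
Definition christoffel (k i j : 'I_n) x : R :=
  2^-1 * \sum_(l < n) invmx (G x) k l *
    (pder i (fun y => G y j l) x + pder j (fun y => G y i l) x
     - pder l (fun y => G y i j) x).

(* R_abcd = g_ae (d_c Gamma^e_db - d_d Gamma^e_cb
                  + Gamma^e_cf Gamma^f_db - Gamma^e_df Gamma^f_cb),
   which is g_ac g_bd - g_ad g_bc on the unit sphere. *)
Definition riemann x : tensor4 (R := R) (n := n) := fun a b c d =>
  \sum_(e < n) G x a e *
    (pder c (christoffel e d b) x - pder d (christoffel e c b) x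
     + \sum_(f < n) (christoffel e c f x * christoffel f d b x
                     - christoffel e d f x * christoffel f c b x)).

(* [covder T a b c x] is T_ab;c. *)
Definition covder (T : 'rV[R]_n -> 'M[R]_n) (a b c : 'I_n) x : R :=
  pder c (fun y => T y a b) x
  - \sum_(d < n) (christoffel d c a x * T x d b + christoffel d c b x * T x a d).

(* T_a[b;c] *)
Definition codazzi (T : 'rV[R]_n -> 'M[R]_n) (a b c : 'I_n) x : R :=
  2^-1 * (covder T a b c x - covder T a c b x).

Definition log_riemann x : tensor4 := op_log (G x) (riemann x).

Definition schouten_star x : 'M[R]_n := schouten_of (G x) (log_riemann x).

Definition weyl_star x : tensor4 := weyl_of (G x) (log_riemann x).

Definition exp_schouten_star x : 'M[R]_n := exp_sym (G x) (schouten_star x).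

End LocalGeometry.

Section RiemannianManifold.
Context {R : realType} {n : nat} {M : manifold R n}.
Variable g : riemannian_metric M.

Definition positive_curvature_operator : Prop :=
  forall c, atlas c -> forall x, chart_cod c x ->
    op_posdef (metric_mx g c x) (riemann (metric_mx g c) x).

Definition smooth_scalar_on (W : set M) (u : M -> R) : Prop :=
  forall c, atlas c ->
    smooth_on (chart_map c @` (chart_dom c `&` W)) (u \o chart_inv c).

Definition admits_local_isometric_immersion (m : nat) : Prop :=
  forall p : M, exists W : set M, [/\ open W, W p &
    exists u : 'I_m -> M -> R,
      (forall t, smooth_scalar_on W (u t)) /\
      (forall c, atlas c -> forall x, (chart_map c @` (chart_dom c `&` W)) x ->
       forall a b,
         \sum_(t < m) pder a (u t \o chart_inv c) x *
                      pder b (u t \o chart_inv c) x = metric_mx g c x a b)].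

Definition exp_schouten_star_codazzi : Prop :=
  forall c, atlas c -> forall x, chart_cod c x -> forall a b d,
    codazzi (metric_mx g c) (exp_schouten_star (metric_mx g c)) a b d x = 0.

Definition weyl_star_vanishes : Prop :=
  forall c, atlas c -> forall x, chart_cod c x -> forall a b d e,
    weyl_star (metric_mx g c) x a b d e = 0.

End RiemannianManifold.

(* Main.v *)
From HB Require Import structures.
Require Import Defs.
From mathcomp Require Import all_boot all_order all_algebra.
From mathcomp Require Import all_classical all_reals all_analysis.
From mathcomp Require Import complex spectral ring lra.
Set Implicit Arguments.
Unset Strict Implicit.
Unset Printing Implicit Defensive.
Import Order.TTheory GRing.Theory Num.Theory.
Import numFieldNormedType.Exports.
Local Open Scope classical_set_scope.
Local Open Scope ring_scope.

(** The theorem combines an algebraic fact about the logarithm of a curvature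
    operator with the fundamental theorem of hypersurfaces.

    By that theorem a metric is locally realized by a hypersurface of R^(n+1)
    exactly when there is locally a smooth symmetric [h] with [R_abcd = h_ac
    h_bd - h_ad h_bc] (Gauss) and [h_a[b;c] = 0] (Codazzi): necessity is
    riemann_immersion and immersion_codazzi, sufficiency is local_hypersurface.
    If the curvature operator is positive, [h] is definite (gauss_definite), and
    the unit normal can be chosen so that [h] is positive definite. In a frame
    that diagonalizes [h] with eigenvalues [l_i] the curvature operator
    multiplies [e_i ^ e_j] by [l_i l_j], so its logarithm multiplies it by [ln
    l_i + ln l_j]: the logarithm of the Gauss product of [h] is the
    Kulkarni-Nomizu product of [g] and [ln h] (log_gauss_tensor), and conversely
    (gauss_tensor_of_log). A tensor is a Kulkarni-Nomizu product with [g]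
    exactly when its Weyl tensor vanishes, and the other factor is then its
    Schouten tensor (schouten_kulkarni). Therefore the Gauss equation is
    solvable if and only if [C* = 0], and its positive solution is [h = e^{P*}].

    In dimension three [C*] vanishes identically (kulkarni_schouten_dim3), and
    what remains is the Codazzi equation for [e^{P*}]. In higher dimension
    the Codazzi equation follows from the Gauss equation: inserting
    [R = h h] in the second Bianchi identity gives a linear relation between [h]
    and [h_a[b;c]], whose contractions with the inverse of [h] show that
    [h_a[b;c] = 0] (gauss_codazzi).

    The tensor [e^{P*}] is defined pointwise by spectral calculus. It is smooth
    because a three by three minor of [h] has its adjugate among the
    components of the smooth tensor [R], which determines the minor up to the
    square root of a positive function (gauss_root_smooth).

    The existence half of the fundamental theorem is an integrable linear total
    differential system for the adapted frame. It is solved by a theorem of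
    Frobenius type (frobenius): the system is integrated along the rays from a
    point by Picard iteration, and integrability shows that the resulting
    functions have the prescribed derivatives in all directions. *)

(** * Simultaneous diagonalization of two quadratic forms *)

Section LinearAlgebra.
Context {R : realType}.

Lemma posdefmx_unit n (S : 'M[R]_n) : posdefmx S -> S \in unitmx.
Proof.
move=> Spos; rewrite -row_free_unit; apply/row_freeP; apply/row_freeP.
rewrite -kermx_eq0; apply/eqP/row_matrixP => i; rewrite row0.
apply/eqP/negPn/negP => /Spos.
by rewrite -row_mul mulmx_ker row0 mul0mx mxE ltxx.
Qed.

Lemma posdefmx_congr m n (S : 'M[R]_n) (B : 'M[R]_(m, n)) :
  row_free B -> posdefmx S -> posdefmx (B *m S *m B^T).
Proof.
move=> Bfree Spos v vn0.
rewrite !mulmxA -(mulmxA (v *m B *m S)) -trmx_mul; apply: Spos.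
by rewrite mulmx_free_eq0.
Qed.

Lemma trmx_congr m n (S : 'M[R]_n) (B : 'M[R]_(m, n)) :
  S^T = S -> (B *m S *m B^T)^T = B *m S *m B^T.
Proof. by move=> Ssym; rewrite !trmx_mul trmxK Ssym mulmxA. Qed.

Lemma form_sym n (S : 'M[R]_n) (u v : 'rV_n) : S^T = S ->
  (u *m S *m v^T) 0 0 = (v *m S *m u^T) 0 0.
Proof.
move=> Ssym; have -> : u *m S *m v^T = (v *m S *m u^T)^T.
  by rewrite !trmx_mul trmxK Ssym mulmxA.
by rewrite mxE.
Qed.

(** A complex eigenvector [x + i y] of [T S^-1] for the eigenvalue [m + i k]
    gives [k (x S x^T + y S y^T) = 0] by symmetry of [T], so the eigenvalue is
    real and its real and imaginary parts are real eigenvectors. *)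
Lemma geigenvector_exists n (S T : 'M[R]_n.+1) :
  S^T = S -> posdefmx S -> T^T = T ->
  exists (v : 'rV_n.+1) (l : R), v != 0 /\ v *m T = l *: (v *m S).
Proof.
move=> Ssym Spos Tsym; have Sunit := posdefmx_unit Spos.
have [a /eigenvalueP[z zE zn0]] :=
  eigenvalue_closed (map_mx (real_complex R) (T *m invmx S)) (ltn0Sn n).
pose x : 'rV[R]_n.+1 := map_mx (@complex.Re R) z.
pose y : 'rV[R]_n.+1 := map_mx (@complex.Im R) z.
set M := T *m invmx S in zE.
have MS : M *m S = T by rewrite /M mulmxKV.
have xE : x *m M = complex.Re a *: x - complex.Im a *: y.
  apply/rowP => j; have /rowP/(_ j) := zE; rewrite !mxE.
  move=> /(congr1 (@complex.Re R)); rewrite raddf_sum /= => zj.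
  transitivity (complex.Re (a * z 0 j)); last by case: (a) (z 0 j) => [a1 a2] [z1 z2].
  rewrite -zj; apply: eq_bigr => i _; rewrite !mxE.
  by case: (z 0 i) => z1 z2 /=; rewrite mulr0 subr0.
have yE : y *m M = complex.Im a *: x + complex.Re a *: y.
  apply/rowP => j; have /rowP/(_ j) := zE; rewrite !mxE.
  move=> /(congr1 (@complex.Im R)); rewrite raddf_sum /= => zj.
  transitivity (complex.Im (a * z 0 j)).
    rewrite -zj; apply: eq_bigr => i _; rewrite !mxE.
    by case: (z 0 i) => z1 z2 /=; rewrite mulr0 add0r.
  by case: (a) (z 0 j) => [a1 a2] [z1 z2] /=; rewrite addrC.
have xyn0 : (x != 0) || (y != 0).
  rewrite -negb_and; apply: contra zn0 => /andP[/eqP x0 /eqP y0].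
  apply/eqP/rowP => j; move/rowP/(_ j): x0; move/rowP/(_ j): y0; rewrite !mxE.
  by case: (z 0 j) => z1 z2 /= -> ->.
move: (complex.Re a) (complex.Im a) xE yE => m k xE yE.
have {}xE : x *m T = m *: (x *m S) - k *: (y *m S).
  by rewrite -MS mulmxA xE mulmxBl -!scalemxAl.
have {}yE : y *m T = k *: (x *m S) + m *: (y *m S).
  by rewrite -MS mulmxA yE mulmxDl -!scalemxAl.
have k0 : k = 0.
  have := form_sym x y Tsym; rewrite xE yE !mulmxDl mulNmx -!scalemxAl.
  move=> /eqP; rewrite !mxE [X in _ == _ + X](_ : _ = m * (x *m S *m y^T) 0 0); last first.
    by rewrite form_sym// mxE.
  rewrite [X in _ + m * X]mxE addrC (inj_eq (addIr _)) eq_sym -subr_eq0 opprK -mulrDr.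
  rewrite mulf_eq0 => /orP[/eqP //|].
  have pos (u : 'rV_n.+1) : u != 0 -> 0 < \sum_j (u *m S) 0 j * u^T j 0.
    by move=> /Spos; rewrite mxE.
  have nneg (u : 'rV_n.+1) : 0 <= \sum_j (u *m S) 0 j * u^T j 0.
    have [->|/pos/ltW//] := eqVneq u 0.
    by rewrite mul0mx sumr_ge0// => i _; rewrite mxE mul0r.
  case/orP: xyn0 => /pos h; rewrite gt_eqF//.
    by rewrite ltr_wpDr.
  by rewrite ltr_wpDl.
move: xE yE; rewrite k0 !scale0r subr0 add0r => xE yE.
by case/orP: xyn0 => h; [exists x, m|exists y, m].
Qed.

(** By induction on the dimension: a generalized eigenvector, normalized for
    [S], splits off, and its [S]-orthogonal complement is invariant because
    [T] is symmetric. *)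
Lemma simultaneous_diag n (S T : 'M[R]_n) :
  S^T = S -> posdefmx S -> T^T = T ->
  exists (W : 'M[R]_n) (d : 'rV[R]_n),
    [/\ W \in unitmx, W *m S *m W^T = 1%:M & W *m T *m W^T = diag_mx d].
Proof.
elim: n S T => [|n IH] S T Ssym Spos Tsym.
  exists 1%:M, 0; split; first exact: unitmx1.
    by apply/matrixP => -[].
  by apply/matrixP => -[].
have [v0 [l [v0n0 v0T]]] := geigenvector_exists Ssym Spos Tsym.
pose c := (v0 *m S *m v0^T) 0 0.
have c0 : 0 < c by exact: Spos.
pose v := (Num.sqrt c)^-1 *: v0.
have vT : v *m T = l *: (v *m S) by rewrite -!scalemxAl v0T !scalerA mulrC.
have vSv : v *m S *m v^T = 1%:M.
  apply/matrixP => i j; rewrite !ord1 /v linearZ /= -!scalemxAr -!scalemxAl scalerA mxE.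
  by rewrite -/c -invfM -expr2 sqr_sqrtr ?ltW// mulVf ?gt_eqF// mxE.
clearbody v; have vSn0 : \rank (S *m v^T) = 1%N.
  apply/eqP; rewrite eqn_leq rank_leq_col lt0n mxrank_eq0.
  apply/eqP => h; move: vSv; rewrite -mulmxA h mulmx0 => /matrixP/(_ 0 0).
  by rewrite !mxE eqxx => /eqP; rewrite eq_sym oner_eq0.
have rk : \rank (kermx (S *m v^T)) = n by rewrite mxrank_ker vSn0 subn1.
pose B : 'M[R]_(n, n.+1) := castmx (rk, erefl) (row_base (kermx (S *m v^T))).
have Bfree : row_free B by rewrite row_free_castmx row_base_free.
have BSv : B *m (S *m v^T) = 0.
  apply/sub_kermxP; rewrite eqmx_cast.
  by rewrite eq_row_base.
have [W [d [Wu WS WT]]] := IH _ _ (trmx_congr B Ssym) (posdefmx_congr Bfree Spos) (trmx_congr B Tsym).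
have vSB : v *m S *m B^T = 0.
  by apply: trmx_inj; rewrite !trmx_mul trmxK Ssym BSv trmx0.
pose Q : 'M[R]_(1 + n, 1 + n) := col_mx v (W *m B).
have QS : Q *m S *m Q^T = 1%:M.
  rewrite /Q tr_col_mx mul_col_mx mul_col_row vSv trmx_mul !mulmxA vSB mul0mx.
  rewrite -(mulmxA _ S) -(mulmxA _ B) BSv mulmx0.
  rewrite -[W *m B *m S *m B^T]mulmxA -(mulmxA W) [B *m (S *m _)]mulmxA WS.
  by rewrite -scalar_mx_block.
have TB : B *m T *m v^T = 0.
  rewrite -mulmxA -[T]Tsym -trmx_mul vT linearZ /= trmx_mul Ssym -scalemxAr.
  by rewrite BSv scaler0.
have QT : Q *m T *m Q^T = diag_mx (row_mx l%:M d).
  rewrite /Q tr_col_mx mul_col_mx mul_col_row trmx_mul !mulmxA vT -!scalemxAl vSv vSB.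
  rewrite mul0mx scaler0 -[W *m B *m T *m v^T]mulmxA -(mulmxA W) [B *m (T *m _)]mulmxA TB mulmx0.
  rewrite -[W *m B *m T *m B^T]mulmxA -(mulmxA W) [B *m (T *m _)]mulmxA WT.
  by rewrite diag_mx_row scale_scalar_mx mulr1; congr block_mx; apply/matrixP => i j; rewrite !ord1 !mxE eqxx.
exists Q, (row_mx (l%:M) d); split => //.
by have [] := mulmx1_unit (QS : _ *m _ = _); rewrite unitmx_mul => /andP[].
Qed.

End LinearAlgebra.

(** * The curvature operator and its logarithm *)

Section OperatorsOnTwoForms.
Context {R : realType} {n : nat}.
Implicit Types (g z v w A B : 'M[R]_n) (K L T : tensor4 (R := R) (n := n)).

(** Raising both indices turns a 2-form into a bivector; [contract4 T] is the
    action of [T] on bivectors. *)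
Definition raise g w : 'M[R]_n := invmx g *m w *m (invmx g)^T.
Definition contract4 T z : 'M[R]_n :=
  \matrix_(a, b) \sum_(e < n) \sum_(f < n) T a b e f * z e f.

Lemma contract4_is_linear T : linear (contract4 T).
Proof.
move=> k u v; apply/matrixP => a b; rewrite !mxE mulr_sumr -big_split /=.
apply: eq_bigr => e _; rewrite mulr_sumr -big_split /=.
by apply: eq_bigr => f _; rewrite !mxE mulrDr mulrCA.
Qed.
HB.instance Definition _ T :=
  GRing.isLinear.Build R 'M[R]_n 'M[R]_n *:%R (contract4 T) (contract4_is_linear T).

Lemma raise_is_linear g : linear (raise g).
Proof. by move=> k u v; rewrite /raise mulmxDr mulmxDl -scalemxAr -scalemxAl. Qed.
HB.instance Definition _ g :=
  GRing.isLinear.Build R 'M[R]_n 'M[R]_n *:%R (raise g) (raise_is_linear g).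

Lemma raiseE g w e f :
  raise g w e f = \sum_(c < n) \sum_(d < n) invmx g e c * w c d * invmx g f d.
Proof.
rewrite /raise mxE exchange_big /=; apply: eq_bigr => d _; rewrite !mxE mulr_suml.
by apply: eq_bigr.
Qed.

Lemma op_of_tensorE g T w : op_of_tensor g T w = 2^-1 *: contract4 T (raise g w).
Proof.
apply/matrixP => a b; rewrite !mxE; congr (_ * _).
rewrite pair_bigA [RHS]pair_bigA /=; under eq_bigr do rewrite pair_bigA /=.
rewrite exchange_big /=; apply: eq_bigr => -[e f] _ /=.
rewrite raiseE pair_bigA mulr_sumr; apply: eq_bigr => -[c d] _ /=; ring.
Qed.

Lemma form_dotE g v w : form_dot g v w = 2^-1 * \tr (v *m (raise g w)^T).
Proof.
congr (_ * _); rewrite /mxtrace; apply: eq_bigr => a _; rewrite !mxE.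
apply: eq_bigr => b _; rewrite [_^T _ _]mxE raiseE mulr_sumr; apply: eq_bigr => c _.
by rewrite mulr_sumr; apply: eq_bigr => d _; ring.
Qed.

Lemma op_of_tensor_is_linear g T : linear (op_of_tensor g T).
Proof. by move=> k u v; rewrite !op_of_tensorE !linearP /= !scalerA mulrC. Qed.
HB.instance Definition _ g T :=
  GRing.isLinear.Build R 'M[R]_n 'M[R]_n *:%R (op_of_tensor g T)
    (op_of_tensor_is_linear g T).

Lemma form_dotZr g c v w : form_dot g v (c *: w) = c * form_dot g v w.
Proof. by rewrite !form_dotE linearZ /= linearZ /= -scalemxAr linearZ /= mulrCA. Qed.

Lemma form_dotZl g c v w : form_dot g (c *: v) w = c * form_dot g v w.
Proof. by rewrite !form_dotE -scalemxAl linearZ /= mulrCA. Qed.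

Lemma form_dot0r g v : form_dot g v 0 = 0.
Proof. by rewrite form_dotE raddf0 trmx0 mulmx0 raddf0 mulr0. Qed.

Lemma trace_contract4_sym T u v : op_symmetric T ->
  \tr (contract4 T u *m v^T) = \tr (contract4 T v *m u^T).
Proof.
move=> [_ _ Tpair].
have E u' v' : \tr (contract4 T u' *m v'^T)
    = \sum_(p : 'I_n * 'I_n) \sum_(q : 'I_n * 'I_n) T p.1 p.2 q.1 q.2 * u' q.1 q.2 * v' p.1 p.2.
  rewrite /mxtrace -(pair_bigA _ (fun a b => \sum_(q : 'I_n * 'I_n) T a b q.1 q.2 * u' q.1 q.2 * v' a b)) /=.
  apply: eq_bigr => a _; rewrite mxE; apply: eq_bigr => b _; rewrite !mxE.
  by rewrite pair_bigA mulr_suml.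
rewrite !E exchange_big /=; apply: eq_bigr => p _; apply: eq_bigr => q _.
by rewrite Tpair; ring.
Qed.

Lemma form_dot_op_sym g T v w : op_symmetric T ->
  form_dot g (op_of_tensor g T v) w = form_dot g (op_of_tensor g T w) v.
Proof.
move=> Tsym; rewrite !form_dotE !op_of_tensorE -!scalemxAl !linearZ /=.
by rewrite trace_contract4_sym.
Qed.

Lemma raise_low g z : g^T = g -> g \in unitmx -> raise g (g *m z *m g) = z.
Proof.
move=> gs gu; rewrite /raise trmx_inv gs -!mulmxA mulmxV // mulmx1.
by rewrite mulmxA mulVmx // mul1mx.
Qed.

Lemma low_raise g w : g^T = g -> g \in unitmx -> g *m raise g w *m g = w.
Proof.
move=> gs gu; rewrite /raise trmx_inv gs !mulmxA mulmxV // mul1mx.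
by rewrite -mulmxA mulVmx // mulmx1.
Qed.

Lemma form_dotC g v w : g^T = g -> form_dot g v w = form_dot g w v.
Proof.
move=> gs; rewrite !form_dotE /raise; congr (_ * _).
have gI : (invmx g)^T = invmx g by rewrite trmx_inv gs.
rewrite !trmx_mul !trmxK gI -[LHS]mxtrace_tr !trmx_mul !trmxK gI.
by rewrite -!mulmxA mxtrace_mulC -!mulmxA.
Qed.

Lemma two_formD v w : two_form v -> two_form w -> two_form (v + w).
Proof. by rewrite /two_form => vw ww; rewrite raddfD /= vw ww opprD. Qed.

Lemma two_formZ c w : two_form w -> two_form (c *: w).
Proof. by rewrite /two_form => ww; rewrite linearZ /= ww scalerN. Qed.

Lemma two_form0 : two_form (0 : 'M[R]_n).
Proof. by rewrite /two_form trmx0 oppr0. Qed.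

Lemma two_form_sum N (P : pred 'I_N) (u : 'I_N -> 'M[R]_n) :
  (forall i, P i -> two_form (u i)) -> two_form (\sum_(i | P i) u i).
Proof.
move=> h; elim/big_ind : _ => //; [exact: two_form0 | exact: two_formD].
Qed.

Lemma two_form_op g T w : op_symmetric T -> two_form (op_of_tensor g T w).
Proof.
move=> [Ta _ _]; apply/matrixP => a b; rewrite op_of_tensorE !mxE -mulrN; congr (_ * _).
rewrite -sumrN; apply: eq_bigr => e _; rewrite -sumrN; apply: eq_bigr => f _.
by rewrite Ta mulNr.
Qed.

Lemma mxtrace_tr_ge0 z : 0 <= \tr (z *m z^T).
Proof.
rewrite /mxtrace sumr_ge0// => i _; rewrite mxE sumr_ge0// => j _.
by rewrite mxE -expr2 sqr_ge0.
Qed.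

Lemma mxtrace_tr_gt0 z : z != 0 -> 0 < \tr (z *m z^T).
Proof.
move=> zn0; rewrite lt_neqAle mxtrace_tr_ge0 andbT eq_sym.
apply: contra zn0 => /eqP tz; apply/eqP/matrixP => i j; apply/eqP.
have ge i' : 0 <= (z *m z^T) i' i'.
  by rewrite mxE sumr_ge0// => k _; rewrite mxE -expr2 sqr_ge0.
have /eqP : (z *m z^T) i i = 0.
  by apply/eqP; move/eqP: tz; rewrite /mxtrace psumr_eq0// => /allP/(_ i (mem_index_enum _)).
rewrite mxE psumr_eq0 => [|k _]; last by rewrite mxE -expr2 sqr_ge0.
move=> /allP/(_ j (mem_index_enum _)) /=; rewrite mxE -expr2 sqrf_eq0.
by rewrite mxE.
Qed.

Lemma mxvec_dot v z : (mxvec v *m (mxvec z)^T) 0 0 = \tr (v *m z^T).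
Proof.
rewrite mxE /mxtrace.
rewrite (reindex (uncurry (@mxvec_index n n))) /=; last exact: curry_mxvec_bij.
transitivity (\sum_(a < n) \sum_(b < n) mxvec v 0 (mxvec_index a b) * (mxvec z)^T (mxvec_index a b) 0).
  by rewrite pair_bigA; apply: eq_bigr => -[].
apply: eq_bigr => a _; rewrite mxE; apply: eq_bigr => b _.
by rewrite [_^T _ _]mxE !mxvecE [_^T _ _]mxE.
Qed.

Lemma form_matrix_sym N (S : 'M[R]_N) :
  (forall u v : 'rV_N, (u *m S *m v^T) 0 0 = (v *m S *m u^T) 0 0) -> S^T = S.
Proof.
move=> h; apply/matrixP => i j; rewrite mxE.
have E i' j' : S i' j' = ((delta_mx 0 i' : 'rV_N) *m S *m (delta_mx 0 j' : 'rV_N)^T) 0 0.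
  by rewrite -rowE trmx_delta -colE !mxE.
by rewrite !E h.
Qed.

(** Writing [g] as [A A^T] turns the trace into the squared Frobenius norm of
    [A^T z A]. *)
Lemma trace_low_gt0 g z : g^T = g -> posdefmx g -> z != 0 ->
  0 < \tr (g *m z *m g *m z^T).
Proof.
move=> gs gp zn0.
have [V [_ [Vu Vg _]]] := simultaneous_diag gs gp gs.
pose A := invmx V.
have gE : g = A *m A^T.
  rewrite -[g]mulmx1 -(mulmxV (_ : V^T \in unitmx)) ?unitmx_tr//.
  rewrite -[g](mulKmx Vu) !mulmxA -(mulmxA A V) -(mulmxA A) Vg mulmx1.
  by rewrite /A trmx_inv.
have -> : \tr (g *m z *m g *m z^T) = \tr ((A^T *m z *m A) *m (A^T *m z *m A)^T).
  by rewrite gE !trmx_mul trmxK -!mulmxA mxtrace_mulC !mulmxA.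
apply: mxtrace_tr_gt0; apply: contra zn0 => /eqP h.
have Au : A \in unitmx by rewrite unitmx_inv.
have ATu : A^T \in unitmx by rewrite unitmx_tr.
by rewrite -[z](mulKmx ATu) -[X in _ *m X](mulmxK Au) h mul0mx mulmx0.
Qed.

(** The spectral theorem for curvature-like operators. The bivectors form a
    subspace of all matrices; the extra (symmetric) eigenvectors of the
    operator on all matrices belong to the eigenvalue 0 and are replaced by the
    zero form, so that the family below is a Parseval frame of eigenforms
    rather than a basis. *)
Lemma eigenforms g K : g^T = g -> posdefmx g -> op_symmetric K -> op_posdef g K ->
  exists N (w : 'I_N -> 'M[R]_n) (d : 'I_N -> R),
    [/\ forall k, two_form (w k), forall k, 0 < d k,
        forall k, op_of_tensor g K (w k) = d k *: w k &
        forall u, two_form u -> u = \sum_k form_dot g (w k) u *: w k].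
Proof.
move=> gs gp Ks Kp; have gu := posdefmx_unit gp.
(* [S] and [T] are the matrices, on the space of all matrices, of the metric
   on bivectors and of the quadratic form of [K]; a simultaneous
   diagonalization of the two gives the eigenforms. *)
pose fS : {linear 'M[R]_n -> 'M[R]_n} := ( *:%R 2^-1) \o (mulmxr g \o mulmx g).
pose fT : {linear 'M[R]_n -> 'M[R]_n} := ( *:%R 4^-1) \o contract4 K.
pose S := lin_mx fS; pose T := lin_mx fT.
have SE (u v : 'rV_(n * n)) : (u *m S *m v^T) 0 0 = 2^-1 * \tr (g *m vec_mx u *m g *m (vec_mx v)^T).
  rewrite -{1}[u]vec_mxK -{1}[v]vec_mxK mul_vec_lin mxvec_dot /=.
  by rewrite -scalemxAl linearZ.
have TE (u v : 'rV_(n * n)) : (u *m T *m v^T) 0 0 = 4^-1 * \tr (contract4 K (vec_mx u) *m (vec_mx v)^T).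
  rewrite -{1}[u]vec_mxK -{1}[v]vec_mxK mul_vec_lin mxvec_dot /=.
  by rewrite -scalemxAl linearZ.
have Ssym : S^T = S.
  apply: form_matrix_sym => u v; rewrite !SE; congr (_ * _).
  by rewrite -[LHS]mxtrace_tr !trmx_mul trmxK gs -!mulmxA [RHS]mxtrace_mulC -!mulmxA.
have Tsym : T^T = T.
  by apply: form_matrix_sym => u v; rewrite !TE trace_contract4_sym.
have Spos : posdefmx S.
  move=> u un0; rewrite SE mulr_gt0 ?invr_gt0 ?ltr0n// trace_low_gt0//.
  by apply: contra un0 => /eqP h; rewrite -[u]vec_mxK h linear0.
have [W [d [Wu WS WT]]] := simultaneous_diag Ssym Spos Tsym.
have WinvE : invmx W = S *m W^T.
  by rewrite -[invmx W]mulmx1 -WS !mulmxA mulVmx// mul1mx.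
have WTE : W *m T = diag_mx d *m W *m S.
  by rewrite -[LHS]mulmx1 -(mulmx1C WS) !mulmxA WT.
pose z k := vec_mx (row k W); pose w k := g *m z k *m g.
have Kz k : contract4 K (z k) = (2 * d 0 k) *: w k.
  have /(congr1 (row k)) := WTE; rewrite -mulmxA !row_mul row_diag_mx -scalemxAl -rowE row_mul.
  rewrite -[row k W]vec_mxK !mul_vec_lin /= => kE.
  have {}kE : mxvec (4^-1 *: contract4 K (z k)) = mxvec (d 0 k *: (2^-1 *: w k)).
    by rewrite [RHS]linearZ.
  have /(congr1 ( *:%R 4)) := can_inj mxvecK kE.
  rewrite !scalerA divff ?scale1r ?pnatr_eq0// => ->; congr (_ *: _).
  by field.
have Kw k : op_of_tensor g K (w k) = d 0 k *: w k.
  by rewrite op_of_tensorE raise_low// Kz scalerA mulKf ?pnatr_eq0.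
have dotw k u : form_dot g (w k) (g *m u *m g) = (row k W *m S *m (mxvec u)^T) 0 0.
  by rewrite SE mxvecK form_dotE raise_low.
have wE u : u = \sum_k form_dot g (w k) u *: w k.
  have uE : u = g *m raise g u *m g by rewrite low_raise.
  set y := raise g u in uE.
  have yE : mxvec y = \sum_k form_dot g (w k) u *: row k W.
    rewrite -[LHS](mulmxKV Wu) mulmx_sum_row; apply: eq_bigr => k _; congr (_ *: _).
    rewrite WinvE mulmxA uE dotw form_sym// mxE [RHS]mxE.
    by apply: eq_bigr => j _; congr (_ * _); rewrite !mxE.
  rewrite {1}uE -[y]mxvecK yE linear_sum /= mulmx_sumr mulmx_suml.
  by apply: eq_bigr => k _; rewrite linearZ /= -scalemxAr -scalemxAl.
have ww k : form_dot g (w k) (w k) = 1.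
  rewrite dotw /z vec_mxK.
  have /matrixP/(_ k k) := WS; rewrite [X in _ = X]mxE eqxx mulr1n => <-.
  rewrite -row_mul mxE [RHS]mxE.
  by apply: eq_bigr => j _; rewrite [row _ _ _ _]mxE; congr (_ * _); rewrite !mxE.
have wform k : d 0 k != 0 -> two_form (w k).
  move=> dn0; have -> : w k = (d 0 k)^-1 *: op_of_tensor g K (w k).
    by rewrite Kw scalerA mulVf ?scale1r.
  by apply: two_formZ; exact: two_form_op.
exists (n * n)%N, (fun k => if d 0 k == 0 then 0 else w k),
  (fun k => if d 0 k == 0 then 1 else d 0 k); split.
- by move=> k; case: eqVneq => [_|]; [exact: two_form0|exact: wform].
- move=> k; case: eqVneq => // dn0.
  have := Kp (w k) (wform k dn0); rewrite Kw form_dotZr ww mulr1; apply.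
  by apply/eqP => w0; have := ww k; rewrite w0 form_dot0r => /eqP; rewrite eq_sym oner_eq0.
- by move=> k; case: eqVneq => // _; rewrite linear0 scaler0.
move=> u uf; rewrite {1}[u]wE (bigID (fun k => d 0 k == 0)) /=.
set u0 := \sum_(_ | _) _; set u1 := \sum_(_ | _) _.
have u1E : u1 = \sum_k form_dot g (if d 0 k == 0 then 0 else w k) u *: (if d 0 k == 0 then 0 else w k).
  rewrite [RHS](bigID (fun k => d 0 k == 0)) /= big1 ?add0r => [|k ->]; last by rewrite scaler0.
  by apply: eq_bigr => k /negbTE ->.
suff -> : u0 = 0 by rewrite add0r.
have u0f : two_form u0.
  have -> : u0 = u - u1 by rewrite [in RHS](wE u) [in RHS](bigID (fun k => d 0 k == 0)) /= addrK.
  apply: two_formD => //; rewrite -scaleN1r; apply: two_formZ; apply: two_form_sum => k dk.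
  by apply: two_formZ; exact: wform.
apply/eqP/negPn/negP => /(Kp _ u0f).
suff -> : op_of_tensor g K u0 = 0 by rewrite form_dot0r ltxx.
by rewrite linear_sum big1 //= => k /eqP dk; rewrite linearZ /= Kw dk scale0r scaler0.
Qed.

(** The logarithm is written as the spectral sum of [ln (d k)] times the
    square of the eigenform [w k]. *)
Lemma is_op_log_exists g K : g^T = g -> posdefmx g -> op_symmetric K ->
  op_posdef g K -> exists L, is_op_log g K L.
Proof.
move=> gs gp Ks Kp; have [N [w [d [wf d0 Kw wE]]]] := eigenforms gs gp Ks Kp.
pose L : tensor4 := fun a b c e => \sum_k ln (d k) * (w k a b * w k c e).
have wanti k a b : w k a b = - w k b a by have /matrixP/(_ b a) := wf k; rewrite !mxE.
exists L; split.
  split=> a b c e; rewrite /L -?sumrN; apply: eq_bigr => k _.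
  - by rewrite (wanti k a b) mulNr mulrN.
  - by rewrite (wanti k c e) !mulrN.
  - by congr (_ * _); rewrite mulrC.
move=> u l uf Ku.
have LE : op_of_tensor g L u = \sum_k (ln (d k) * form_dot g (w k) u) *: w k.
  rewrite op_of_tensorE; apply/matrixP => a b; rewrite !mxE summxE.
  transitivity (2^-1 * \sum_e \sum_f \sum_k ln (d k) * (w k a b * w k e f) * raise g u e f).
    by congr (_ * _); apply: eq_bigr => e _; apply: eq_bigr => f _; rewrite mulr_suml.
  under eq_bigr do rewrite exchange_big /=; rewrite exchange_big /= mulr_sumr.
  apply: eq_bigr => k _; rewrite !mxE form_dotE /mxtrace.
  rewrite !mulr_sumr !mulr_suml; apply: eq_bigr => e _.
  rewrite mxE !mulr_sumr !mulr_suml; apply: eq_bigr => f _.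
  by rewrite [_^T _ _]mxE; ring.
rewrite LE [in RHS](wE _ uf) scaler_sumr; apply: eq_bigr => k _; rewrite scalerA.
have := form_dot_op_sym g (w k) u Ks.
rewrite Kw Ku !form_dotZl (form_dotC u)// => /eqP.
rewrite -subr_eq0 -mulrBl mulf_eq0 subr_eq0 => /orP[/eqP -> //|/eqP ->].
by rewrite !mulr0.
Qed.

Lemma op_logP g K : g^T = g -> posdefmx g -> op_symmetric K ->
  op_posdef g K -> is_op_log g K (op_log g K).
Proof.
move=> gs gp Ks Kp; rewrite /op_log.
have [L KL] := is_op_log_exists gs gp Ks Kp.
by case: xgetP => [L' _ //|] /(_ L).
Qed.

(** Expand [u] along the eigenforms of [K]. The logarithm is self-adjoint and
    acts on [w k] by [ln (d k)], so [u] is orthogonal to every [w k] with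
    [ln (d k) != s]. *)
Lemma is_op_log_exp g K L u s : g^T = g -> posdefmx g -> op_symmetric K ->
  op_posdef g K -> is_op_log g K L -> two_form u ->
  op_of_tensor g L u = s *: u -> op_of_tensor g K u = expR s *: u.
Proof.
move=> gs gp Ks Kp [Ls KL] uf Lu; have [N [w [d [wf d0 Kw wE]]]] := eigenforms gs gp Ks Kp.
rewrite [in LHS](wE _ uf) [in RHS](wE _ uf) linear_sum scaler_sumr; apply: eq_bigr => k _ /=.
rewrite linearZ /= Kw !scalerA.
have := form_dot_op_sym g (w k) u Ls.
rewrite (KL _ _ (wf k) (Kw k)) Lu !form_dotZl (form_dotC u)// => /eqP.
rewrite -subr_eq0 -mulrBl mulf_eq0 subr_eq0 => /orP[/eqP <-|/eqP ->].
  by rewrite lnK ?posrE// mulrC.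
by rewrite mulr0 mul0r.
Qed.

End OperatorsOnTwoForms.

(** * Products of symmetric forms as operators on 2-forms *)

Section Frames.
Context {R : realType} {n : nat}.
Implicit Types (g z v w A B V : 'M[R]_n) (K L T : tensor4 (R := R) (n := n)).

Definition kulkarni A B : tensor4 (R := R) (n := n) := fun a b c d =>
  A a c * B b d + B a c * A b d - B a d * A b c - A a d * B b c.

Definition gauss_tensor A : tensor4 (R := R) (n := n) := fun a b c d =>
  A a c * A b d - A a d * A b c.

Lemma gauss_tensorE A a b c d :
  gauss_tensor A a b c d = 2^-1 * kulkarni A A a b c d.
Proof. by rewrite /gauss_tensor /kulkarni; field. Qed.

Lemma gauss_tensorN A a b c d : gauss_tensor (- A) a b c d = gauss_tensor A a b c d.
Proof. by rewrite /gauss_tensor !mxE; ring. Qed.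

Lemma kulkarni_sym A B : A^T = A -> B^T = B -> op_symmetric (kulkarni A B).
Proof.
move=> As Bs.
have Aij i j : A i j = A j i by rewrite -{1}As mxE.
have Bij i j : B i j = B j i by rewrite -{1}Bs mxE.
split=> a b c d; rewrite /kulkarni; [ring|ring|].
by rewrite (Aij c a) (Aij d b) (Aij d a) (Aij c b) (Bij c a) (Bij d b) (Bij d a) (Bij c b); ring.
Qed.

Lemma gauss_tensor_sym A : A^T = A -> op_symmetric (gauss_tensor A).
Proof.
move=> As; have [s1 s2 s3] := kulkarni_sym As As.
split=> a b c d; rewrite !gauss_tensorE; [rewrite s1|rewrite s2|rewrite s3] => //; ring.
Qed.

Definition bivector V (i j : 'I_n) : 'M[R]_n :=
  (row i V)^T *m row j V - (row j V)^T *m row i V.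
Definition wedge g V i j : 'M[R]_n := g *m bivector V i j *m g.

Lemma bivectorE V i j a b : bivector V i j a b = V i a * V j b - V j a * V i b.
Proof. by rewrite !mxE !big_ord1 !mxE. Qed.

Lemma bivector_tr V i j : (bivector V i j)^T = - bivector V i j.
Proof. by apply/matrixP => a b; rewrite mxE [RHS]mxE !bivectorE; ring. Qed.

Lemma wedge_two_form g V i j : g^T = g -> two_form (wedge g V i j).
Proof.
by move=> gs; rewrite /two_form /wedge !trmx_mul gs bivector_tr mulmxA mulmxN mulNmx.
Qed.

(** Contracting with a bivector the Kulkarni-Nomizu product acts by
    sandwiching, which makes it diagonal on the elementary bivectors of a
    frame that diagonalizes both factors. *)
Lemma contract4_kulkarni A B z : A^T = A -> B^T = B -> z^T = - z ->
  contract4 (kulkarni A B) z = 2 *: (A *m z *m B + B *m z *m A).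
Proof.
move=> As Bs zs.
have Aij i j : A i j = A j i by rewrite -{1}As mxE.
have Bij i j : B i j = B j i by rewrite -{1}Bs mxE.
have zij i j : z i j = - z j i by have /matrixP/(_ j i) := zs; rewrite !mxE.
have E A' B' a b : (A' *m z *m B') a b = \sum_e \sum_f A' a e * z e f * B' f b.
  rewrite mxE exchange_big; apply: eq_bigr => f _; rewrite mxE mulr_suml.
  by apply: eq_bigr.
apply/matrixP => a b; rewrite [LHS]mxE [RHS]mxE [X in 2 * X]mxE.
transitivity ((A *m z *m B) a b + (B *m z *m A) a b + (B *m z *m A) a b + (A *m z *m B) a b).
  rewrite !E -!big_split /=.
  have -> : \sum_e \sum_f kulkarni A B a b e f * z e f =
     \sum_e \sum_f (A a e * z e f * B f b + B a e * z e f * A f b)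
   - \sum_e \sum_f (B a f * A b e + A a f * B b e) * z e f.
    rewrite -sumrB; apply: eq_bigr => e _; rewrite -sumrB; apply: eq_bigr => f _.
    by rewrite /kulkarni (Bij f b) (Aij f b); ring.
  rewrite [X in _ - X]exchange_big /= -sumrB; apply: eq_bigr => e _.
  rewrite -!big_split -sumrB /=; apply: eq_bigr => f _.
  by rewrite (zij f e) (Aij b f) (Bij b f); ring.
by rewrite !E; ring.
Qed.

Lemma contract4_bivector T V i j a b : (forall a b c d, T a b c d = - T a b d c) ->
  contract4 T (bivector V i j) a b =
  2 * (V *m (\matrix_(e, f) T a b e f) *m V^T) i j.
Proof.
move=> Ta; rewrite mxE.
have -> : (V *m (\matrix_(e, f) T a b e f) *m V^T) i j
   = \sum_e \sum_f T a b e f * (V i e * V j f).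
  rewrite mxE exchange_big; apply: eq_bigr => f _; rewrite !mxE mulr_suml.
  by apply: eq_bigr => e _; rewrite !mxE; ring.
under eq_bigr do under eq_bigr do rewrite bivectorE mulrBr.
under eq_bigr do rewrite sumrB.
rewrite sumrB [X in _ - X]exchange_big /=.
rewrite -[X in _ - X]opprK -sumrN opprK.
have -> : \sum_(i0 < n) - \sum_(i1 < n) T a b i1 i0 * (V j i1 * V i i0) =
  \sum_e \sum_f T a b e f * (V i e * V j f).
  by apply: eq_bigr => e _; rewrite -sumrN; apply: eq_bigr => f _; rewrite Ta; ring.
by ring.
Qed.

Lemma op_wedge g T V i j : g^T = g -> posdefmx g ->
  op_of_tensor g T (wedge g V i j) = 2^-1 *: contract4 T (bivector V i j).
Proof.
by move=> gs gp; rewrite op_of_tensorE raise_low//; exact: posdefmx_unit.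
Qed.

(** The elementary 2-forms of a frame span all 2-forms. *)
Lemma wedge_ext g V T T' : g^T = g -> posdefmx g -> V \in unitmx ->
  (forall a b c d, T a b c d = - T a b d c) ->
  (forall a b c d, T' a b c d = - T' a b d c) ->
  (forall i j, op_of_tensor g T (wedge g V i j) = op_of_tensor g T' (wedge g V i j)) ->
  forall a b c d, T a b c d = T' a b c d.
Proof.
move=> gs gp Vu Ta Ta' TT' a b c d.
have Vtu : V^T \in unitmx by rewrite unitmx_tr.
suff /matrixP/(_ c d) : (\matrix_(e, f) T a b e f) = \matrix_(e, f) T' a b e f by rewrite !mxE.
apply: (can_inj (mulKmx Vu)); apply: (can_inj (mulmxK Vtu)).
apply/matrixP => i j; have /(congr1 ( *:%R 2)) := TT' i j.
rewrite !op_wedge// !scalerA divff ?pnatr_eq0// !scale1r => /matrixP/(_ a b).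
rewrite !contract4_bivector// => /mulfI; apply; by rewrite pnatr_eq0.
Qed.

Lemma frame_invmx g V : V *m g *m V^T = 1%:M -> V \in unitmx -> invmx V = g *m V^T.
Proof. by move=> Vg Vu; rewrite -[LHS]mulmx1 -Vg !mulmxA mulVmx// mul1mx. Qed.

Lemma frame_inv_metric g V : V *m g *m V^T = 1%:M -> V \in unitmx -> invmx g = V^T *m V.
Proof.
move=> Vg Vu; have gu : g \in unitmx.
  have : V *m g *m V^T \in unitmx by rewrite Vg unitmx1.
  by rewrite !unitmx_mul => /andP[/andP[]].
have : g *m (V^T *m V) = 1%:M by rewrite mulmxA -(frame_invmx Vg Vu) mulVmx.
by move=> /(congr1 (mulmx (invmx g))); rewrite mulKmx// mulmx1.
Qed.

Lemma frame_diagE V A (a : 'rV_n) : V \in unitmx -> V *m A *m V^T = diag_mx a ->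
  A = invmx V *m diag_mx a *m (invmx V)^T.
Proof.
move=> Vu <-; rewrite trmx_inv -!mulmxA mulmxV ?unitmx_tr// mulmx1.
by rewrite mulmxA mulVmx// mul1mx.
Qed.

(** The rows of a frame diagonalizing [A] are the eigenvectors of [A] relative
    to [g]. *)
Lemma frame_diag_row g V A (a : 'rV_n) i : V *m g *m V^T = 1%:M -> V \in unitmx ->
  g^T = g -> A^T = A ->
  V *m A *m V^T = diag_mx a -> row i V *m A = a 0 i *: (row i V *m g).
Proof.
move=> Vg Vu gs As VA; rewrite -!row_mul.
have -> : V *m A = diag_mx a *m (V *m g).
  have Vi := frame_invmx Vg Vu.
  have -> : V *m g = (invmx V)^T by rewrite Vi trmx_mul trmxK gs.
  by rewrite -VA trmx_inv -mulmxA mulmxV ?unitmx_tr// mulmx1.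
by rewrite row_mul row_diag_mx -scalemxAl -rowE.
Qed.

Lemma op_kulkarni_wedge g V A B (a b : 'rV_n) i j :
  g^T = g -> posdefmx g -> V \in unitmx -> V *m g *m V^T = 1%:M ->
  A^T = A -> B^T = B -> V *m A *m V^T = diag_mx a -> V *m B *m V^T = diag_mx b ->
  op_of_tensor g (kulkarni A B) (wedge g V i j) =
  (a 0 i * b 0 j + b 0 i * a 0 j) *: wedge g V i j.
Proof.
move=> gs gp Vu Vg As Bs VA VB.
rewrite op_wedge// contract4_kulkarni ?bivector_tr// scalerA mulVf ?scale1r ?pnatr_eq0//.
have rA k : row k V *m A = a 0 k *: (row k V *m g) by exact: frame_diag_row VA.
have rB k : row k V *m B = b 0 k *: (row k V *m g) by exact: frame_diag_row VB.
have cA k : A *m (row k V)^T = a 0 k *: (g *m (row k V)^T).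
  by apply: trmx_inj; rewrite linearZ /= !trmx_mul trmxK As gs rA.
have cB k : B *m (row k V)^T = b 0 k *: (g *m (row k V)^T).
  by apply: trmx_inj; rewrite linearZ /= !trmx_mul trmxK Bs gs rB.
have E X Y : X *m bivector V i j *m Y =
    (X *m (row i V)^T) *m (row j V *m Y) - (X *m (row j V)^T) *m (row i V *m Y).
  by rewrite /bivector mulmxBr mulmxBl !mulmxA.
rewrite /wedge !E !rA !rB !cA !cB -!scalemxAl -!scalemxAr !scalerA.
set x := _ *m _; set y := _ *m _.
by apply/matrixP => p q; rewrite !mxE; ring.
Qed.

Lemma op_gauss_wedge g V A (a : 'rV_n) i j :
  g^T = g -> posdefmx g -> V \in unitmx -> V *m g *m V^T = 1%:M ->
  A^T = A -> V *m A *m V^T = diag_mx a ->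
  op_of_tensor g (gauss_tensor A) (wedge g V i j) = (a 0 i * a 0 j) *: wedge g V i j.
Proof.
move=> gs gp Vu Vg As VA.
have -> : op_of_tensor g (gauss_tensor A) (wedge g V i j) =
    2^-1 *: op_of_tensor g (kulkarni A A) (wedge g V i j).
  rewrite !op_of_tensorE; congr (_ *: _); apply/matrixP => p q; rewrite !mxE mulr_sumr.
  apply: eq_bigr => e _; rewrite mulr_sumr; apply: eq_bigr => f _.
  by rewrite gauss_tensorE mulrA.
rewrite (op_kulkarni_wedge _ _ gs gp Vu Vg As As VA VA) scalerA; congr (_ *: _).
by field.
Qed.

Lemma posdef_diag (d : 'rV[R]_n) : posdefmx (diag_mx d) <-> forall i, 0 < d 0 i.
Proof.
split=> [dp i|dp v vn0].
  have : delta_mx 0 i != 0 :> 'rV[R]_n.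
    by apply/eqP => /rowP/(_ i); rewrite !mxE !eqxx => /eqP; rewrite oner_eq0.
  move=> /dp; rewrite -rowE row_diag_mx -scalemxAl mxE trmx_delta mul_delta_mx.
  by rewrite mxE !eqxx mulr1.
have E : (v *m diag_mx d *m v^T) 0 0 = \sum_i d 0 i * v 0 i ^+ 2.
  by rewrite mul_mx_diag mxE; apply: eq_bigr => i _; rewrite !mxE; ring.
have h i : 0 <= d 0 i * v 0 i ^+ 2 by rewrite mulr_ge0 ?sqr_ge0// ltW.
rewrite E lt_neqAle sumr_ge0 // andbT eq_sym; apply: contra vn0.
rewrite psumr_eq0// => /allP vd; apply/eqP/rowP => i; rewrite mxE.
have := vd i (mem_index_enum _); rewrite /= mulf_eq0 gt_eqF// sqrf_eq0 => /eqP//.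
Qed.

Lemma posdef_frame V A (a : 'rV_n) : V \in unitmx -> V *m A *m V^T = diag_mx a ->
  posdefmx A <-> forall i, 0 < a 0 i.
Proof.
move=> Vu VA; rewrite -posdef_diag; split=> [Ap|dp].
  by rewrite -VA; apply: posdefmx_congr => //; rewrite row_free_unit.
rewrite (frame_diagE Vu VA); apply: posdefmx_congr => //.
by rewrite row_free_unit unitmx_inv.
Qed.

Lemma wedge_neq0 g V i j : posdefmx g -> V \in unitmx -> i != j -> wedge g V i j != 0.
Proof.
move=> gp Vu ij; have gu := posdefmx_unit gp.
apply: contra_neq ij => w0.
have z0 : bivector V i j = 0.
  by rewrite -[bivector V i j](mulKmx gu) -[X in _ *m X](mulmxK gu) -/(wedge _ _ _ _) w0 mul0mx mulmx0.
have E : (invmx V)^T *m bivector V i j *m invmx V = 0 by rewrite z0 mulmx0 mul0mx.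
have r k : row k V *m invmx V = delta_mx 0 k by rewrite rowE -mulmxA mulmxV// mulmx1.
have : ((delta_mx 0 i : 'rV[R]_n)^T *m (delta_mx 0 j : 'rV[R]_n)
        - (delta_mx 0 j : 'rV[R]_n)^T *m (delta_mx 0 i : 'rV[R]_n)) = 0.
  rewrite -!r !trmx_mul -E /bivector mulmxBr mulmxBl !mulmxA //.
rewrite !trmx_delta !mul_delta_mx => /matrixP/(_ i j); rewrite !mxE !eqxx /=.
by case: eqVneq => [->//|_] /eqP; rewrite andFb subr0 oner_eq0.
Qed.

Lemma posdef_wedge_eigen g V K i j l : g^T = g -> posdefmx g -> V \in unitmx ->
  op_posdef g K -> i != j ->
  op_of_tensor g K (wedge g V i j) = l *: wedge g V i j -> 0 < l.
Proof.
move=> gs gp Vu Kp ij Kw.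
have wf := wedge_two_form V i j gs; have wn0 := wedge_neq0 gp Vu ij.
have := Kp _ wf wn0; rewrite Kw form_dotZr.
have -> : form_dot g (wedge g V i j) (wedge g V i j) =
   2^-1 * \tr (g *m bivector V i j *m g *m (bivector V i j)^T).
  by rewrite form_dotE raise_low// posdefmx_unit.
rewrite pmulr_lgt0// mulr_gt0 ?invr_gt0 ?ltr0n// trace_low_gt0//.
by apply: contra_neq wn0 => w0; rewrite /wedge w0 mulmx0 mul0mx.
Qed.

(** In a frame diagonalizing [h] the eigenvalues of the curvature operator are
    the products [l_i l_j] with [i != j]; numbers whose pairwise products are
    positive are nonzero and share one sign. *)
Lemma gauss_definite g K h : (3 <= n)%N -> g^T = g -> posdefmx g -> h^T = h ->
  (forall a b c d, K a b c d = gauss_tensor h a b c d) -> op_posdef g K ->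
  posdefmx h \/ posdefmx (- h).
Proof.
move=> n3 gs gp hs Kh Kp; have [V [l [Vu Vg Vh]]] := simultaneous_diag gs gp hs.
have KE w : op_of_tensor g K w = op_of_tensor g (gauss_tensor h) w.
  by congr op_of_tensor; do 4 (apply/funext => ?); rewrite Kh.
have pos i j : i != j -> 0 < l 0 i * l 0 j.
  by move=> ij; apply: (posdef_wedge_eigen gs gp Vu Kp ij); rewrite KE (op_gauss_wedge _ _ gs gp Vu Vg hs Vh).
pose i0 : 'I_n := Ordinal (leq_trans (isT : 0 < 3)%N n3).
pose i1 : 'I_n := Ordinal (leq_trans (isT : 1 < 3)%N n3).
have hN : V *m - h *m V^T = diag_mx (- l).
  by rewrite mulmxN mulNmx Vh; apply/matrixP => i j; rewrite !mxE mulNrn.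
have [l0|l0|l0] := ltgtP 0 (l 0 i0).
- left; apply/(posdef_frame Vu Vh) => i.
  by have [->//|/pos] := eqVneq i i0; rewrite pmulr_lgt0.
- right; apply/(posdef_frame Vu hN) => i; rewrite mxE oppr_gt0.
  by have [->//|/pos] := eqVneq i i0; rewrite nmulr_lgt0.
- by have := pos i1 i0 isT; rewrite -l0 mulr0 ltxx.
Qed.

End Frames.

(** * The exponential of a symmetric tensor *)

Section Exponential.
Context {R : realType}.

(** Convergence of matrices is entrywise; the statement covers every filter
    since it also serves for row vectors depending on a point. *)
Lemma cvg_mx (T : Type) (F : set_system T) {FF : Filter F} m p
    (f : T -> 'M[R]_(m, p)) (L : 'M[R]_(m, p)) :
  (forall i j, (fun x => f x i j) @ F --> L i j) -> f @ F --> L.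
Proof.
move=> h A [P LP PA]; rewrite /nbhs /=.
apply: (@filterS _ F _ [set x | forall i j, P i j (f x i j)]).
  by move=> x; exact: PA.
apply: filter_forall => i; apply: filter_forall => j.
exact: h (LP i j).
Qed.

Lemma cvg_sumr (T : Type) (F : set_system T) {FF : Filter F} (I : finType)
    (f : I -> T -> R) (l : I -> R) :
  (forall i, f i x @[x --> F] --> l i) ->
  \sum_i f i x @[x --> F] --> \sum_i l i.
Proof. by move=> h; apply: cvg_big => //; exact: add_continuous. Qed.

(** Conjugation commutes with the partial sums of the exponential series,
    which are diagonal in the conjugated form and converge entry by entry. *)
Lemma expmx_conj n (V : 'M[R]_n) (d : 'rV[R]_n) : V \in unitmx ->
  expmx (invmx V *m diag_mx d *m V) =
  invmx V *m diag_mx (\row_i expR (d 0 i)) *m V.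
Proof.
move=> Vu; apply/cvg_lim; first exact: norm_hausdorff.
set A := invmx V *m diag_mx d *m V.
have AX k : A ^+ k = invmx V *m diag_mx (\row_i d 0 i ^+ k) *m V.
  elim: k => [|k IH].
    rewrite expr0; have -> : diag_mx (\row_i d 0 i ^+ 0) = 1%:M :> 'M[R]_n.
      by apply/matrixP => i j; rewrite !mxE expr0.
    by rewrite mulmx1 mulVmx.
  rewrite exprS IH -[A * _]/(A *m _) /A !mulmxA mulmxK// -(mulmxA (invmx V)).
  congr (_ *m _ *m _); rewrite mul_diag_mx; apply/matrixP => i j.
  by rewrite !mxE mulrnAr exprS.
have E N : series (fun k => (k`!%:R)^-1 *: A ^+ k) N =
    invmx V *m diag_mx (\row_i series (exp_coeff (d 0 i)) N) *m V.
  rewrite /series /=; apply/matrixP => i j; rewrite summxE.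
  under eq_bigr do rewrite AX mxE mxE.
  rewrite mxE; under eq_bigr do rewrite mulr_sumr.
  rewrite exchange_big; apply: eq_bigr => k _ /=.
  rewrite mul_mx_diag [in RHS]mxE mxE mulr_sumr mulr_suml; apply: eq_bigr => l _.
  by rewrite mul_mx_diag !mxE /exp_coeff /=; ring.
rewrite (_ : series _ = (fun N => invmx V *m diag_mx (\row_i series (exp_coeff (d 0 i)) N) *m V)); last first.
  by apply/funext => N; exact: E.
apply: cvg_mx => i j.
rewrite (_ : (fun x => _) = (fun N => \sum_k (invmx V i k * series (exp_coeff (d 0 k)) N * V k j))); last first.
  by apply/funext => N; rewrite mxE; apply: eq_bigr => k _; rewrite mul_mx_diag !mxE.
have -> : (invmx V *m diag_mx (\row_i expR (d 0 i)) *m V) i j =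
   \sum_k (invmx V i k * expR (d 0 k) * V k j).
  by rewrite mxE; apply: eq_bigr => k _; rewrite mul_mx_diag !mxE.
apply: cvg_sumr => k; apply: cvgMr_tmp; apply: cvgMl_tmp.
exact: is_cvg_series_exp_coeff.
Qed.

(** A frame orthonormal for [g] turns the endomorphism [P g^-1] into a
    diagonal matrix, and lowering its exponential again gives the exponentials
    on the diagonal. *)
Lemma exp_sym_frame n (g P V : 'M[R]_n) (s : 'rV_n) : V \in unitmx ->
  V *m g *m V^T = 1%:M -> V *m P *m V^T = diag_mx s ->
  V *m exp_sym g P *m V^T = diag_mx (\row_i expR (s 0 i)).
Proof.
move=> Vu Vg VP; have Vi := frame_invmx Vg Vu; have gE := frame_inv_metric Vg Vu.
have -> : exp_sym g P = invmx V *m diag_mx (\row_i expR (s 0 i)) *m V *m g.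
  have PE : P *m invmx g = invmx V *m diag_mx s *m V.
    by rewrite gE -VP !mulmxA mulVmx// mul1mx.
  by rewrite /exp_sym PE expmx_conj.
by rewrite !mulmxA mulmxV// mul1mx -!mulmxA (mulmxA V) Vg mulmx1.
Qed.

End Exponential.

(** * The logarithm of a Gauss product *)

Section LogarithmOfGauss.
Context {R : realType} {n : nat}.
Implicit Types (g h S P : 'M[R]_n) (K L : tensor4 (R := R) (n := n)).

Lemma diag_const1 : 1%:M = diag_mx (const_mx 1) :> 'M[R]_n.
Proof. by apply/matrixP => i j; rewrite !mxE. Qed.

(** In a frame diagonalizing [h] with eigenvalues [l_i], the curvature operator
    multiplies [e_i ^ e_j] by [l_i l_j], and [ln (l_i l_j) = ln l_i + ln l_j] is
    the eigenvalue of the Kulkarni-Nomizu product of [g] and [ln h]. *)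
Lemma log_gauss_tensor g h : g^T = g -> posdefmx g -> h^T = h -> posdefmx h ->
  op_posdef g (gauss_tensor h) ->
  exists S, [/\ S^T = S, op_log g (gauss_tensor h) = kulkarni g S & exp_sym g S = h].
Proof.
move=> gs gp hs hp Kp; have [V [l [Vu Vg Vh]]] := simultaneous_diag gs gp hs.
have l0 := (posdef_frame Vu Vh).1 hp.
pose s : 'rV[R]_n := \row_i ln (l 0 i).
pose S := invmx V *m diag_mx s *m (invmx V)^T.
have Ss : S^T = S by rewrite /S trmx_congr// tr_diag_mx.
have VS : V *m S *m V^T = diag_mx s.
  by rewrite /S trmx_inv !mulmxA mulmxV// mul1mx -mulmxA mulVmx ?unitmx_tr// mulmx1.
have Ks := gauss_tensor_sym hs; have [Ls KL] := op_logP gs gp Ks Kp.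
exists S; split => //.
  have [_ La _] := Ls; have [_ kna _] := kulkarni_sym gs Ss.
  do 4 (apply/funext => ?); apply: (wedge_ext gs gp Vu La kna) => i j.
  rewrite (KL _ _ (wedge_two_form V i j gs) (op_gauss_wedge _ _ gs gp Vu Vg hs Vh)).
  rewrite (op_kulkarni_wedge _ _ gs gp Vu Vg gs Ss (etrans Vg diag_const1) VS).
  by rewrite lnM ?posrE// !mxE mul1r mulr1 addrC.
apply: (can_inj (mulKmx Vu)); apply: (can_inj (mulmxK (_ : V^T \in unitmx))).
  by rewrite unitmx_tr.
rewrite (exp_sym_frame Vu Vg VS) Vh; congr diag_mx; apply/rowP => i.
by rewrite !mxE lnK ?posrE.
Qed.

(** The converse computation: in a frame diagonalizing [P] with eigenvalues
    [s_i] the logarithm multiplies [e_i ^ e_j] by [s_i + s_j], hence the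
    curvature operator multiplies it by [exp s_i exp s_j]. *)
Lemma gauss_tensor_of_log g K P : g^T = g -> posdefmx g -> op_symmetric K ->
  op_posdef g K -> P^T = P -> op_log g K = kulkarni g P ->
  [/\ (exp_sym g P)^T = exp_sym g P, posdefmx (exp_sym g P) &
      K = gauss_tensor (exp_sym g P)].
Proof.
move=> gs gp Ks Kp Ps LP; have [V [s [Vu Vg VP]]] := simultaneous_diag gs gp Ps.
have Ve := exp_sym_frame Vu Vg VP; set h := exp_sym g P in Ve *.
have hs : h^T = h by rewrite (frame_diagE Vu Ve) trmx_congr// tr_diag_mx.
have hp : posdefmx h by apply/(posdef_frame Vu Ve) => i; rewrite mxE expR_gt0.
split => //; have KL := op_logP gs gp Ks Kp; rewrite LP in KL.
have [_ Ka _] := Ks; have [_ ha _] := gauss_tensor_sym hs.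
do 4 (apply/funext => ?); apply: (wedge_ext gs gp Vu Ka ha) => i j.
rewrite (op_gauss_wedge _ _ gs gp Vu Vg hs Ve) !mxE -expRD.
apply: (is_op_log_exp gs gp Ks Kp KL); first exact: wedge_two_form.
rewrite (op_kulkarni_wedge _ _ gs gp Vu Vg gs Ps (etrans Vg diag_const1) VP).
by rewrite !mxE mul1r mulr1 addrC.
Qed.

Lemma ricci_kulkarni g S : g^T = g -> posdefmx g ->
  ricci_of g (kulkarni g S) = (n%:R - 2) *: S + \tr (invmx g *m S) *: g.
Proof.
move=> gs gp; have gu := posdefmx_unit gp.
have gij i j : g i j = g j i by rewrite -{1}gs mxE.
have E : ricci_of g (kulkarni g S) = \tr (invmx g *m g) *: S + \tr (invmx g *m S) *: g
     - g *m (invmx g *m S) - S *m (invmx g *m g).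
  apply/matrixP => i j; rewrite !mxE /mxtrace !mulr_suml -big_split /= -!sumrB.
  apply: eq_bigr => k _; rewrite !mxE !mulr_suml !mulr_sumr -big_split /= -!sumrB.
  by apply: eq_bigr => l _; rewrite /kulkarni; ring.
rewrite E mulVmx// mulmx1 mulKVmx// mxtrace1; set t := \tr _.
by apply/matrixP => i j; rewrite !mxE; ring.
Qed.

Lemma scalar_ofE g T : scalar_of g T = \tr (invmx g *m (ricci_of g T)^T).
Proof.
rewrite /scalar_of /mxtrace; apply: eq_bigr => a _; rewrite mxE.
by apply: eq_bigr => b _; rewrite [_^T _ _]mxE.
Qed.

(** The Ricci contraction of the product of [g] and [S] is
    [(n - 2) S + (tr S) g], and the Schouten formula is the inverse of that linear map. *)
Lemma schouten_kulkarni g S : (3 <= n)%N -> g^T = g -> posdefmx g -> S^T = S ->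
  schouten_of g (kulkarni g S) = S.
Proof.
move=> n3 gs gp Ss; have n3' : 3 <= n%:R :> R by rewrite ler_nat.
have n2 : n%:R - 2 != 0 :> R by apply/negP => /eqP; lra.
have n1 : n%:R - 1 != 0 :> R by apply/negP => /eqP; lra.
pose t := \tr (invmx g *m S).
have tE : ((n%:R - 2) *: S + t *: g)^T = (n%:R - 2) *: S + t *: g.
  have gij i j : g i j = g j i by rewrite -{1}gs mxE.
  have Sij i j : S i j = S j i by rewrite -{1}Ss mxE.
  by apply/matrixP => i j; rewrite !mxE gij Sij.
have sE : scalar_of g (kulkarni g S) = 2 * (n%:R - 1) * t.
  rewrite scalar_ofE ricci_kulkarni// tE mulmxDr -!scalemxAr mulVmx ?posdefmx_unit//.
  by rewrite mxtraceD !mxtraceZ mxtrace1 -/t; ring.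
rewrite /schouten_of sE ricci_kulkarni// -/t.
have -> : 2 * (n%:R - 1) * t / (2 * (n%:R - 1)) = t by field; rewrite n1.
by rewrite addrK scalerA mulVf ?scale1r.
Qed.

Lemma ricci_sym g T : g^T = g -> op_symmetric T -> (ricci_of g T)^T = ricci_of g T.
Proof.
move=> gs [_ _ Tp]; apply/matrixP => i j; rewrite !mxE exchange_big.
apply: eq_bigr => k _; apply: eq_bigr => l _; rewrite Tp; congr (_ * _).
by rewrite -[in LHS]gs -trmx_inv mxE.
Qed.

Lemma schouten_sym g T : g^T = g -> op_symmetric T ->
  (schouten_of g T)^T = schouten_of g T.
Proof.
by move=> gs Ts; rewrite /schouten_of linearZ /= linearB /= linearZ /= ricci_sym// gs.
Qed.

(** Subtracting the Schouten part from a curvature-like tensor therefore leaves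
    a trace-free one. *)
Lemma ricci_schouten g T : (3 <= n)%N -> g^T = g -> posdefmx g -> op_symmetric T ->
  ricci_of g (kulkarni g (schouten_of g T)) = ricci_of g T.
Proof.
move=> n3 gs gp Ts; rewrite ricci_kulkarni//.
have n3' : 3 <= n%:R :> R by rewrite ler_nat.
have n2 : n%:R - 2 != 0 :> R by apply/negP => /eqP; lra.
have n1 : n%:R - 1 != 0 :> R by apply/negP => /eqP; lra.
have -> : \tr (invmx g *m schouten_of g T) = scalar_of g T / (2 * (n%:R - 1)).
  rewrite /schouten_of -scalemxAr mxtraceZ mulmxBr linearB /= -scalemxAr mxtraceZ.
  rewrite mulVmx ?posdefmx_unit// mxtrace1 -{1}(ricci_sym gs Ts) -scalar_ofE.
  by field; rewrite n1 n2.
by rewrite /schouten_of scalerA divff// scale1r subrK.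
Qed.

End LogarithmOfGauss.

(** * Curvature tensors in dimension three *)

Section DimensionThree.
Context {R : realType} {n : nat}.
Implicit Types (g V : 'M[R]_n) (T : tensor4 (R := R) (n := n)).

(** The nested form of the sum lets the invertibility of [V] be used for one
    index at a time. *)
Definition frame_tensor V T : tensor4 (R := R) (n := n) := fun i j k l =>
  \sum_a V i a * \sum_b V j b * \sum_c V k c * \sum_d V l d * T a b c d.

Lemma frame_tensorE V T i j k l : frame_tensor V T i j k l =
  \sum_a \sum_b \sum_c \sum_d V i a * V j b * V k c * V l d * T a b c d.
Proof.
apply: eq_bigr => a _; rewrite mulr_sumr; apply: eq_bigr => b _; rewrite !mulr_sumr.
apply: eq_bigr => c _; rewrite !mulr_sumr; apply: eq_bigr => d _; ring.
Qed.

Lemma frame_tensor_sym V T : op_symmetric T -> op_symmetric (frame_tensor V T).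
Proof.
move=> [T1 T2 T3]; split=> i j k l; rewrite !frame_tensorE.
- rewrite exchange_big -sumrN; apply: eq_bigr => b _; rewrite -sumrN.
  apply: eq_bigr => a _; rewrite -sumrN; apply: eq_bigr => c _; rewrite -sumrN.
  by apply: eq_bigr => d _; rewrite T1; ring.
- rewrite -sumrN; apply: eq_bigr => a _; rewrite -sumrN; apply: eq_bigr => b _.
  rewrite exchange_big -sumrN; apply: eq_bigr => c _; rewrite -sumrN.
  by apply: eq_bigr => d _; rewrite T2; ring.
- rewrite pair_bigA [RHS]pair_bigA /=.
  under eq_bigr do rewrite pair_bigA; under [RHS]eq_bigr do rewrite pair_bigA.
  rewrite exchange_big; apply: eq_bigr => -[a b] _; apply: eq_bigr => -[c d] _ /=.
  by rewrite T3; ring.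
Qed.

Lemma frame_tensor_eq0 V T : V \in unitmx ->
  (forall i j k l, frame_tensor V T i j k l = 0) -> forall a b c d, T a b c d = 0.
Proof.
move=> Vu T0.
have inj (f : 'I_n -> R) : (forall i, \sum_a V i a * f a = 0) -> forall a, f a = 0.
  move=> f0 a; have : V *m (\col_a f a) = 0.
    by apply/colP => i; rewrite !mxE -[RHS](f0 i); apply: eq_bigr => b _; rewrite mxE.
  move=> /(congr1 (mulmx (invmx V))); rewrite mulKmx// mulmx0 => /colP/(_ a).
  by rewrite !mxE.
move=> a b c d.
apply: (inj (fun d => T a b c d)) => l.
apply: (inj (fun c => \sum_d V l d * T a b c d)) => k.
apply: (inj (fun b => \sum_c V k c * \sum_d V l d * T a b c d)) => j.
apply: (inj (fun a => \sum_b V j b * \sum_c V k c * \sum_d V l d * T a b c d)) => i.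
exact: T0.
Qed.

(** In an orthonormal frame the Ricci contraction is a plain sum over repeated
    indices. *)
Lemma frame_tensor_ricci g V T j l : V *m g *m V^T = 1%:M -> V \in unitmx ->
  \sum_k frame_tensor V T k j k l = \sum_b \sum_d V j b * V l d * ricci_of g T b d.
Proof.
move=> Vg Vu; have gE := frame_inv_metric Vg Vu.
under eq_bigr do rewrite frame_tensorE.
under eq_bigr do rewrite exchange_big /=.
rewrite exchange_big /=; apply: eq_bigr => b _.
under eq_bigr do under eq_bigr do rewrite exchange_big /=.
under eq_bigr do rewrite exchange_big /=.
rewrite exchange_big /=; apply: eq_bigr => d _.
under eq_bigr do rewrite exchange_big /=.
rewrite exchange_big /= mxE mulr_sumr; apply: eq_bigr => c _.
rewrite exchange_big /= mulr_sumr; apply: eq_bigr => a _.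
rewrite gE mxE mulr_suml mulr_sumr; apply: eq_bigr => k _; rewrite mxE; ring.
Qed.

End DimensionThree.

(** In dimension three any two coordinate planes share a direction, so a tensor
    with the symmetries of a curvature operator is determined by its Ricci
    contraction. *)
Lemma traceless_dim3 (R : realType) (t : tensor4 (R := R) (n := 3)) :
  op_symmetric t -> (forall j l, \sum_k t k j k l = 0) -> forall i j k l, t i j k l = 0.
Proof.
move=> [t1 t2 t3] ric.
pose e0 : 'I_3 := ord0; pose e1 : 'I_3 := lift ord0 ord0.
pose e2 : 'I_3 := lift ord0 (lift ord0 ord0).
have elim3 (P : 'I_3 -> Prop) : P e0 -> P e1 -> P e2 -> forall i, P i.
  move=> P0 P1 P2 [[|[|[|//]]] i3].
  - by rewrite (_ : Ordinal _ = e0)//; apply: val_inj.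
  - by rewrite (_ : Ordinal _ = e1)//; apply: val_inj.
  - by rewrite (_ : Ordinal _ = e2)//; apply: val_inj.
have sum3 (f : 'I_3 -> R) : \sum_k f k = f e0 + f e1 + f e2.
  by rewrite !big_ord_recl big_ord0 addr0 addrA.
have ric' j l : t e0 j e0 l + t e1 j e1 l + t e2 j e2 l = 0 by rewrite -(sum3 (fun k => t k j k l)) ric.
have diag1 i k l : t i i k l = 0 by have := t1 i i k l; lra.
have diag2 i k l : t k l i i = 0 by have := t2 k l i i; lra.
have r0 := ric' e0 e0; have r1 := ric' e1 e1; have r2 := ric' e2 e2.
rewrite !diag1 ?add0r ?addr0 in r0 r1 r2.
rewrite (t1 e1 e0) (t2 e0 e1 e1 e0) opprK (t1 e2 e0) (t2 e0 e2 e2 e0) opprK in r0.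
rewrite (t1 e2 e1) (t2 e1 e2 e2 e1) opprK in r1.
have [z01 z02 z12] : [/\ t e0 e1 e0 e1 = 0, t e0 e2 e0 e2 = 0 & t e1 e2 e1 e2 = 0].
  by split; lra.
have y0 : t e0 e1 e0 e2 = 0 by have := ric' e1 e2; rewrite !diag1 !diag2; lra.
have y1 : t e0 e1 e1 e2 = 0.
  by have := ric' e0 e2; rewrite !diag1 !diag2 (t1 e1 e0); lra.
have y2 : t e0 e2 e1 e2 = 0.
  by have := ric' e0 e1; rewrite !diag1 !diag2 (t1 e2 e0) (t2 e0 e2 e2 e1); lra.
have z3 : t e0 e2 e0 e1 = 0 by rewrite t3.
have z4 : t e1 e2 e0 e1 = 0 by rewrite t3.
have z5 : t e1 e2 e0 e2 = 0 by rewrite t3.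
have half2 i j : t i j e0 e1 = 0 -> t i j e0 e2 = 0 -> t i j e1 e2 = 0 ->
    forall k l, t i j k l = 0.
  move=> h01 h02 h12; apply: (elim3); apply: (elim3);
    by [rewrite diag2|exact: h01|exact: h02|exact: h12|rewrite t2 ?h01 ?h02 ?h12 oppr0].
apply: (elim3); apply: (elim3) => k l; rewrite ?diag1//.
- exact: half2.
- exact: half2.
- by rewrite t1 half2 ?oppr0.
- exact: half2.
- by rewrite t1 half2 ?oppr0.
- by rewrite t1 half2 ?oppr0.
Qed.

(** The difference of the two sides is trace-free, and so vanishes in an
    orthonormal frame. *)
Lemma kulkarni_schouten_dim3 (R : realType) (g : 'M[R]_3) T :
  g^T = g -> posdefmx g -> op_symmetric T -> T = kulkarni g (schouten_of g T).
Proof.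
move=> gs gp Ts; set P := schouten_of g T.
have Ps : P^T = P by exact: schouten_sym.
have [V [_ [Vu Vg _]]] := simultaneous_diag gs gp gs.
pose W : tensor4 (R := R) (n := 3) := fun a b c d => T a b c d - kulkarni g P a b c d.
have Ws : op_symmetric W.
  have [T1 T2 T3] := Ts; have [k1 k2 k3] := kulkarni_sym gs Ps.
  by split=> a b c d; rewrite /W; [rewrite T1 k1|rewrite T2 k2|rewrite T3 k3] => //; ring.
have ricW : ricci_of g W = 0.
  have -> : ricci_of g W = ricci_of g T - ricci_of g (kulkarni g P).
    apply/matrixP => i j; rewrite !mxE -sumrB; apply: eq_bigr => k _.
    by rewrite -sumrB; apply: eq_bigr => l _; rewrite mulrBr.
  by rewrite ricci_schouten// subrr.
have W0 : forall a b c d, W a b c d = 0.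
  apply: (frame_tensor_eq0 Vu); apply: traceless_dim3; first exact: frame_tensor_sym.
  move=> j l; rewrite (frame_tensor_ricci _ _ _ Vg Vu) ricW big1// => b _.
  by rewrite big1// => d _; rewrite mxE mulr0.
by do 4 (apply/funext => ?); apply/eqP; rewrite -subr_eq0; apply/eqP; exact: W0.
Qed.

(** * Calculus of partial derivatives *)

Section OneVariable.
Context {R : realType}.

Lemma is_derive_quotient (V : normedModType R) (f : V -> R) x v d :
  (h^-1 * (f (h *: v + x) - f x)) @[h --> 0^'] --> d -> is_derive x v f d.
Proof.
move=> h; apply: DeriveDef; first by apply/cvg_ex; exists d.
by apply/cvg_lim.
Qed.

Lemma is_derive_line (V : normedModType R) (f : V -> R) (y v : V) (s d : R) :
  is_derive (y + s *: v) v f d -> is_derive s (1 : R) (fun t => f (y + t *: v)) d.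
Proof.
move=> [fd <-]; apply: is_derive_quotient.
rewrite (_ : (fun _ => _) = (fun h : R => h^-1 *: (f (h *: v + (y + s *: v)) - f (y + s *: v)))) //.
apply/funext => h; congr (_ * (f _ - _)).
by rewrite [h *: 1]mulr1 scalerDl addrCA.
Qed.

Lemma mean_value (f df : R -> R) (a b : R) : a <= b ->
  (forall x : R, a <= x <= b -> is_derive x (1 : R) f (df x)) ->
  exists2 c, a <= c <= b & f b - f a = df c * (b - a).
Proof.
move=> ab fd.
have [||c cab E] := @MVT_segment R f df a b ab.
- by move=> x; rewrite in_itv /= => /andP[ax xb]; apply: fd; rewrite !ltW.
- apply: derivable_within_continuous => x; rewrite in_itv /= => xab.
  by have [] := fd x xab.
by exists c => //; move: cab; rewrite in_itv.
Qed.

(** A two-sided form that does not depend on the sign of the increment. *)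
Lemma mean_value0 (f df : R -> R) (b : R) :
  (forall x : R, `|x| <= `|b| -> is_derive x (1 : R) f (df x)) ->
  exists2 c, `|c| <= `|b| & f b - f 0 = df c * b.
Proof.
move=> fd; have [b0|b0] := leP 0 b.
  have [|c /andP[c0 cb] E] := @mean_value f df 0 b b0.
    by move=> x /andP[x0 xb]; apply: fd; rewrite !ger0_norm.
  by exists c; [rewrite !ger0_norm|rewrite E subr0].
have [|c /andP[c0 cb] E] := @mean_value f df b 0 (ltW b0).
  by move=> x /andP[bx x0]; apply: fd; rewrite !ler0_norm ?lerN2// ltW.
by exists c; [rewrite !ler0_norm ?lerN2// ltW|rewrite -opprB E sub0r mulrN opprK].
Qed.

End OneVariable.

Lemma is_derive_fsum {R : realType} (V : normedModType R) (x v : V) (I : finType)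
    (F : I -> V -> R) (dF : I -> R) : (forall i, is_derive x v (F i) (dF i)) ->
  is_derive x v (fun y => \sum_i F i y) (\sum_i dF i).
Proof.
move=> Fd; elim: (index_enum I) => [|i r IH].
  rewrite big_nil (_ : (fun _ => _) = cst 0) ?funeqE; last by move=> y; rewrite big_nil.
  exact: is_derive_cst.
rewrite big_cons (_ : (fun _ => _) = (fun y => F i y + \sum_(j <- r) F j y)) ?funeqE.
  exact: is_deriveD.
by move=> y; rewrite big_cons.
Qed.

Lemma is_derive_fM {R : realType} (V : normedModType R) (x v : V)
    (f g : V -> R) (df dg : R) : is_derive x v f df -> is_derive x v g dg ->
  is_derive x v (fun y => f y * g y) (df * g x + f x * dg).
Proof.
move=> fd gd; have h : is_derive x v (f * g) (f x *: dg + g x *: df) by exact: is_deriveM.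
have -> : df * g x + f x * dg = f x *: dg + g x *: df by rewrite addrC [df * _]mulrC.
exact: h.
Qed.

Lemma is_derive_cmul {R : realType} (V : normedModType R) (x v : V) (c : R)
    (f : V -> R) (df : R) : is_derive x v f df ->
  is_derive x v (fun y => c * f y) (c * df).
Proof.
move=> fd; have h : is_derive x v (c *: f) (c *: df) by exact: is_deriveZ.
exact: h.
Qed.

Lemma is_derive_linear {R : realType} (c s : R) :
  is_derive s (1 : R) (fun s => s * c) c.
Proof.
apply: is_derive_quotient.
have : \forall h \near (0 : R)^', c = h^-1 * ((h *: (1 : R) + s) * c - s * c).
  near=> h; rewrite [h *: _]mulr1 mulrDl addrK mulKf//; near: h; exact: nbhs_dnbhs_neq.
by move=> /near_eq_cvg /cvg_trans; apply; exact: cvg_cst.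
Unshelve. all: by end_near. Qed.

Lemma norm_sum_le {R : realType} (J : finType) (f : J -> R) (m : R) :
  (forall a, `|f a| <= m) -> `|\sum_a f a| <= #|J|%:R * m.
Proof.
move=> fm; apply: le_trans (ler_norm_sum _ _ _) _.
by rewrite mulr_natl -sumr_const; apply: ler_sum.
Qed.

Lemma norm_sum_ord_le {R : realType} n (f : 'I_n -> R) (m : R) :
  (forall a, `|f a| <= m) -> `|\sum_a f a| <= n%:R * m.
Proof. by move=> /norm_sum_le; rewrite card_ord. Qed.

Section RowVectors.
Context {R : realType} {n : nat}.
Implicit Types (x y h : 'rV[R]_n) (f : 'rV[R]_n -> R) (U : set 'rV[R]_n).

Lemma nbhs_rVP x (A : set 'rV[R]_n) : nbhs x A <->
  exists2 d : R, 0 < d & forall h, (forall i, `|h 0 i| < d) -> A (x + h).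
Proof.
split=> [/nbhs_ballP[d d0 dA]|[d d0 dA]].
  exists d => // h hd; apply: dA; split => // i j; rewrite !ord1 !mxE /ball /=.
  by rewrite opprD addrA subrr sub0r normrN.
apply/nbhs_ballP; exists d => // y xy; rewrite -[y](subrK x) addrC; apply: dA => i.
by have := xy.2 0 i; rewrite /ball /= !mxE distrC.
Qed.

(** The corners of the broken line from the origin to [h] with edges parallel
    to the axes. *)
Definition partial_step k h : 'rV[R]_n := \row_i (if (i < k)%N then h 0 i else 0).

Lemma partial_stepS (j : 'I_n) h :
  partial_step j.+1 h = partial_step j h + h 0 j *: delta_mx 0 j.
Proof.
apply/rowP => i; rewrite !mxE eqxx /= ltnS leq_eqVlt.
have [ij|ij] := eqVneq i j; first by rewrite ij eqxx ltnn mulr1 add0r.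
by rewrite (negbTE (_ : val i != val j)) //= mulr0 addr0.
Qed.

(** The increment of [f] along the [j]-th edge of the broken line from [x] to
    [x + h], divided by the length of that edge. *)
Definition slope f x (j : 'I_n) h : R :=
  if h 0 j == 0 then pder j f x
  else (f (x + partial_step j.+1 h) - f (x + partial_step j h)) / h 0 j.

Lemma slope_sum f x h : f (x + h) - f x = \sum_j h 0 j * slope f x j h.
Proof.
have s0 : partial_step 0 h = 0 by apply/rowP => i; rewrite !mxE.
have sn : partial_step n h = h by apply/rowP => i; rewrite !mxE ltn_ord.
rewrite -{1}sn -{2}[x]addr0 -s0 -(telescope_sumr (fun k => f (x + partial_step k h)))//.
rewrite big_mkord; apply: eq_bigr => j _; rewrite /slope.
case: eqP => [hj|/eqP hj]; last by rewrite mulrCA divff ?mulr1.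
by rewrite partial_stepS hj scale0r addr0 subrr mul0r.
Qed.

(** Each slope is a partial derivative at an intermediate point of the edge,
    by the mean value theorem, and the partial derivatives are continuous. *)
Lemma slope_cvg U f x j : open U -> Ck 1 U f -> U x ->
  slope f x j h @[h --> (0 : 'rV[R]_n)] --> pder j f x.
Proof.
move=> Uo [_ /(_ j)[fd [fc _]]] Ux.
have FF : Filter (nbhs (0 : 'rV[R]_n)) := @nbhs_filter 'rV[R]_n 0.
apply/cvgrPdist_le => e e0.
have [d d0 dP] : exists2 d : R, 0 < d & forall h, (forall i, `|h 0 i| < d) ->
    U (x + h) /\ `|pder j f x - pder j f (x + h)| <= e.
  apply/(nbhs_rVP x [set y | U y /\ `|pder j f x - pder j f y| <= e]).
  near=> y; split; first by near: y; exact: open_nbhs_nbhs.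
  by near: y; move/cvgrPdist_le : (fc x Ux); exact.
apply/(nbhs_rVP 0 [set h | `|pder j f x - slope f x j h| <= e]); exists d => // h hd.
rewrite /= add0r /slope; case: eqP => [_|/eqP hj]; first by rewrite subrr normr0 ltW.
pose v : 'rV[R]_n := delta_mx 0 j.
have inb (t : R) : `|t| <= `|h 0 j| -> forall i, `|(partial_step j h + t *: v) 0 i| < d.
  move=> tj i; rewrite !mxE eqxx /=; have [->|ij] := eqVneq i j.
    by rewrite ltnn add0r mulr1 (le_lt_trans tj).
  by rewrite mulr0 addr0; case: ifP => // _; rewrite normr0.
have [|c cj E] := @mean_value0 R (fun t => f (x + partial_step j h + t *: v))
    (fun t => pder j f (x + partial_step j h + t *: v)) (h 0 j).
  move=> t tj; apply: is_derive_line; apply/derivableP.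
  by apply: fd; rewrite -addrA; exact: (dP _ (inb t tj)).1.
rewrite partial_stepS addrA.
move: E; rewrite scale0r addr0 => ->; rewrite mulfK//.
by rewrite -addrA; exact: (dP _ (inb c cj)).2.
Unshelve. all: by end_near. Qed.

Lemma row_cvg (T : Type) (F : set_system T) {FF : Filter F} (c : T -> 'rV[R]_n) x :
  (forall j, c t 0 j @[t --> F] --> x 0 j) -> c @ F --> x.
Proof. by move=> h; apply: cvg_mx => i j; rewrite ord1; exact: h. Qed.

Lemma continuous_row (T : topologicalType) (c : T -> 'rV[R]_n) t :
  (forall j, {for t, continuous (fun s => c s 0 j)}) -> {for t, continuous c}.
Proof. by move=> h; apply: row_cvg => j; exact: h. Qed.

Lemma derivable_cvg (V : normedModType R) (f : V -> R) (x v : V) : derivable f x v ->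
  f (h *: v + x) @[h --> (0 : R)] --> f x.
Proof.
move=> /derivable1P/derivable1_diffP/differentiable_continuous fc.
have : f (h *: v + x) @[h --> (0 : R)] --> f (0 *: v + x) := fc.
by rewrite scale0r add0r.
Qed.

(** The chain rule for continuously differentiable [f], without Frechet
    derivatives: the increment of [f] is a sum of slopes times increments of
    the coordinates of [c]. *)
Lemma is_derive_comp_row (V : normedModType R) (c : V -> 'rV[R]_n) f U (y v : V) :
  open U -> Ck 1 U f -> U (c y) -> (forall j, derivable (fun z => c z 0 j) y v) ->
  is_derive y v (f \o c) (\sum_j pder j f (c y) * 'D_v (fun z => c z 0 j) y).
Proof.
move=> Uo f1 Uc cd; apply: is_derive_quotient.
have E (h : R) : h^-1 * ((f \o c) (h *: v + y) - (f \o c) y) =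
    \sum_j slope f (c y) j (c (h *: v + y) - c y)
         * (h^-1 * (c (h *: v + y) 0 j - c y 0 j)).
  rewrite /= -[c (_ + _)](subrK (c y)) [_ - _ + _]addrC slope_sum mulr_sumr.
  by apply: eq_bigr => j _; rewrite -[c y + _]addrC subrK !mxE; ring.
under eq_cvg do rewrite E.
apply: cvg_sumr => j; apply: cvgM; last first.
  by have := cd j; rewrite /derivable /derive => /cvg_ex[l hl]; rewrite (cvg_lim _ hl).
apply: (@cvg_comp _ _ _ (fun h : R => c (h *: v + y) - c y) (slope f (c y) j) 0^' (nbhs (0 : 'rV[R]_n))); last first.
  exact: slope_cvg f1 Uc.
apply: row_cvg => k.
rewrite (_ : (0 : 'rV[R]_n) 0 k = c y 0 k - c y 0 k); last by rewrite mxE subrr.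
under eq_cvg do rewrite !mxE.
apply: cvgB; last exact: cvg_cst.
by apply: cvg_within_filter; exact: derivable_cvg (cd k).
Qed.

End RowVectors.

Section CkCalculus.
Context {R : realType} {n : nat}.
Implicit Types (x : 'rV[R]_n) (f g : 'rV[R]_n -> R) (U V : set 'rV[R]_n).

Lemma near_open U x (P : 'rV[R]_n -> Prop) : open U -> U x ->
  (forall y, U y -> P y) -> \forall y \near x, P y.
Proof.
by move=> Uo Ux UP; apply: (filterS UP); exact: open_nbhs_nbhs.
Qed.

Lemma Ck_cont k U f : Ck k U f -> forall x, U x -> {for x, continuous f}.
Proof. by case: k => [|k] []. Qed.

Lemma Ck_derivable k U f i : Ck k.+1 U f -> forall x, U x -> derivable f x (delta_mx 0 i).
Proof. by move=> [_ /(_ i)[]]. Qed.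

Lemma Ck_pder k U f i : Ck k.+1 U f -> Ck k U (pder i f).
Proof. by move=> [_ /(_ i)[]]. Qed.

Arguments Ck_cont {k U f} _ {x} _.
Arguments Ck_derivable {k U f} i _ {x} _.
Arguments Ck_pder {k U f} i.

Lemma near_eq_continuous (T : topologicalType) (f g : T -> R) (x : T) :
  (\forall y \near x, f y = g y) -> {for x, continuous f} -> {for x, continuous g}.
Proof.
move=> fg fc; rewrite /prop_for /continuous_at -(nbhs_singleton fg).
exact: cvg_trans (near_eq_cvg fg) fc.
Qed.

Lemma CkS k U f : Ck k.+1 U f -> Ck k U f.
Proof.
elim: k f => [|k IH] f fk; first by split => //; exact: Ck_cont fk.
split; first exact: Ck_cont fk.
by move=> i; split; [exact: Ck_derivable fk|apply: IH; exact: Ck_pder fk].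
Qed.

Lemma Ck_le k l U f : (k <= l)%N -> Ck l U f -> Ck k U f.
Proof.
by move=> /subnK <-; elim: (l - k)%N => // m IH /CkS.
Qed.

Lemma Ck_sub k U V f : V `<=` U -> Ck k U f -> Ck k V f.
Proof.
move=> VU; elim: k f => [|k IH] f [fc fd]; split => //; first by move=> x /VU /fc.
- by move=> x /VU /fc.
- move=> i; have [fdi fpi] := fd i; split; last exact: IH.
  by move=> x /VU /fdi.
Qed.

Lemma Ck_ext k U f g : open U -> (forall x, U x -> f x = g x) -> Ck k U f -> Ck k U g.
Proof.
move=> Uo fg0; have cE f' g' k' : (forall x, U x -> f' x = g' x) -> Ck k' U f' ->
    forall x, U x -> {for x, continuous g'}.
  move=> fg fk x Ux; apply: near_eq_continuous (Ck_cont fk Ux).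
  exact: near_open Uo Ux fg.
elim: k f g fg0 => [|k IH] f g fg fk; first by split => //; exact: cE fg fk.
split; first exact: cE fg fk.
move=> i; split=> [x Ux|].
  apply: near_eq_derivable (Ck_derivable i fk Ux).
  by apply: (near_open Uo Ux) => y /fg.
apply: IH (Ck_pder i fk) => x Ux; apply: near_eq_derive.
by apply: (near_open Uo Ux) => y /fg.
Qed.

Lemma pder_ext U f g i x : open U -> U x -> (forall y, U y -> f y = g y) ->
  pder i f x = pder i g x.
Proof.
by move=> Uo Ux fg; apply: near_eq_derive; apply: (near_open Uo Ux) => y /fg.
Qed.

Lemma pder_cst c i x : pder i (fun=> c) x = 0.
Proof. exact: derive_cst. Qed.

Lemma Ck_cst k U c : Ck k U (fun=> c).
Proof.
elim: k c => [|k IH] c; first by split => // x _; exact: cst_continuous.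
split; first by move=> x _; exact: cst_continuous.
move=> i; split; first by move=> x _; exact: derivable_cst.
by rewrite (_ : pder i _ = fun=> 0) //; apply/funext => x; rewrite pder_cst.
Qed.

Lemma pderD f g i x : derivable f x (delta_mx 0 i) -> derivable g x (delta_mx 0 i) ->
  pder i (fun y => f y + g y) x = pder i f x + pder i g x.
Proof. by move=> fd gd; exact: deriveD. Qed.

Lemma pderN f i x : derivable f x (delta_mx 0 i) -> pder i (fun y => - f y) x = - pder i f x.
Proof. by move=> fd; exact: deriveN. Qed.

Lemma pderM f g i x : derivable f x (delta_mx 0 i) -> derivable g x (delta_mx 0 i) ->
  pder i (fun y => f y * g y) x = pder i f x * g x + f x * pder i g x.
Proof. by move=> fd gd; apply: etrans (deriveM fd gd) _; rewrite addrC mulrC. Qed.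

Lemma derivable_fD f g x v : derivable f x v -> derivable g x v ->
  derivable (fun y => f y + g y) x v.
Proof. exact: derivableD. Qed.

Lemma derivable_fM f g x v : derivable f x v -> derivable g x v ->
  derivable (fun y => f y * g y) x v.
Proof. exact: derivableM. Qed.

Lemma CkD k U f g : open U -> Ck k U f -> Ck k U g -> Ck k U (fun x => f x + g x).
Proof.
move=> Uo; elim: k f g => [|k IH] f g fk gk.
  by split=> // x Ux; exact: cvgD (Ck_cont fk Ux) (Ck_cont gk Ux).
split; first by move=> x Ux; exact: cvgD (Ck_cont fk Ux) (Ck_cont gk Ux).
move=> i; split=> [x Ux|].
  exact: derivable_fD (Ck_derivable i fk Ux) (Ck_derivable i gk Ux).
apply: Ck_ext (IH _ _ (Ck_pder i fk) (Ck_pder i gk)) => // x Ux.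
by rewrite (pderD (Ck_derivable i fk Ux) (Ck_derivable i gk Ux)).
Qed.

Lemma CkM k U f g : open U -> Ck k U f -> Ck k U g -> Ck k U (fun x => f x * g x).
Proof.
move=> Uo; elim: k f g => [|k IH] f g fk gk.
  by split=> // x Ux; exact: cvgM (Ck_cont fk Ux) (Ck_cont gk Ux).
split; first by move=> x Ux; exact: cvgM (Ck_cont fk Ux) (Ck_cont gk Ux).
move=> i; split=> [x Ux|].
  exact: derivable_fM (Ck_derivable i fk Ux) (Ck_derivable i gk Ux).
apply: (@Ck_ext _ _ (fun x => pder i f x * g x + f x * pder i g x)) => //.
  by move=> x Ux; rewrite (pderM (Ck_derivable i fk Ux) (Ck_derivable i gk Ux)).
by apply: CkD => //; apply: IH => //; [exact: Ck_pder|exact: CkS|exact: CkS|exact: Ck_pder].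
Qed.

Lemma CkZ k U c f : open U -> Ck k U f -> Ck k U (fun x => c * f x).
Proof. by move=> Uo fk; apply: CkM => //; exact: Ck_cst. Qed.

Lemma CkN k U f : open U -> Ck k U f -> Ck k U (fun x => - f x).
Proof.
move=> Uo fk; apply: Ck_ext (CkZ (-1) Uo fk) => // x _; exact: mulN1r.
Qed.

Lemma CkB k U f g : open U -> Ck k U f -> Ck k U g -> Ck k U (fun x => f x - g x).
Proof. by move=> Uo fk gk; apply: CkD => //; exact: CkN. Qed.

Lemma Ck_sum k U (I : Type) (r : seq I) (P : pred I) (F : I -> 'rV[R]_n -> R) : open U ->
  (forall i, P i -> Ck k U (F i)) -> Ck k U (fun x => \sum_(i <- r | P i) F i x).
Proof.
move=> Uo Fk; elim: r => [|i r IH].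
  by apply: Ck_ext (Ck_cst k U 0) => // x _; rewrite big_nil.
case Pi : (P i); last by apply: Ck_ext IH => // x _; rewrite big_cons Pi.
by apply: Ck_ext (CkD Uo (Fk i Pi) IH) => // x _; rewrite big_cons Pi.
Qed.

Lemma Ck_prod k U (I : Type) (r : seq I) (P : pred I) (F : I -> 'rV[R]_n -> R) : open U ->
  (forall i, P i -> Ck k U (F i)) -> Ck k U (fun x => \prod_(i <- r | P i) F i x).
Proof.
move=> Uo Fk; elim: r => [|i r IH].
  by apply: Ck_ext (Ck_cst k U 1) => // x _; rewrite big_nil.
case Pi : (P i); last by apply: Ck_ext IH => // x _; rewrite big_cons Pi.
by apply: Ck_ext (CkM Uo (Fk i Pi) IH) => // x _; rewrite big_cons Pi.
Qed.

Lemma pder_sum i x (I : finType) (F : I -> 'rV[R]_n -> R) :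
  (forall j, derivable (F j) x (delta_mx 0 i)) ->
  pder i (fun y => \sum_j F j y) x = \sum_j pder i (F j) x.
Proof. by move=> Fd; have [] := is_derive_fsum (fun j => derivableP (Fd j)). Qed.

Lemma CkV k U f : open U -> (forall x, U x -> f x != 0) -> Ck k U f ->
  Ck k U (fun x => (f x)^-1).
Proof.
move=> Uo f0; have cV k' f' : (forall x, U x -> f' x != 0) -> Ck k' U f' ->
    forall x, U x -> {for x, continuous (fun x => (f' x)^-1)}.
  by move=> f'0 f'k x Ux; exact: cvgV (f'0 x Ux) (Ck_cont f'k Ux).
elim: k f f0 => [|k IH] f f0 fk; first by split => //; exact: cV fk.
split; first exact: cV fk.
move=> i; split=> [x Ux|]; first exact: derivableV (f0 x Ux) (Ck_derivable i fk Ux).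
apply: (@Ck_ext _ _ (fun x => - ((f x)^-1 * (f x)^-1 * pder i f x))) => //.
  move=> x Ux; rewrite /pder (deriveV (f0 x Ux) (Ck_derivable i fk Ux)).
  by rewrite -[RHS]/(- f x ^- 2 * _) mulNr expr2 invfM.
apply: CkN => //; apply: CkM => //; last exact: Ck_pder.
by apply: CkM => //; apply: IH => //; exact: CkS.
Qed.

Lemma is_derive_sqrt f x v : derivable f x v -> 0 < f x ->
  is_derive x v (fun y => Num.sqrt (f y)) ((2 * Num.sqrt (f x))^-1 * 'D_v f x).
Proof.
move=> fd f0.
have fx : f (0 *: v + x) = f x by rewrite scale0r add0r.
pose g (h : R) := f (h *: v + x).
have gd : is_derive (0 : R) (1 : R) g ('D_v f x).
  have : is_derive (x + 0 *: v) v f ('D_v f x).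
    by rewrite scale0r addr0; exact: derivableP.
  by move=> /is_derive_line; rewrite (_ : (fun t => _) = g)//; apply/funext => t; rewrite /g addrC.
have sd : is_derive (g 0) (1 : R) Num.sqrt (2 * Num.sqrt (g 0))^-1.
  by apply: is_derive1_sqrt; rewrite /g fx.
have [cd cE] := is_derive1_comp sd gd.
have hd : derivable (fun y => Num.sqrt (f y)) x v by apply/derivable1P.
apply: DeriveDef => //.
have : is_derive (x + 0 *: v) v (fun y => Num.sqrt (f y)) ('D_v (fun y => Num.sqrt (f y)) x).
  by rewrite scale0r addr0; exact: derivableP.
move=> /is_derive_line; rewrite (_ : (fun t => _) = Num.sqrt \o g); last first.
  by apply/funext => t; rewrite /g /= addrC.
by move=> [_ <-]; rewrite cE /g fx.
Qed.

Lemma Ck_sqrt k U f : open U -> (forall x, U x -> 0 < f x) -> Ck k U f ->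
  Ck k U (fun x => Num.sqrt (f x)).
Proof.
move=> Uo f0; have cV k' f' : Ck k' U f' ->
    forall x, U x -> {for x, continuous (fun x => Num.sqrt (f' x))}.
  by move=> f'k x Ux; exact: (continuous_comp (Ck_cont f'k Ux) (@sqrt_continuous R _)).
elim: k f f0 => [|k IH] f f0 fk; first by split => //; exact: cV fk.
split; first exact: cV fk.
move=> i; split=> [x Ux|]; first by have [] := is_derive_sqrt (Ck_derivable i fk Ux) (f0 x Ux).
apply: (@Ck_ext _ _ (fun x => (2 * Num.sqrt (f x))^-1 * pder i f x)) => //.
  by move=> x Ux; have [_ <-] := is_derive_sqrt (Ck_derivable i fk Ux) (f0 x Ux).
apply: CkM => //; last exact: Ck_pder.
apply: CkV => //.
  by move=> x Ux; rewrite mulf_neq0 ?pnatr_eq0// gt_eqF// sqrtr_gt0 f0.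
by apply: CkZ => //; apply: IH => //; exact: CkS.
Qed.

Lemma Ck_det k U N (A : 'rV[R]_n -> 'M[R]_N) : open U ->
  (forall i j, Ck k U (fun x => A x i j)) -> Ck k U (fun x => \det (A x)).
Proof.
move=> Uo Ak; apply: Ck_sum => // s _; apply: CkZ => //.
by apply: Ck_prod.
Qed.

(** Cramer's rule. *)
Lemma Ck_invmx k U N (A : 'rV[R]_n -> 'M[R]_N) i j : open U ->
  (forall x, U x -> A x \in unitmx) ->
  (forall i j, Ck k U (fun x => A x i j)) -> Ck k U (fun x => invmx (A x) i j).
Proof.
move=> Uo Au Ak.
apply: (@Ck_ext _ _ (fun x => (\det (A x))^-1 * cofactor (A x) j i)) => //.
  by move=> x Ux; rewrite /invmx Au// !mxE.
apply: CkM => //.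
  apply: CkV => //; last exact: Ck_det.
  by move=> x Ux; have := Au x Ux; rewrite unitmxE unitfE.
apply: CkZ => //; apply: Ck_det => // a b.
by apply: Ck_ext (Ak (lift j a) (lift i b)) => // x _; rewrite !mxE.
Qed.

(** The second difference of [f] over a small square is, by two applications of
    the mean value theorem, both [h^2 pder i (pder j f)] and
    [h^2 pder j (pder i f)] at nearby points. *)
Lemma pderC U f i j x : open U -> Ck 2 U f -> U x ->
  pder i (pder j f) x = pder j (pder i f) x.
Proof.
move=> Uo f2 Ux.
have key a b (e : R) : 0 < e -> exists2 d : R, 0 < d & forall h, 0 < h < d ->
  `|f (x + h *: delta_mx 0 a + h *: delta_mx 0 b) - f (x + h *: delta_mx 0 a)
   - f (x + h *: delta_mx 0 b) + f x - h * h * pder b (pder a f) x| <= h * h * e.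
  move=> e0.
  have [d d0 dP] : exists2 d : R, 0 < d & forall v : 'rV[R]_n, (forall i, `|v 0 i| < d) ->
      U (x + v) /\ `|pder b (pder a f) x - pder b (pder a f) (x + v)| <= e.
    apply/(nbhs_rVP x [set y | U y /\ `|pder b (pder a f) x - pder b (pder a f) y| <= e]).
    near=> y; split; first by near: y; exact: open_nbhs_nbhs.
    by near: y; move/cvgrPdist_le : (Ck_cont (Ck_pder b (Ck_pder a f2)) Ux); exact.
  exists (d / 2) => [|h /andP[h0 hd]]; first by rewrite divr_gt0.
  have inb (s t : R) : 0 <= s <= h -> 0 <= t <= h -> forall i,
      `|(s *: delta_mx 0 a + t *: delta_mx 0 b : 'rV[R]_n) 0 i| < d.
    move=> /andP[s0 sh] /andP[t0 th] l; rewrite !mxE eqxx /= ger0_norm.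
      by case: (l == a); case: (l == b); rewrite /= ?mulr1 ?mulr0; lra.
    by rewrite addr_ge0// mulr_ge0.
  have [|s sh Es] := @mean_value R
      (fun s => f (x + h *: delta_mx 0 b + s *: delta_mx 0 a) - f (x + s *: delta_mx 0 a))
      (fun s => pder a f (x + h *: delta_mx 0 b + s *: delta_mx 0 a)
               - pder a f (x + s *: delta_mx 0 a)) 0 h (ltW h0).
    move=> s sh; apply: is_deriveB; apply: is_derive_line; apply/derivableP.
      apply: (Ck_derivable a f2); rewrite -addrA [_ *: _ + _]addrC.
      by apply: (dP _ _).1; apply: inb => //; rewrite (ltW h0) lexx.
    apply: (Ck_derivable a f2); rewrite -[s *: _]addr0 -(scale0r (delta_mx 0 b : 'rV[R]_n)).
    by apply: (dP _ _).1; apply: inb => //; rewrite lexx (ltW h0).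
  have [|t th Et] := @mean_value R
      (fun t => pder a f (x + s *: delta_mx 0 a + t *: delta_mx 0 b))
      (fun t => pder b (pder a f) (x + s *: delta_mx 0 a + t *: delta_mx 0 b)) 0 h (ltW h0).
    move=> t th; apply: is_derive_line; apply/derivableP.
    apply: (Ck_derivable b (Ck_pder a f2)); rewrite -addrA.
    by apply: (dP _ _).1; apply: inb.
  have -> : f (x + h *: delta_mx 0 a + h *: delta_mx 0 b) - f (x + h *: delta_mx 0 a)
     - f (x + h *: delta_mx 0 b) + f x
     = h * h * pder b (pder a f) (x + s *: delta_mx 0 a + t *: delta_mx 0 b).
    move: Es Et; rewrite !scale0r !addr0 !subr0 => Es Et.
    rewrite [x + h *: delta_mx 0 b + s *: _]addrAC Et in Es.
    rewrite -[RHS]mulrA [h * pder _ _ _]mulrC [RHS]mulrC -Es addrAC.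
    by rewrite -[x + _ + h *: delta_mx 0 a]addrA [h *: delta_mx 0 b + _]addrC addrA; ring.
  rewrite -mulrBr normrM ger0_norm ?mulr_ge0 ?(ltW h0)//.
  apply: ler_wpM2l; first by rewrite mulr_ge0 ?(ltW h0).
  by rewrite -addrA distrC; apply: (dP _ _).2; exact: inb.
apply/eqP; rewrite -subr_eq0 -normr_le0; apply/ler_addgt0Pr => e e0; rewrite add0r.
have e20 : 0 < e / 2 by rewrite divr_gt0.
have [d1 d10 d1P] := key j i _ e20; have [d2 d20 d2P] := key i j _ e20.
pose h := Num.min d1 d2 / 2.
have m0 : 0 < Num.min d1 d2 by rewrite lt_min d10.
have h0 : 0 < h by rewrite divr_gt0.
have hm : h < Num.min d1 d2 by rewrite /h ltr_pdivrMr// mulr_natr mulr2n ltrDl.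
have h1 : 0 < h < d1 by rewrite h0 (lt_le_trans hm)// ge_min lexx.
have h2 : 0 < h < d2 by rewrite h0 (lt_le_trans hm)// ge_min lexx orbT.
have := d1P _ h1; have := d2P _ h2.
rewrite [x + h *: delta_mx 0 i + h *: delta_mx 0 j]addrAC.
set A := f (_ + _ + _); set B := f (_ + _); set C := f (x + h *: delta_mx 0 j).
set p := pder j _ x; set q := pder i _ x => P1 P2.
have hh : 0 < h * h by rewrite mulr_gt0.
rewrite -(ler_pM2l hh) -{1}(gtr0_norm hh) -normrM.
have -> : h * h * (q - p) =
   (A - B - C + f x - h * h * p) - (A - C - B + f x - h * h * q) by ring.
apply: le_trans (ler_normB _ _) _.
by rewrite [e in leRHS]splitr mulrDr; exact: lerD P1 P2.
Unshelve. all: by end_near. Qed.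

End CkCalculus.

Arguments Ck_cont {R n k U f} _ {x} _.
Arguments Ck_derivable {R n k U f} i _ {x} _.
Arguments Ck_pder {R n k U f} i _.

(** By induction on the order, the partial derivatives of the composite being
    sums of products of functions of one order less. *)
Lemma Ck_comp (R : realType) n k m (U : set 'rV[R]_n) (V : set 'rV[R]_m) (c : 'rV[R]_n -> 'rV[R]_m) (f : 'rV[R]_m -> R) :
  open U -> open V -> (forall x, U x -> V (c x)) ->
  (forall j, Ck k U (fun x => c x 0 j)) -> Ck k V f -> Ck k U (f \o c).
Proof.
move=> Uo Vo cUV.
have cc k' (f' : 'rV[R]_m -> R) : (forall j, Ck k' U (fun x => c x 0 j)) -> Ck k' V f' ->
    forall x, U x -> {for x, continuous (f' \o c)}.
  move=> ck f'k x Ux.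
  have cx : {for x, continuous c}.
    by apply: continuous_row => j; have hj := Ck_cont (ck j) Ux; exact: hj.
  have fx := Ck_cont f'k (cUV _ Ux).
  by apply: (@continuous_comp _ _ _ c f' x); [exact: cx|exact: fx].
elim: k f => [|k IH] f ck fk; first by split => //; exact: cc fk.
split; first exact: cc fk.
have cd i x : U x -> is_derive x (delta_mx 0 i : 'rV[R]_n) (f \o c)
    (\sum_j pder j f (c x) * pder i (fun z => c z 0 j) x).
  move=> Ux; apply: (is_derive_comp_row Vo (Ck_le _ fk) (cUV _ Ux)) => //.
  by move=> j; have h := Ck_derivable i (ck j) Ux; exact: h.
move=> i; split; first by move=> x Ux; have [] := cd i x Ux.
apply: (@Ck_ext _ _ _ _ (fun x => \sum_j pder j f (c x) * pder i (fun z => c z 0 j) x)) => //.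
  by move=> x Ux; have [_ <-] := cd i x Ux.
apply: Ck_sum => // j _; apply: CkM => //; last exact: Ck_pder.
apply: (IH (pder j f)); last exact: Ck_pder.
by move=> l; exact: CkS.
Qed.

(** * Linear ordinary differential equations *)

Section LinearODE.
Context {R : realType}.
Local Notation mu := (@lebesgue_measure R).

(** The lower bound [-2] of the integrals only has to lie below every time
    that will occur; the second integral normalizes the primitive to vanish at
    0. *)
Definition primitive (f : R -> R) (x : R) : R :=
  (\int[mu]_(t in [set` `[-2, x]]) f t)%R - (\int[mu]_(t in [set` `[-2, 0]]) f t)%R.

Lemma primitive0 f : primitive f 0 = 0.
Proof. exact: subrr. Qed.

Lemma is_derive_primitive (f : R -> R) (x : R) : continuous f -> -2 < x < 2 ->
  is_derive x (1 : R) (primitive f) (f x).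
Proof.
move=> fc /andP[x1 x2].
have fi : mu.-integrable [set` `[-2, 2]] (EFin \o f).
  apply: continuous_compact_integrable; first exact: segment_compact.
  exact: continuous_subspaceT.
have [||d e] := @continuous_FTC1 R f (BLeft (-2)) x 2 x2 fi.
- by rewrite lte_fin.
- exact: fc.
rewrite /primitive -[f x]subr0; apply: is_deriveB.
by rewrite -e derive1E; exact/derivableP.
Qed.

(** Freezing the time outside of a neighbourhood of [0, 1] keeps all the
    iterates below defined, continuous and bounded on the whole line. *)
Definition clamp (t : R) : R := Num.max (- (3 / 2)) (Num.min t (3 / 2)).

Lemma clamp_norm t : `|clamp t| <= 3 / 2.
Proof.
rewrite ler_norml /clamp le_max lexx ge_max ge_min lexx orbT andbT /=; lra.
Qed.

Lemma clamp_id t : `|t| <= 3 / 2 -> clamp t = t.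
Proof. by rewrite ler_norml => /andP[t0 t1]; rewrite /clamp min_l// max_r. Qed.

Lemma clamp_continuous : continuous clamp.
Proof.
move=> t; apply: (@continuous_max R R (cst (- (3 / 2))) (fun t => Num.min t (3 / 2)) t).
  exact: cst_continuous.
by apply: (@continuous_min R R id (cst (3 / 2)) t); [exact: cvg_id|exact: cst_continuous].
Qed.

Lemma primitive_clamp_continuous (f : R -> R) : continuous f -> continuous (primitive f \o clamp).
Proof.
move=> fc t; apply: continuous_comp; first exact: clamp_continuous.
apply/differentiable_continuous/derivable1_diffP.
have [] // := @is_derive_primitive f (clamp t) fc.
by have := clamp_norm t; rewrite ler_norml => /andP[? ?]; apply/andP; split; lra.
Qed.

Lemma primitive_clamp_le (f g : R -> R) (b t : R) : continuous f -> continuous g ->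
  (forall s, `|f s - g s| <= b) ->
  `|primitive f (clamp t) - primitive g (clamp t)| <= 3 / 2 * b.
Proof.
move=> fc gc fgb.
have [|c _ E] := @mean_value0 R (fun x => primitive f x - primitive g x)
    (fun x => f x - g x) (clamp t).
  move=> x /le_trans/(_ (clamp_norm t)); rewrite ler_norml => /andP[x1 x2].
  have xI : -2 < x < 2 by apply/andP; split; lra.
  by apply: is_deriveB; apply: is_derive_primitive.
move: E; rewrite !primitive0 !subr0 => ->; rewrite normrM mulrC.
by apply: ler_pM => //; exact: clamp_norm.
Qed.

Section Picard.
Context (I : finType) (B : R -> I -> I -> R) (y0 : I -> R) (beta : R).
Hypothesis Bc : forall i j, continuous (fun t => B t i j).
Hypothesis Bb : forall t i j, `|B t i j| <= beta.
Hypothesis beta_small : #|I|%:R * beta <= 3^-1.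

Definition picard_rhs (Y : R -> I -> R) (i : I) (t : R) : R := \sum_j B t i j * Y t j.

Fixpoint picard k (t : R) (i : I) : R :=
  if k is k'.+1 then y0 i + primitive (picard_rhs (picard k') i) (clamp t) else y0 i.

Lemma picard_rhs_continuous Y i : (forall j, continuous (fun t => Y t j)) ->
  continuous (picard_rhs Y i).
Proof.
move=> Yc t; apply: cvg_sumr => j; apply: cvgM; [exact: Bc|exact: Yc].
Qed.

Lemma picard_continuous k i : continuous (fun t => picard k t i).
Proof.
elim: k i => [|k IH] i t; first exact: cst_continuous.
apply: cvgD; first exact: cvg_cst.
by apply: primitive_clamp_continuous; apply: picard_rhs_continuous => j; exact: IH.
Qed.

Lemma picard_rhs_le Y Z (m : R) i t : (forall j, `|Y t j - Z t j| <= m) ->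
  `|picard_rhs Y i t - picard_rhs Z i t| <= m / 3.
Proof.
move=> YZ; rewrite /picard_rhs -sumrB; apply: le_trans (ler_norm_sum _ _ _) _.
have m0 : 0 <= m := le_trans (normr_ge0 _) (YZ i).
apply: (@le_trans _ _ (\sum_(j : I) beta * m)).
  by apply: ler_sum => j _; rewrite -mulrBr normrM; apply: ler_pM.
rewrite sumr_const -[X in X <= _]mulr_natl mulrA [m / 3]mulrC.
exact: ler_wpM2r.
Qed.

(** The iteration halves distances: the coefficients are so small that the
    right-hand side shrinks distances by a factor of 3, and the integral runs
    over a time of at most [3 / 2]. *)
Lemma picard_step Y Z (m : R) i t :
  (forall j, continuous (fun t => Y t j)) -> (forall j, continuous (fun t => Z t j)) ->
  (forall t j, `|Y t j - Z t j| <= m) ->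
  `|primitive (picard_rhs Y i) (clamp t) - primitive (picard_rhs Z i) (clamp t)| <= m / 2.
Proof.
move=> Yc Zc YZ; have -> : m / 2 = 3 / 2 * (m / 3) by field.
apply: primitive_clamp_le; do ?exact: picard_rhs_continuous.
by move=> s; apply: picard_rhs_le.
Qed.

Let M : R := \sum_i `|y0 i|.

Let M_ge i : `|y0 i| <= M.
Proof. by rewrite /M (bigD1 i)//= lerDl sumr_ge0. Qed.

Lemma picard_diff k t i : `|picard k.+1 t i - picard k t i| <= M / 2 ^+ k.
Proof.
elim: k t i => [|k IH] t i.
  rewrite /= expr0 divr1 [y0 i + _]addrC addrK -[primitive _ _]subr0.
  have -> : 0 = primitive (picard_rhs (fun _ _ => 0) i) (clamp t).
    have E : picard_rhs (fun _ _ => 0) i = fun=> 0.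
      by apply/funext => s; rewrite /picard_rhs big1// => j _; rewrite mulr0.
    rewrite E; have [|c _] := @mean_value0 R (primitive (fun=> 0)) (fun=> 0) (clamp t).
      move=> x /le_trans/(_ (clamp_norm t)); rewrite ler_norml => /andP[x1 x2].
      by apply: is_derive_primitive; [exact: cst_continuous|apply/andP; split; lra].
    by rewrite primitive0 subr0 mul0r.
  apply: le_trans (@picard_step (fun _ => y0) (fun _ _ => 0) M i t _ _ _) _.
  - by move=> j; exact: cst_continuous.
  - by move=> j; exact: cst_continuous.
  - by move=> _ j; rewrite subr0; exact: M_ge.
  by rewrite ler_pdivrMr// ler_peMr ?ler1n// sumr_ge0.
rewrite [picard k.+2 t i]/= [X in _ - X]/= opprD addrACA subrr add0r.
apply: le_trans (@picard_step (picard k.+1) (picard k) (M / 2 ^+ k) i t _ _ IH) _.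
- exact: picard_continuous.
- exact: picard_continuous.
by rewrite exprSr invfM mulrA.
Qed.

Lemma picard_cauchy k m t i : `|picard (k + m) t i - picard k t i| <= 2 * M / 2 ^+ k.
Proof.
have M0 : 0 <= M by rewrite sumr_ge0.
suff : `|picard (k + m) t i - picard k t i| <= 2 * M / 2 ^+ k - 2 * M / 2 ^+ (k + m).
  by move=> /le_trans; apply; rewrite gerBl divr_ge0 ?mulr_ge0// exprn_ge0.
elim: m => [|m IH]; first by rewrite addn0 !subrr normr0.
rewrite addnS -(subrKA (picard (k + m) t i)).
apply: le_trans (ler_normD _ _) _; apply: le_trans (lerD (picard_diff _ _ _) IH) _.
have p0 : (2 : R) ^+ (k + m) != 0 by rewrite expf_neq0// pnatr_eq0.
have -> : 2 * M / 2 ^+ (k + m).+1 = M / 2 ^+ (k + m).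
  by rewrite exprS; field.
rewrite le_eqVlt; apply/orP; left; apply/eqP; field.
by rewrite p0 expf_neq0// pnatr_eq0.
Qed.

Lemma exp2_small (C e : R) : 0 < e -> exists k, C / 2 ^+ k < e.
Proof.
move=> e0; pose k := Num.bound `|C / e|; exists k.
rewrite ltr_pdivrMr ?exprn_gt0// mulrC -ltr_pdivrMr//.
apply: le_lt_trans (ler_norm _) _.
apply: lt_le_trans (archi_boundP (normr_ge0 _)) _.
by rewrite -natrX ler_nat ltnW// ltn_expl.
Qed.

Definition picard_limit (t : R) (i : I) : R := limn (fun k => picard k t i).

Lemma picard_limit_dist k t i : `|picard_limit t i - picard k t i| <= 2 * M / 2 ^+ k.
Proof.
have cv : cvgn (fun k => picard k t i).
  apply/cauchy_cvgP/cauchy_exP => e e0.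
  have [k0 hk] := exp2_small (2 * M) e0.
  exists (picard k0 t i); exists k0 => // m /= /subnKC <-.
  rewrite /ball /= distrC; apply: le_lt_trans hk; exact: picard_cauchy.
apply/ler_addgt0Pr => e e0.
have : \forall m \near \oo, `|picard_limit t i - picard m t i| < e.
  by move/cvgrPdist_lt : cv; apply.
move=> [m0 _ hm]; have := hm (m0 + k)%N (leq_addr _ _) => /ltW h.
rewrite -(subrKA (picard (m0 + k) t i)) addrC; apply: le_trans (ler_normD _ _) _.
by apply: lerD => //; rewrite addnC; exact: picard_cauchy.
Qed.

(** The convergence is uniform, with the geometric rate of
    [picard_limit_dist]. *)
Lemma picard_limit_continuous i : continuous (fun t => picard_limit t i).
Proof.
move=> t; apply/cvgrPdist_le => e e0.
have e3 : 0 < e / 3 by rewrite divr_gt0.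
have [k hk] := exp2_small (2 * M) e3.
have /cvgrPdist_le/(_ (e / 3)) := @picard_continuous k i t.
rewrite divr_gt0// => /(_ isT); apply: filterS => s hs.
have h1 := le_trans (picard_limit_dist k t i) (ltW hk).
have h2 := le_trans (picard_limit_dist k s i) (ltW hk).
have -> : picard_limit t i - picard_limit s i =
  (picard_limit t i - picard k t i) + (picard k t i - picard k s i)
  - (picard_limit s i - picard k s i) by ring.
apply: le_trans (ler_normB _ _) _.
have := lerD (le_trans (ler_normD _ _) (lerD h1 hs)) h2.
by move=> /le_trans; apply; lra.
Qed.

Lemma picard_limit_eq t i :
  picard_limit t i = y0 i + primitive (picard_rhs picard_limit i) (clamp t).
Proof.
apply/eqP; rewrite -subr_eq0 -normr_le0; apply/ler_addgt0Pr => e e0; rewrite add0r.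
have e2 : 0 < e / 2 by rewrite divr_gt0.
have [k hk] := exp2_small (2 * M) e2.
have h1 := picard_limit_dist k.+1 t i.
have h2 := @picard_step picard_limit (picard k) (2 * M / 2 ^+ k) i t
  picard_limit_continuous (fun j => @picard_continuous k j) (picard_limit_dist k).
have -> : picard_limit t i - (y0 i + primitive (picard_rhs picard_limit i) (clamp t)) =
  (picard_limit t i - picard k.+1 t i)
  - (primitive (picard_rhs picard_limit i) (clamp t)
     - primitive (picard_rhs (picard k) i) (clamp t)) by rewrite /=; ring.
apply: le_trans (ler_normB _ _) _; apply: le_trans (lerD h1 h2) _.
by rewrite exprSr invfM mulrA -splitr; lra.
Qed.

(** Picard iteration. The time interval reaches beyond [0, 1] so that the
    solution is differentiable on both sides of its end points. *)
Lemma linear_ode_exists : exists Y : R -> I -> R,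
  (forall i, Y 0 i = y0 i) /\
  (forall t, `|t| < 3 / 2 -> forall i,
     is_derive t (1 : R) (fun s => Y s i) (\sum_j B t i j * Y t j)).
Proof.
exists picard_limit; split=> [i|t tb i].
  by rewrite picard_limit_eq clamp_id ?normr0 ?divr_ge0// primitive0 addr0.
have E : \forall s \near t, y0 i + primitive (picard_rhs picard_limit i) s = picard_limit s i.
  near=> s; rewrite picard_limit_eq clamp_id//.
  near: s; have /open_nbhs_nbhs : open_nbhs t [set s : R | `|s| < 3 / 2].
    split => //; rewrite (_ : [set s | _] = (fun s => `|s|) @^-1` [set s | s < 3 / 2])//.
    by apply: open_comp; [move=> s _; exact: norm_continuous|exact: open_lt].
  by apply: filterS => s /ltW.
apply: (near_eq_is_derive E); rewrite -[X in is_derive _ _ _ X]add0r.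
apply: is_deriveD; apply: is_derive_primitive.
  by apply: picard_rhs_continuous; exact: picard_limit_continuous.
by move: tb; rewrite ltr_norml => /andP[? ?]; apply/andP; split; lra.
Unshelve. all: by end_near. Qed.

End Picard.

(** A Gronwall estimate on an interval so short that the maximum of the
    solution is controlled by half of itself. *)
Lemma gronwall_short (I : finType) (D D' : R -> I -> R) (beta e : R) :
  0 <= beta -> #|I|%:R * beta <= 2^-1 ->
  (forall i, D 0 i = 0) ->
  (forall t : R, 0 <= t <= 1 -> forall i, is_derive t (1 : R) (fun s => D s i) (D' t i)) ->
  (forall t, 0 <= t <= 1 -> forall i, `|D' t i| <= beta * (\sum_j `|D t j|) + e) ->
  forall t, 0 <= t <= 1 -> forall i, `|D t i| <= 2 * #|I|%:R * e.
Proof.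
move=> b0 bs D0 Dd De; pose S t := \sum_j `|D t j|.
have Sc : {within `[0, 1], continuous S}.
  have E : S = (fun t => \sum_j (fun t => `|D t j|) t) by [].
  apply: continuous_in_subspaceT => t; rewrite inE /= in_itv /= => t01.
  apply: cvg_sumr => j; apply: (@continuous_comp _ _ _ (fun t => D t j) (fun x : R => `|x|)).
    by apply/differentiable_continuous/derivable1_diffP; have [] := Dd t t01 j.
  exact: norm_continuous.
have [c] := EVT_max ler01 Sc; rewrite in_itv /= => c01 Smax.
have Sle t : 0 <= t <= 1 -> S t <= S c by move=> t01; apply: Smax; rewrite in_itv.
have Dle t i : 0 <= t <= 1 -> `|D t i| <= beta * S c + e.
  move=> /andP[t0 t1].
  have [|s /andP[s0 st] E] := @mean_value R (fun s => D s i) (fun s => D' s i) 0 t t0.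
    by move=> s /andP[s0 st]; apply: Dd; rewrite s0 (le_trans st).
  move: E; rewrite D0 !subr0 => ->; rewrite normrM (ger0_norm t0).
  have s01 : 0 <= s <= 1 by rewrite s0 (le_trans st).
  have h := le_trans (De s s01 i) (lerD (ler_wpM2l b0 (Sle s s01)) (lexx e)).
  by apply: le_trans h; rewrite ler_piMr.
have S0 : 0 <= S c by apply: sumr_ge0.
have Sc2 : S c <= #|I|%:R * (beta * S c + e).
  rewrite mulr_natl -sumr_const; apply: ler_sum => j _; exact: Dle.
have Sc3 : S c <= 2 * #|I|%:R * e.
  have := ler_wpM2r S0 bs; rewrite mulrDr mulrA in Sc2; lra.
move=> t t01 i; apply: le_trans Sc3; apply: le_trans (Sle t t01).
by rewrite /S (bigD1 i)//= lerDl sumr_ge0.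
Qed.

Lemma linear_ode_unique (I : finType) (B : R -> I -> I -> R) (D : R -> I -> R) (beta : R) :
  0 <= beta -> #|I|%:R * beta <= 2^-1 ->
  (forall t i j, 0 <= t <= 1 -> `|B t i j| <= beta) ->
  (forall i, D 0 i = 0) ->
  (forall t : R, 0 <= t <= 1 -> forall i,
     is_derive t (1 : R) (fun s => D s i) (\sum_j B t i j * D t j)) ->
  forall t, 0 <= t <= 1 -> forall i, D t i = 0.
Proof.
move=> b0 bs Bb D0 Dd t t01 i; apply/eqP; rewrite -normr_le0.
have := @gronwall_short I D _ beta 0 b0 bs D0 Dd _ t t01 i; rewrite mulr0; apply.
move=> s s01 j; rewrite addr0 mulr_sumr; apply: le_trans (ler_norm_sum _ _ _) _.
by apply: ler_sum => k _; rewrite normrM ler_wpM2r// Bb.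
Qed.

(** The mean value theorem for [f] and then for [f']. *)
Lemma taylor_bound (f f' f'' : R -> R) (C h : R) :
  (forall s : R, `|s| <= `|h| -> is_derive s (1 : R) f (f' s)) ->
  (forall s : R, `|s| <= `|h| -> is_derive s (1 : R) f' (f'' s)) ->
  (forall s : R, `|s| <= `|h| -> `|f'' s| <= C) ->
  `|f h - f 0 - h * f' 0| <= C * h ^+ 2.
Proof.
move=> fd fd' fC; have [c ch ->] := mean_value0 fd.
have [|c' c'c E] := @mean_value0 R f' f'' c.
  by move=> s sc; apply: fd'; exact: le_trans ch.
rewrite [h * _]mulrC -mulrBl E !normrM -[h ^+ 2]ger0_norm ?sqr_ge0// normrX expr2 mulrA.
rewrite ler_wpM2r//; apply: ler_pM => //; apply: fC; exact: le_trans ch.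
Qed.

(** Differentiability from an explicit second-order remainder, which is the
    form in which the comparison of neighbouring solutions delivers it. *)
Lemma is_derive_quadratic (V : normedModType R) (f : V -> R) x v d (K e : R) : 0 < e ->
  (forall h : R, `|h| < e -> `|f (h *: v + x) - f x - h * d| <= K * h ^+ 2) ->
  is_derive x v f d.
Proof.
move=> e0 fq; apply: is_derive_quotient; apply/cvgrPdist_le => eps eps0.
near=> h.
have h0 : h != 0 by near: h; exact: nbhs_dnbhs_neq.
have he : `|h| < e by near: h; exact: dnbhs0_lt.
have hK : `|h| <= eps / (`|K| + 1).
  by near: h; apply: dnbhs0_le; rewrite divr_gt0// ltr_wpDl.
have -> : d - h^-1 * (f (h *: v + x) - f x) = - (h^-1 * (f (h *: v + x) - f x - h * d)).
  by rewrite [in RHS]mulrBr mulKf// opprB.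
rewrite normrN normrM normfV ler_pdivrMl ?normr_gt0//.
apply: le_trans (fq h he) _; rewrite -[h ^+ 2]ger0_norm ?sqr_ge0// normrX expr2 mulrA mulrC.
rewrite ler_pM2l ?normr_gt0//; apply: (@le_trans _ _ ((`|K| + 1) * `|h|)).
  by rewrite ler_wpM2r// (le_trans (ler_norm K))// lerDl.
by rewrite mulrC -ler_pdivlMr// ltr_wpDl.
Unshelve. all: by end_near. Qed.

End LinearODE.

(** * Boxes *)

Lemma near_forall (T : topologicalType) (x : T) (K : finType) (P : K -> T -> Prop) :
  (forall k, \forall y \near x, P k y) -> \forall y \near x, forall k, P k y.
Proof. by move=> h; apply: filter_forall. Qed.

Lemma near_norm_lt {R : realType} (T : topologicalType) (f : T -> R) (x : T) (c r : R) :
  {for x, continuous f} -> `|f x - c| < r -> \forall y \near x, `|f y - c| < r.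
Proof.
move=> fc fr; have : `|f y - c| @[y --> x] --> `|f x - c|.
  by apply: cvg_norm; apply: cvgB; [exact: fc|exact: cvg_cst].
by move=> /cvgr_lt; apply.
Qed.

Section Boxes.
Context {R : realType} {n : nat}.
Implicit Types (x p q : 'rV[R]_n) (U : set 'rV[R]_n).

Definition box x (r : R) : set 'rV[R]_n := [set y | forall i, `|y 0 i - x 0 i| < r].

Lemma nbhs_boxP x (A : set 'rV[R]_n) :
  nbhs x A <-> exists2 r : R, 0 < r & box x r `<=` A.
Proof.
split=> [/nbhs_rVP[d d0 dA]|[d d0 dA]].
  exists d => // y yx; rewrite -[y](subrK x) addrC; apply: dA => i.
  by have := yx i; rewrite !mxE.
apply/nbhs_rVP; exists d => // h hd; apply: dA => i.
by rewrite !mxE addrAC subrr add0r.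
Qed.

Lemma box_center x r : 0 < r -> box x r x.
Proof. by move=> r0 i; rewrite subrr normr0. Qed.

Lemma box_open x r : open (box x r).
Proof.
rewrite openE => y yx; rewrite /interior /=.
have : \forall z \near y, forall i : 'I_n, `|(z : 'rV[R]_n) 0 i - x 0 i| < r.
  apply: near_forall => i.
  have h := @coord_continuous R 1 n 0 i y.
  by apply: near_norm_lt; [exact: h|exact: yx].
by [].
Qed.

Lemma is_derive_affine (g : 'rV[R]_n -> R) U p q (s : R) :
  open U -> Ck 1 U g -> U (p + s *: q) ->
  is_derive s (1 : R) (fun s => g (p + s *: q)) (\sum_a q 0 a * pder a g (p + s *: q)).
Proof.
move=> Uo g1 Us.
have cd a : is_derive s (1 : R) (fun s => (p + s *: q) 0 a) (q 0 a).
  rewrite (_ : (fun s => _) = (fun s => p 0 a + s * q 0 a)); last first.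
    by apply/funext => z; rewrite !mxE.
  rewrite -[q 0 a in X in is_derive _ _ _ X]add0r; apply: is_deriveD.
  exact: is_derive_linear.
have h := @is_derive_comp_row R n _ (fun s : R => p + s *: q) g U s 1 Uo g1 Us _.
apply: is_derive_eq; first by apply: h => j; have [] := cd j.
by apply: eq_bigr => a _; rewrite mulrC; congr (_ * _); have [_ ->] := cd a.
Qed.

Lemma locally_bounded (K : finType) (f : K -> 'rV[R]_n -> R) x :
  (forall k, {for x, continuous (f k)}) ->
  exists C : R, 0 <= C /\ \forall y \near x, forall k, `|f k y| <= C.
Proof.
move=> fc; exists (\sum_k (`|f k x| + 1)).
split; first by apply: sumr_ge0 => k _; rewrite addr_ge0.
apply: near_forall => k.
have fk : \forall y \near x, `|f k y - f k x| < 1.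
  by apply: near_norm_lt; [have h := fc k; exact: h|rewrite subrr normr0].
apply: filterS fk => y fy; apply: (@le_trans _ _ (`|f k x| + 1)).
  by rewrite -[f k y](subrK (f k x)) addrC (le_trans (ler_normD _ _))// lerD2l ltW.
by rewrite [leRHS](bigD1 k)//= lerDl sumr_ge0// => j _; rewrite addr_ge0.
Qed.

(** The slopes along the edges of a broken line to a nearby point are bounded,
    and so is the increment of [f] by a multiple of the step. *)
Lemma bounded_pder_continuous (f : 'rV[R]_n -> R) x (r L : R) : 0 < r ->
  (forall y i, box x r y -> derivable f y (delta_mx 0 i) /\ `|pder i f y| <= L) ->
  {for x, continuous f}.
Proof.
move=> r0 fd; suff : f y @[y --> x] --> f x by [].
have FF : Filter (nbhs x) := @nbhs_filter 'rV[R]_n x.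
apply/cvgrPdist_le => e e0.
(* The summand 1 keeps the denominator positive when [n] or [L] is 0. *)
have q0 : 0 < n%:R * `|L| + 1 :> R by rewrite ltr_wpDl// mulr_ge0.
apply/(nbhs_rVP x [set y | `|f x - f y| <= e]).
exists (Num.min r (e / (n%:R * `|L| + 1))); first by rewrite lt_min r0 divr_gt0.
move=> h hd /=; rewrite distrC slope_sum.
have hr i : `|h 0 i| < r by have := hd i; rewrite lt_min => /andP[].
have he i : `|h 0 i| <= e / (n%:R * `|L| + 1).
  by have := hd i; rewrite lt_min => /andP[_ /ltW].
have sl j : `|h 0 j * slope f x j h| <= e / (n%:R * `|L| + 1) * `|L|.
  rewrite normrM; have [->|hj] := eqVneq (h 0 j) 0.
    by rewrite normr0 mul0r mulr_ge0// divr_ge0// ltW.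
  apply: ler_pM => //.
  have inb (t : R) : `|t| <= `|h 0 j| ->
      box x r (x + partial_step j h + t *: delta_mx 0 j).
    move=> tj i; rewrite !mxE eqxx /= -addrA addrAC subrr add0r.
    have [->|ij] := eqVneq i j; first by rewrite ltnn add0r mulr1 (le_lt_trans tj).
    by rewrite mulr0 addr0; case: ifP => // _; rewrite normr0.
  have [|c cj E] := @mean_value0 R (fun t => f (x + partial_step j h + t *: delta_mx 0 j))
      (fun t => pder j f (x + partial_step j h + t *: delta_mx 0 j)) (h 0 j).
    by move=> t tj; apply: is_derive_line; apply/derivableP; exact: (fd _ j (inb t tj)).1.
  rewrite /slope (negbTE hj) partial_stepS addrA.
  move: E; rewrite scale0r addr0 => ->; rewrite mulfK//.
  by apply: le_trans (fd _ j (inb c cj)).2 _; exact: ler_norm.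
apply: le_trans (ler_norm_sum _ _ _) _.
apply: (@le_trans _ _ (\sum_(j < n) e / (n%:R * `|L| + 1) * `|L|)).
  by apply: ler_sum => j _; exact: sl.
rewrite sumr_const card_ord -[X in X <= _]mulr_natl.
have -> : n%:R * (e / (n%:R * `|L| + 1) * `|L|) = e * (n%:R * `|L|) / (n%:R * `|L| + 1) by ring.
by rewrite ler_pdivrMr// ler_pM2l// lerDl.
Qed.

End Boxes.

(** * Integrable linear total differential systems *)

Section Frobenius.
Context {R : realType} {n : nat} (I : finType).
Variables (A : 'I_n -> I -> I -> 'rV[R]_n -> R) (U : set 'rV[R]_n) (x0 : 'rV[R]_n).
Hypothesis Uo : open U.
Hypothesis A2 : forall a i j, Ck 2 U (A a i j).
Hypothesis flat : forall x, U x -> forall a b i j,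
  pder a (A b i j) x + \sum_k A b i k x * A a k j x =
  pder b (A a i j) x + \sum_k A a i k x * A b k j x.

Local Notation N := (#|I|%:R : R).

Section Radius.
Variables (C r : R).
Hypotheses (C0 : 0 <= C) (r0 : 0 < r) (VU : box x0 (2 * r) `<=` U).
Hypothesis AC : forall x, box x0 (2 * r) x -> forall a i j, `|A a i j x| <= C.
Hypothesis dAC : forall x, box x0 (2 * r) x -> forall a b i j, `|pder b (A a i j) x| <= C.
Hypothesis ddAC : forall x, box x0 (2 * r) x -> forall a b i j,
  `|pder b (pder b (A a i j)) x| <= C.
Let beta : R := n%:R * (r * C).
Hypothesis small : N * beta <= 3^-1.

Let near0 (v : 'rV[R]_n) := forall a, `|v 0 a| < r.

Lemma ray_box v (t : R) : near0 v -> `|t| <= 3 / 2 -> box x0 (2 * r) (x0 + t *: v).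
Proof.
move=> vr t2 i; rewrite !mxE addrAC subrr add0r normrM.
apply: (@le_lt_trans _ _ (3 / 2 * `|v 0 i|)); first by rewrite ler_wpM2r.
apply: (@lt_le_trans _ _ (3 / 2 * r)); last by rewrite ler_wpM2r ?ltW//; lra.
by rewrite ltr_pM2l//; exact: vr.
Qed.

(** By the chain rule a solution of the system restricted to the ray from [x0]
    in the direction [v] solves the ordinary differential equation with this
    matrix. *)
Definition ray_coeff (v : 'rV[R]_n) (t : R) (i j : I) : R := \sum_a v 0 a * A a i j (x0 + t *: v).

Lemma ray_coeff_le v t i j : near0 v -> `|t| <= 3 / 2 -> `|ray_coeff v t i j| <= beta.
Proof.
move=> vr t2; apply: norm_sum_ord_le => a; rewrite normrM; apply: ler_pM => //.
  exact: ltW.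
by apply: AC; exact: ray_box.
Qed.

Lemma coeff_Ck1 a i j : Ck 1 U (A a i j).
Proof. exact: CkS (A2 a i j). Qed.

(** The system is linear, and the box is small enough for the ray equations to
    be solvable up to time 1. *)
Lemma ray_solution (y0 : I -> R) v : near0 v -> exists Y : R -> I -> R,
  (forall i, Y 0 i = y0 i) /\
  (forall t : R, `|t| < 3 / 2 -> forall i,
     is_derive t (1 : R) (fun s => Y s i) (\sum_j ray_coeff v t i j * Y t j)).
Proof.
move=> vr.
have Bc i j : continuous (fun t => ray_coeff v (clamp t) i j).
  move=> t; apply: cvg_sumr => a; apply: cvgM; first exact: cvg_cst.
  apply: (@continuous_comp _ _ _ clamp (fun s => A a i j (x0 + s *: v))).
    exact: clamp_continuous.
  apply/differentiable_continuous/derivable1_diffP.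
  have UU : U (x0 + clamp t *: v) by apply: VU; apply: ray_box => //; exact: clamp_norm.
  by have [] := is_derive_affine Uo (coeff_Ck1 a i j) UU.
have Bb t i j : `|ray_coeff v (clamp t) i j| <= beta.
  by apply: ray_coeff_le => //; exact: clamp_norm.
have [Y [Y0 Yd]] := linear_ode_exists y0 Bc Bb small.
exists Y; split => // t t2 i; have := Yd t t2 i.
by rewrite clamp_id// ltW.
Qed.

Section Solution.
Variables (y0 : I -> R) (Y : 'rV[R]_n -> R -> I -> R).
Hypothesis Y0 : forall v, near0 v -> forall i, Y v 0 i = y0 i.
Hypothesis Yd : forall v, near0 v -> forall t : R, `|t| < 3 / 2 -> forall i,
  is_derive t (1 : R) (fun s => Y v s i) (\sum_j ray_coeff v t i j * Y v t j).

Lemma t01_norm (t : R) : 0 <= t <= 1 -> `|t| < 3 / 2.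
Proof. by move=> /andP[t0 t1]; rewrite ger0_norm//; lra. Qed.

Lemma ray_solution_center i : Y 0 1 i = y0 i.
Proof.
have z : near0 0 by move=> a; rewrite mxE normr0.
apply/eqP; rewrite -subr_eq0; apply/eqP.
apply: (@linear_ode_unique R I (fun _ _ _ => 0) (fun t i => Y 0 t i - y0 i) 0) => //.
- by rewrite mulr0 invr_ge0.
- by move=> *; rewrite normr0.
- by move=> j; rewrite Y0// subrr.
- move=> t t01 j; apply: is_derive_eq.
    by apply: is_deriveB; apply: Yd => //; exact: t01_norm.
  rewrite subr0; apply: eq_bigr => k _; rewrite mul0r /ray_coeff big1 ?mul0r// => a _.
  by rewrite mxE mul0r.
- by rewrite ler01 lexx.
Qed.

Variables (v : 'rV[R]_n) (b : 'I_n).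
Hypothesis vr : near0 v.
Let eb : 'rV[R]_n := delta_mx 0 b.

Let Ab t i j := A b i j (x0 + t *: v).
Let dAb t i j := \sum_a v 0 a * pder a (A b i j) (x0 + t *: v).
Let dbB t i j := \sum_a v 0 a * pder b (A a i j) (x0 + t *: v).
Let C1 : R := n%:R * (C + r * C).
Let C2 : R := n%:R * (C + (C + r * C)).

(** Integrability of the system, contracted with the direction of the ray. *)
Lemma ray_flat t i j : 0 <= t <= 1 ->
  dAb t i j + \sum_k Ab t i k * ray_coeff v t k j =
  dbB t i j + \sum_k ray_coeff v t i k * Ab t k j.
Proof.
move=> t01; have Ux : U (x0 + t *: v) by apply/VU/ray_box => //; exact/ltW/t01_norm.
have -> : \sum_k Ab t i k * ray_coeff v t k j =
    \sum_a v 0 a * \sum_k Ab t i k * A a k j (x0 + t *: v).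
  under [RHS]eq_bigr do rewrite mulr_sumr; rewrite exchange_big; apply: eq_bigr => k _ /=.
  by rewrite mulr_sumr; apply: eq_bigr => a _; ring.
have -> : \sum_k ray_coeff v t i k * Ab t k j =
    \sum_a v 0 a * \sum_k A a i k (x0 + t *: v) * Ab t k j.
  under [RHS]eq_bigr do rewrite mulr_sumr; rewrite exchange_big; apply: eq_bigr => k _ /=.
  by rewrite mulr_suml; apply: eq_bigr => a _; ring.
rewrite -!big_split; apply: eq_bigr => a _ /=; rewrite -!mulrDr; congr (_ * _).
exact: flat.
Qed.

Lemma moved_ray t s : x0 + t *: (s *: eb + v) = (x0 + t *: v) + s *: (t *: eb).
Proof. by rewrite scalerDr !scalerA mulrC addrC -addrA [_ + x0]addrC addrC. Qed.

Lemma is_derive_moved (g : 'rV[R]_n -> R) t s : Ck 1 U g -> 0 <= t <= 1 ->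
  near0 (s *: eb + v) ->
  is_derive s (1 : R) (fun s => g (x0 + t *: (s *: eb + v)))
    (t * pder b g (x0 + t *: (s *: eb + v))).
Proof.
move=> g1 t01 sr.
have Ux : U ((x0 + t *: v) + s *: (t *: eb)).
  by rewrite -moved_ray; apply/VU/ray_box => //; exact/ltW/t01_norm.
rewrite (_ : (fun s => _) = (fun s => g ((x0 + t *: v) + s *: (t *: eb)))); last first.
  by apply/funext => z; rewrite moved_ray.
apply: is_derive_eq; first exact: is_derive_affine Uo g1 Ux.
rewrite (bigD1 b)//= big1 ?addr0 => [|a ab].
  by rewrite !mxE !eqxx mulr1 moved_ray.
by rewrite !mxE (negbTE ab) andbF mulr0 mul0r.
Qed.

Let coeff' t i j s := \sum_a ((a == b)%:R * A a i j (x0 + t *: (s *: eb + v))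
   + (s *: eb + v) 0 a * (t * pder b (A a i j) (x0 + t *: (s *: eb + v)))).
Let coeff'' t i j s := \sum_a ((a == b)%:R * (t * pder b (A a i j) (x0 + t *: (s *: eb + v)))
   + ((a == b)%:R * (t * pder b (A a i j) (x0 + t *: (s *: eb + v)))
     + (s *: eb + v) 0 a * (t * (t * pder b (pder b (A a i j)) (x0 + t *: (s *: eb + v)))))).

Lemma is_derive_moved_coord s a :
  is_derive s (1 : R) (fun s => (s *: eb + v) 0 a) (a == b)%:R.
Proof.
rewrite (_ : (fun s => _) = (fun s => s * (a == b)%:R + v 0 a)); last first.
  by apply/funext => z; rewrite !mxE eqxx.
rewrite -[(a == b)%:R in X in is_derive _ _ _ X]addr0; apply: is_deriveD.
exact: is_derive_linear.
Qed.

Lemma is_derive_moved_coeff t i j s : 0 <= t <= 1 -> near0 (s *: eb + v) ->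
  is_derive s (1 : R) (fun s => ray_coeff (s *: eb + v) t i j) (coeff' t i j s).
Proof.
move=> t01 sr; apply: is_derive_fsum => a; apply: is_derive_fM.
  exact: is_derive_moved_coord.
exact: is_derive_moved (coeff_Ck1 a i j) t01 sr.
Qed.

Lemma is_derive_moved_coeff' t i j s : 0 <= t <= 1 -> near0 (s *: eb + v) ->
  is_derive s (1 : R) (coeff' t i j) (coeff'' t i j s).
Proof.
move=> t01 sr; apply: is_derive_fsum => a; apply: is_deriveD.
  by apply: is_derive_cmul; exact: is_derive_moved (coeff_Ck1 a i j) t01 sr.
apply: is_derive_fM; first exact: is_derive_moved_coord.
by apply: is_derive_cmul; exact: is_derive_moved (Ck_pder b (A2 a i j)) t01 sr.
Qed.

Lemma eqb_norm (a : 'I_n) : `|(a == b)%:R : R| <= 1.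
Proof. by case: (a == b); rewrite ?normr1 ?normr0. Qed.

Lemma t01_le (t m : R) : 0 <= t <= 1 -> `|m| <= C -> `|t * m| <= C.
Proof.
move=> /andP[t0 t1] mC; rewrite normrM (ger0_norm t0).
by apply: le_trans mC; rewrite ler_piMl.
Qed.

Lemma coeff'_le t i j s : 0 <= t <= 1 -> near0 (s *: eb + v) -> `|coeff' t i j s| <= C1.
Proof.
move=> t01 sr; have Vx : box x0 (2 * r) (x0 + t *: (s *: eb + v)).
  by apply: ray_box => //; exact/ltW/t01_norm.
apply: norm_sum_ord_le => a; apply: le_trans (ler_normD _ _) _; apply: lerD.
  by rewrite normrM -[C]mul1r; apply: ler_pM => //; [exact: eqb_norm|exact: AC].
rewrite normrM; apply: ler_pM => //; first exact/ltW/sr.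
by apply: t01_le => //; exact: dAC.
Qed.

Lemma coeff''_le t i j s : 0 <= t <= 1 -> near0 (s *: eb + v) -> `|coeff'' t i j s| <= C2.
Proof.
move=> t01 sr; have Vx : box x0 (2 * r) (x0 + t *: (s *: eb + v)).
  by apply: ray_box => //; exact/ltW/t01_norm.
have dbC a : `|(a == b)%:R * (t * pder b (A a i j) (x0 + t *: (s *: eb + v)))| <= C.
  rewrite normrM -[C]mul1r; apply: ler_pM => //; first exact: eqb_norm.
  by apply: t01_le => //; exact: dAC.
apply: norm_sum_ord_le => a; apply: le_trans (ler_normD _ _) _; apply: lerD => //.
apply: le_trans (ler_normD _ _) _; apply: lerD => //.
rewrite normrM; apply: ler_pM => //; first exact/ltW/sr.
by do 2 (apply: t01_le => //); exact: ddAC.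
Qed.

Lemma coeff'0 t i j : coeff' t i j 0 = Ab t i j + t * dbB t i j.
Proof.
rewrite /coeff' scale0r add0r big_split /=; congr (_ + _).
  rewrite (bigD1 b)//= eqxx mul1r big1 ?addr0// => a /negbTE ->.
  by rewrite mul0r.
by rewrite mulr_sumr; apply: eq_bigr => a _; rewrite mulrCA.
Qed.

Variable h : R.
Hypothesis hr : forall s : R, `|s| <= `|h| -> near0 (s *: eb + v).
Let vh := h *: eb + v.
Let vhr : near0 vh. Proof. exact: hr. Qed.

Lemma coeff_moved_le t i j : 0 <= t <= 1 ->
  `|ray_coeff vh t i j - ray_coeff v t i j| <= C1 * `|h|.
Proof.
move=> t01.
have [|c ch E] := @mean_value0 R (fun s => ray_coeff (s *: eb + v) t i j) (coeff' t i j) h.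
  by move=> s sh; apply: is_derive_moved_coeff => //; exact: hr.
move: E; rewrite scale0r add0r -/vh => ->; rewrite normrM ler_wpM2r//.
by apply: coeff'_le => //; exact: hr.
Qed.

Lemma coeff_moved_taylor t i j : 0 <= t <= 1 ->
  `|ray_coeff vh t i j - ray_coeff v t i j - h * (Ab t i j + t * dbB t i j)| <= C2 * h ^+ 2.
Proof.
move=> t01.
have := @taylor_bound R (fun s => ray_coeff (s *: eb + v) t i j)
  (coeff' t i j) (coeff'' t i j) C2 h.
rewrite scale0r add0r -/vh coeff'0; apply => s sh.
- by apply: is_derive_moved_coeff => //; exact: hr.
- by apply: is_derive_moved_coeff' => //; exact: hr.
- by apply: coeff''_le => //; exact: hr.
Qed.

Variable m : R.
Hypothesis Ym : forall t, 0 <= t <= 1 -> forall i, `|Y v t i| <= m.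

Let D t i := Y vh t i - Y v t i - (t * h) * \sum_j Ab t i j * Y v t j.
Let P2 t i j := \sum_k ray_coeff v t i k * Ab t k j.
Let P3 t i j := \sum_k ray_coeff vh t i k * Ab t k j.
Let rem t i j := (ray_coeff vh t i j - ray_coeff v t i j - h * (Ab t i j + t * dbB t i j))
  + (t * h) * (P3 t i j - P2 t i j).
Let K : R := C2 + N * (C1 * C).

Lemma rem_le t i j : 0 <= t <= 1 -> `|rem t i j| <= K * h ^+ 2.
Proof.
move=> t01; rewrite /K mulrDl; apply: le_trans (ler_normD _ _) _.
apply: lerD; first exact: coeff_moved_taylor.
have p : `|P3 t i j - P2 t i j| <= N * (C1 * `|h| * C).
  rewrite /P3 /P2 -sumrB; apply: norm_sum_le => k; rewrite -mulrBl normrM.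
  apply: ler_pM => //; first exact: coeff_moved_le.
  by apply: AC; apply: ray_box => //; exact/ltW/t01_norm.
rewrite normrM; apply: (@le_trans _ _ (`|h| * (N * (C1 * `|h| * C)))).
  apply: ler_pM => //; rewrite normrM; case/andP: t01 => t0 t1.
  by rewrite (ger0_norm t0) ler_piMl.
by rewrite -[h ^+ 2]ger0_norm ?sqr_ge0// normrX expr2 le_eqVlt; apply/orP; left; apply/eqP; ring.
Qed.

(** The deviation [D] compares the variation of the ray solution under a
    change of direction by [h *: eb] with the value [t h A_b Y] predicted by
    the system. Integrability makes the terms of first order in [h] cancel in
    its derivative, which leaves the same linear equation with an error of
    second order. *)
Lemma ray_deviation_derive (t : R) i : 0 <= t <= 1 ->
  is_derive t (1 : R) (fun s => D s i)
    (\sum_j ray_coeff vh t i j * D t j + \sum_j rem t i j * Y v t j).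
Proof.
move=> t01; have t2 := t01_norm t01.
have Ux : U (x0 + t *: v) by apply/VU/ray_box => //; exact/ltW.
have d1 := Yd vhr t2; have d2 := Yd vr t2.
have dA j : is_derive t (1 : R) (fun s => Ab s i j) (dAb t i j).
  exact: is_derive_affine Uo (coeff_Ck1 b i j) Ux.
have dth : is_derive t (1 : R) (fun s => s * h) h.
  exact: is_derive_linear.
have dS := is_derive_fsum (fun j => is_derive_fM (dA j) (d2 j)).
apply: is_derive_eq.
rewrite -[(t * h) *: _]/(t * h * _) -[_ *: h]/(_ * h) [(\sum_j _) * h]mulrC.
have E1 : \sum_j Ab t i j * (\sum_k ray_coeff v t j k * Y v t k) =
   \sum_j (\sum_k Ab t i k * ray_coeff v t k j) * Y v t j.
  under eq_bigr do rewrite mulr_sumr; rewrite exchange_big; apply: eq_bigr => j _ /=.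
  by rewrite mulr_suml; apply: eq_bigr => k _; ring.
have E2 : \sum_j ray_coeff vh t i j * D t j =
   \sum_j (ray_coeff vh t i j * (Y vh t j - Y v t j) - t * h * (P3 t i j * Y v t j)).
  rewrite sumrB -mulr_sumr.
  have -> : \sum_j P3 t i j * Y v t j =
      \sum_j ray_coeff vh t i j * \sum_k Ab t j k * Y v t k.
    under [RHS]eq_bigr do rewrite mulr_sumr; rewrite exchange_big; apply: eq_bigr => j _ /=.
    by rewrite mulr_suml; apply: eq_bigr => k _; ring.
  by rewrite mulr_sumr -sumrB; apply: eq_bigr => j _; rewrite /D; ring.
rewrite big_split /= E1 -big_split /= !mulr_sumr -big_split /= -!sumrB E2 -big_split /=.
apply: eq_bigr => j _ /=.
have := ray_flat i j t01; rewrite -/(P2 t i j) => /eqP; rewrite -subr_eq => /eqP E3.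
rewrite /rem.
move: E3; set p1 := \sum_k _; move=> E3.
have -> : dAb t i j = dbB t i j + P2 t i j - p1 by rewrite -E3; ring.
by ring.
Qed.

(** Gronwall's estimate turns the second-order error of the equation into a
    second-order bound of the deviation. *)
Lemma ray_deviation_le i : `|D 1 i| <= (2 * N * (N * (K * m))) * h ^+ 2.
Proof.
have t1 : 0 <= (1 : R) <= 1 by rewrite ler01 lexx.
have b0 : 0 <= beta by rewrite !mulr_ge0// ltW.
have small' : N * beta <= 2^-1 by apply: le_trans small _; lra.
rewrite -mulrA.
apply: (@gronwall_short R I D _ beta (N * (K * m) * h ^+ 2) b0 small' _ _ _ 1 t1 i).
- by move=> j; rewrite /D mul0r mul0r subr0 !Y0// subrr.
- by move=> t t01 j; exact: ray_deviation_derive.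
move=> t t01 j; apply: le_trans (ler_normD _ _) _; apply: lerD.
  rewrite mulr_sumr; apply: le_trans (ler_norm_sum _ _ _) _.
  apply: ler_sum => k _; rewrite normrM ler_wpM2r//.
  by apply: ray_coeff_le => //; exact/ltW/t01_norm.
rewrite -mulrA; apply: norm_sum_le => k; rewrite normrM.
have -> : K * m * h ^+ 2 = K * h ^+ 2 * m by ring.
by apply: ler_pM => //; [exact: rem_le|exact: Ym].
Qed.

End Solution.

(** The solution takes at [x] the value reached along the ray from [x0] to [x].
    At time 1 the deviation estimate says that its increment in the direction of an axis
    is the prescribed derivative up to second order. *)
Lemma frobenius_radius (y0 : I -> R) : exists F : I -> 'rV[R]_n -> R,
  [/\ forall i, F i x0 = y0 i,
      forall x, box x0 r x -> forall a i,
        is_derive x (delta_mx 0 a : 'rV[R]_n) (F i) (\sum_j A a i j x * F j x) &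
      exists m : R, forall x, box x0 r x -> forall i, `|F i x| <= m].
Proof.
have exY (v : 'rV[R]_n) : exists Y : R -> I -> R, near0 v ->
    (forall i, Y 0 i = y0 i) /\
    (forall t : R, `|t| < 3 / 2 -> forall i,
     is_derive t (1 : R) (fun s => Y s i) (\sum_j ray_coeff v t i j * Y t j)).
  have [vr|nvr] := pselect (near0 v); last by exists (fun _ _ => 0).
  by have [Y hY] := ray_solution y0 vr; exists Y.
have [Y YP] := choice exY.
have Y0 v : near0 v -> forall i, Y v 0 i = y0 i by move=> /YP[].
have Yd v : near0 v -> forall t : R, `|t| < 3 / 2 -> forall i,
    is_derive t (1 : R) (fun s => Y v s i) (\sum_j ray_coeff v t i j * Y v t j).
  by move=> /YP[].
have b0 : 0 <= beta by rewrite !mulr_ge0// ltW.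
have small' : N * beta <= 2^-1 by apply: le_trans small _; lra.
pose e0 := beta * \sum_j `|y0 j|.
have Yb v (t : R) : near0 v -> 0 <= t <= 1 -> forall i, `|Y v t i| <= 2 * N * e0 + \sum_j `|y0 j|.
  move=> vr t01 i; rewrite -[Y v t i](subrK (y0 i)); apply: le_trans (ler_normD _ _) _.
  apply: lerD; last by rewrite (bigD1 i)//= lerDl sumr_ge0.
  apply: (@gronwall_short R I (fun t i => Y v t i - y0 i)
     (fun t i => \sum_j ray_coeff v t i j * Y v t j) beta e0 b0 small') => //.
  - by move=> j; rewrite Y0// subrr.
  - move=> s s01 j; apply: is_derive_eq.
      by apply: is_deriveB; apply: Yd => //; exact: t01_norm.
    by rewrite subr0.
  move=> s s01 j; rewrite /e0 -mulrDr -big_split /= mulr_sumr.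
  apply: le_trans (ler_norm_sum _ _ _) _; apply: ler_sum => k _; rewrite normrM.
  apply: ler_pM => //; first by apply: ray_coeff_le => //; exact/ltW/t01_norm.
  by rewrite -{1}[Y v s k](subrK (y0 k)) ler_normD.
have one01 : 0 <= (1 : R) <= 1 by rewrite ler01 lexx.
have vrx x : box x0 r x -> near0 (x - x0) by move=> xr a; rewrite !mxE; exact: xr.
exists (fun i x => Y (x - x0) 1 i); split.
- by move=> i; rewrite subrr; exact: ray_solution_center Y0 Yd i.
- move=> x xr b i; set v := x - x0; have vr : near0 v := vrx _ xr.
  have : nbhs v (box 0 r).
    by apply: open_nbhs_nbhs; split; [exact: box_open|move=> a; rewrite [X in _ - X]mxE subr0; exact: vr].
  move=> /nbhs_rVP[d d0 dP].
  have nh (s : R) : `|s| < d -> near0 (s *: delta_mx 0 b + v).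
    move=> sd a; have := dP (s *: delta_mx 0 b) _ a.
    rewrite [X in `|_ - X|]mxE subr0 addrC; apply => j.
    rewrite !mxE eqxx /= normrM; apply: le_lt_trans sd.
    by rewrite ler_piMr//; case: (j == b); rewrite ?normr1 ?normr0.
  apply: (@is_derive_quadratic R _ _ _ _ _ _ d d0) => h hd.
  have hr s : `|s| <= `|h| -> near0 (s *: delta_mx 0 b + v).
    by move=> sh; apply: nh; exact: le_lt_trans hd.
  have := ray_deviation_le Y0 Yd vr hr (fun t t01 => Yb v t vr t01) i.
  rewrite mul1r scale1r.
  have -> : h *: delta_mx 0 b + x - x0 = h *: delta_mx 0 b + v by rewrite /v addrA.
  by rewrite (_ : x0 + v = x) ?/v; [apply|rewrite addrC subrK].
- by exists (2 * N * e0 + \sum_j `|y0 j|) => x xr i; apply: Yb => //; exact: vrx.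
Qed.

(** Along each ray [D] solves a linear ordinary differential equation with
    initial value zero. *)
Lemma frobenius_unique_radius (D : I -> 'rV[R]_n -> R) :
  (forall i, Ck 1 U (D i)) ->
  (forall x, box x0 (2 * r) x -> forall a i, pder a (D i) x = \sum_j A a i j x * D j x) ->
  (forall i, D i x0 = 0) ->
  forall x, box x0 r x -> forall i, D i x = 0.
Proof.
move=> D1 Dd D0 x xr i; set v := x - x0.
have vr : near0 v by move=> a; rewrite !mxE; exact: xr.
have one01 : 0 <= (1 : R) <= 1 by rewrite ler01 lexx.
have -> : x = x0 + (1 : R) *: v by rewrite scale1r /v addrC subrK.
have b0 : 0 <= beta by rewrite !mulr_ge0// ltW.
have small' : N * beta <= 2^-1 by apply: le_trans small _; lra.
apply: (@linear_ode_unique R I (ray_coeff v) (fun t i => D i (x0 + t *: v)) beta) => //.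
- by move=> t k j t01; apply: ray_coeff_le => //; exact/ltW/t01_norm.
- by move=> j; rewrite scale0r addr0.
move=> t t01 j; have Vx : box x0 (2 * r) (x0 + t *: v) by apply: ray_box => //; exact/ltW/t01_norm.
apply: is_derive_eq; first exact: is_derive_affine Uo (D1 j) (VU Vx).
under eq_bigr do rewrite Dd// mulr_sumr; rewrite exchange_big; apply: eq_bigr => k _ /=.
by rewrite /ray_coeff mulr_suml; apply: eq_bigr => a _; rewrite mulrA.
Qed.

End Radius.

Lemma frobenius_radius_exists : U x0 -> exists C r : R, [/\ 0 <= C, 0 < r &
  [/\ box x0 (2 * r) `<=` U,
   forall x, box x0 (2 * r) x -> forall a i j, `|A a i j x| <= C,
   forall x, box x0 (2 * r) x -> forall a b i j, `|pder b (A a i j) x| <= C,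
   forall x, box x0 (2 * r) x -> forall a b i j, `|pder b (pder b (A a i j)) x| <= C &
   N * (n%:R * (r * C)) <= 3^-1]].
Proof.
move=> Ux0.
have [C1 [C10 h1]] := @locally_bounded R n ('I_n * I * I)%type
  (fun k => A k.1.1 k.1.2 k.2) x0 (fun k => Ck_cont (A2 _ _ _) Ux0).
have [C2 [C20 h2]] := @locally_bounded R n ('I_n * 'I_n * I * I)%type
  (fun k => pder k.1.1.2 (A k.1.1.1 k.1.2 k.2)) x0
  (fun k => Ck_cont (Ck_pder _ (A2 _ _ _)) Ux0).
have [C3 [C30 h3]] := @locally_bounded R n ('I_n * 'I_n * I * I)%type
  (fun k => pder k.1.1.2 (pder k.1.1.2 (A k.1.1.1 k.1.2 k.2))) x0
  (fun k => Ck_cont (Ck_pder _ (Ck_pder _ (A2 _ _ _))) Ux0).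
pose C := C1 + C2 + C3; have C0 : 0 <= C by rewrite !addr_ge0.
have hU : nbhs x0 U by exact: open_nbhs_nbhs.
have [d d0 dP] := (nbhs_boxP x0 _).1 (filterI (filterI hU h1) (filterI h2 h3)).
pose q := 3 * (N * (n%:R * C) + 1).
have q0 : 0 < q by rewrite mulr_gt0// ltr_wpDl// !mulr_ge0.
pose r := Num.min (d / 2) q^-1.
have r0 : 0 < r by rewrite lt_min divr_gt0//= invr_gt0.
have rd : box x0 (2 * r) `<=` box x0 d.
  move=> x xr i; apply: lt_le_trans (xr i) _.
  by rewrite mulrC -ler_pdivlMr// ge_min lexx.
exists C, r; split => //; split.
- by move=> x /rd /dP[[]].
- move=> x /rd /dP[[_ h] _] a i j; apply: le_trans (h (a, i, j)) _.
  by rewrite /C -addrA lerDl addr_ge0.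
- move=> x /rd /dP[_ [h _]] a b i j; apply: le_trans (h (a, b, i, j)) _.
  by rewrite /C addrAC lerDr addr_ge0.
- move=> x /rd /dP[_ [_ h]] a b i j; apply: le_trans (h (a, b, i, j)) _.
  by rewrite /C lerDr addr_ge0.
have -> : N * (n%:R * (r * C)) = N * (n%:R * C) * r by ring.
apply: (@le_trans _ _ (N * (n%:R * C) * q^-1)).
  by rewrite ler_wpM2l ?mulr_ge0// ge_min lexx orbT.
by rewrite ler_pdivrMr// /q mulKf ?pnatr_eq0// lerDl.
Qed.

(** Frobenius' theorem for linear total differential systems: the condition
    obtained by equating mixed derivatives is sufficient. The solution
    inherits the regularity of the coefficients because its partial
    derivatives are given by the system itself. *)
Theorem frobenius : U x0 -> exists2 r : R, 0 < r & box x0 r `<=` U /\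
  forall y0 : I -> R, exists F : I -> 'rV[R]_n -> R,
  [/\ forall i, F i x0 = y0 i,
      forall x, box x0 r x -> forall a i, pder a (F i) x = \sum_j A a i j x * F j x &
      forall k, (forall a i j, Ck k U (A a i j)) -> forall i, Ck k (box x0 r) (F i)].
Proof.
move=> Ux0; have [C [r [C0 r0 [VU AC dAC ddAC small]]]] := frobenius_radius_exists Ux0.
have rr : box x0 r `<=` box x0 (2 * r).
  by move=> x xr i; apply: lt_le_trans (xr i) _; lra.
exists r => //; split; first by move=> x /rr /VU.
move=> y0; have [F [F0 Fd [m Fm]]] := frobenius_radius C0 r0 VU AC dAC ddAC small y0.
have FE x a i : box x0 r x -> pder a (F i) x = \sum_j A a i j x * F j x.
  by move=> xr; have [_] := Fd x xr a i.
have Fcont i x : box x0 r x -> {for x, continuous (F i)}.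
  move=> xr; have /nbhs_boxP[d d0 dP] : nbhs x (box x0 r).
    by apply: open_nbhs_nbhs; split => //; exact: box_open.
  apply: (@bounded_pder_continuous R n (F i) x d (N * (C * m)) d0) => y a /dP yr.
  split; first by have [] := Fd y yr a i.
  rewrite FE//; apply: norm_sum_le => j; rewrite normrM; apply: ler_pM => //.
    by apply: AC; exact: rr.
  exact: Fm.
exists F; split => //; first by move=> x xr a i; exact: FE.
have bo := @box_open R n x0 r.
elim=> [|k IH] Ak i; first by split => // x; exact: Fcont.
split; first by move=> x; exact: Fcont.
move=> a; split; first by move=> x xr; have [] := Fd x xr a i.
apply: (@Ck_ext _ _ k _ (fun x => \sum_j A a i j x * F j x)) => //.
  by move=> x xr; rewrite FE.
apply: Ck_sum => // j _; apply: CkM => //; last by apply: IH => *; exact: CkS.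
by apply: Ck_sub (CkS (Ak _ _ _)) => x /rr /VU.
Qed.

Lemma frobenius_unique (D : I -> 'rV[R]_n -> R) : U x0 ->
  (forall i, Ck 1 U (D i)) ->
  (forall x, U x -> forall a i, pder a (D i) x = \sum_j A a i j x * D j x) ->
  (forall i, D i x0 = 0) ->
  exists2 r : R, 0 < r & forall x, box x0 r x -> forall i, D i x = 0.
Proof.
move=> Ux0 D1 Dd D0; have [C [r [C0 r0 [VU AC dAC ddAC small]]]] := frobenius_radius_exists Ux0.
exists r => //; apply: (frobenius_unique_radius C0 r0 VU AC) => //.
by move=> x /VU; exact: Dd.
Qed.

End Frobenius.

(** * Christoffel symbols and curvature in coordinates *)

Lemma sum_delta {R : comNzRingType} {T : finType} (a : T) (v : T -> R) :
  \sum_l (a == l)%:R * v l = v a.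
Proof.
rewrite (bigD1 a)//= eqxx mul1r big1 ?addr0// => l; rewrite eq_sym => /negbTE ->.
by rewrite mul0r.
Qed.

Section Curvature.
Context {R : realType} {n : nat}.
Variables (G : 'rV[R]_n -> 'M[R]_n) (U : set 'rV[R]_n).
Hypothesis Uo : open U.
Hypothesis Gsmooth : forall k a b, Ck k U (fun x => G x a b).
Hypothesis Gsym : forall x, U x -> (G x)^T = G x.
Hypothesis Gpos : forall x, U x -> posdefmx (G x).
Implicit Types (x : 'rV[R]_n) (a b c d e f i j k l : 'I_n).

Local Notation Gam := (christoffel G).

(** Christoffel symbols of the first kind, [chr1 l i j = Gamma_{l,ij}]. They
    are linear in the derivatives of the metric, so the symmetries of the
    curvature are easier to see on them than on the symbols of the second
    kind. *)
Definition chr1 l i j x : R :=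
  2^-1 * (pder i (fun y => G y j l) x + pder j (fun y => G y i l) x
          - pder l (fun y => G y i j) x).

Lemma metric_unit x : U x -> G x \in unitmx.
Proof. by move=> Ux; apply: posdefmx_unit; exact: Gpos. Qed.

Lemma metricC x i j : U x -> G x i j = G x j i.
Proof. by move=> Ux; rewrite -{1}(Gsym Ux) mxE. Qed.

Lemma inv_metricC x i j : U x -> invmx (G x) i j = invmx (G x) j i.
Proof. by move=> Ux; rewrite -{1}(Gsym Ux) -trmx_inv mxE. Qed.

Lemma pder_metricC x c i j : U x -> pder c (fun y => G y i j) x = pder c (fun y => G y j i) x.
Proof. by move=> Ux; apply: (pder_ext c Uo Ux) => y; exact: metricC. Qed.

Lemma pder2_metricC x c d i j : U x ->
  pder c (pder d (fun y => G y i j)) x = pder c (pder d (fun y => G y j i)) x.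
Proof. by move=> Ux; apply: (pder_ext c Uo Ux) => y; exact: pder_metricC. Qed.

Lemma chr1_sym x l i j : U x -> chr1 l i j x = chr1 l j i x.
Proof.
move=> Ux; rewrite /chr1 (pder_metricC l i j Ux) [X in _ * (X - _)]addrC //.
Qed.

Lemma christoffelE k i j x : Gam k i j x = \sum_l invmx (G x) k l * chr1 l i j x.
Proof.
rewrite /christoffel mulr_sumr; apply: eq_bigr => l _; rewrite /chr1; ring.
Qed.

Lemma christoffel_sym x k i j : U x -> Gam k i j x = Gam k j i x.
Proof. by move=> Ux; rewrite !christoffelE; apply: eq_bigr => l _; rewrite chr1_sym. Qed.

Lemma mul_metric_inv x a l : U x -> \sum_k G x a k * invmx (G x) k l = (a == l)%:R.
Proof. by move=> Ux; have /matrixP/(_ a l) := mulmxV (metric_unit Ux); rewrite !mxE. Qed.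

Lemma mul_inv_metric x a l : U x -> \sum_k invmx (G x) a k * G x k l = (a == l)%:R.
Proof. by move=> Ux; have /matrixP/(_ a l) := mulVmx (metric_unit Ux); rewrite !mxE. Qed.

Lemma lower_raise x (v : 'I_n -> R) a : U x ->
  \sum_k G x a k * (\sum_l invmx (G x) k l * v l) = v a.
Proof.
move=> Ux; under eq_bigr do rewrite mulr_sumr; rewrite exchange_big /=.
rewrite -[RHS]sum_delta; apply: eq_bigr => l _; rewrite -(mul_metric_inv _ _ Ux) mulr_suml.
by apply: eq_bigr => k _; rewrite mulrA.
Qed.

Lemma raise_lower x (v : 'I_n -> R) a : U x ->
  \sum_k invmx (G x) a k * (\sum_l G x k l * v l) = v a.
Proof.
move=> Ux; under eq_bigr do rewrite mulr_sumr; rewrite exchange_big /=.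
rewrite -[RHS]sum_delta; apply: eq_bigr => l _; rewrite -(mul_inv_metric _ _ Ux) mulr_suml.
by apply: eq_bigr => k _; rewrite mulrA.
Qed.

(** Identities between mixed components may be checked after lowering an
    index. *)
Lemma lower_inj x (v w : 'I_n -> R) : U x ->
  (forall a, \sum_k G x a k * v k = \sum_k G x a k * w k) -> forall a, v a = w a.
Proof.
move=> Ux vw a; rewrite -(raise_lower v a Ux) -(raise_lower w a Ux).
by apply: eq_bigr => k _; rewrite vw.
Qed.

Lemma lower_christoffel x a i j : U x -> \sum_k G x a k * Gam k i j x = chr1 a i j x.
Proof.
move=> Ux; under eq_bigr do rewrite christoffelE.
exact: (lower_raise (fun l => chr1 l i j x)).
Qed.

Lemma metric_compat x a b c : U x ->
  pder c (fun y => G y a b) x = chr1 a c b x + chr1 b c a x.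
Proof.
move=> Ux; rewrite /chr1 (pder_metricC c b a Ux) (pder_metricC b c a Ux) (pder_metricC a c b Ux).
set p := pder a _ x; set q := pder b _ x; set r := pder c _ x.
by clearbody p q r; field.
Qed.

Lemma chr1_smooth m l i j : Ck m U (chr1 l i j).
Proof.
apply: CkZ => //; apply: CkB => //; last exact: Ck_pder (Gsmooth _ _ _).
by apply: CkD => //; exact: Ck_pder (Gsmooth _ _ _).
Qed.

Lemma invmx_smooth m i j : Ck m U (fun x => invmx (G x) i j).
Proof. by apply: Ck_invmx => //; exact: metric_unit. Qed.

Lemma christoffel_smooth m k i j : Ck m U (Gam k i j).
Proof.
apply: (@Ck_ext _ _ _ _ (fun x => \sum_l invmx (G x) k l * chr1 l i j x)) => //.
  by move=> x Ux; rewrite christoffelE.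
by apply: Ck_sum => // l _; apply: CkM => //; [exact: invmx_smooth|exact: chr1_smooth].
Qed.

Lemma riemann_smooth m a b c d : Ck m U (fun x => riemann G x a b c d).
Proof.
apply: Ck_sum => // e _; apply: CkM => //.
apply: CkD => //.
  by apply: CkB => //; exact: Ck_pder (christoffel_smooth _ _ _ _).
apply: Ck_sum => // f _; apply: CkB => //; apply: CkM => //; exact: christoffel_smooth.
Qed.

(** The part of the lowered curvature that is quadratic in the Christoffel
    symbols; it is a symmetric form on the pairs of lower indices. *)
Definition chr_dot x i j k l : R := \sum_e chr1 e i j x * Gam e k l x.

Lemma chr_dotC x i j k l : U x -> chr_dot x i j k l = chr_dot x k l i j.
Proof.
move=> Ux; rewrite /chr_dot; under eq_bigr do rewrite christoffelE mulr_sumr.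
under [RHS]eq_bigr do rewrite christoffelE mulr_sumr.
rewrite exchange_big /=; apply: eq_bigr => e _; apply: eq_bigr => f _.
by rewrite (inv_metricC _ _ Ux); ring.
Qed.

Lemma chr_dotsl x i j k l : U x -> chr_dot x i j k l = chr_dot x j i k l.
Proof. by move=> Ux; apply: eq_bigr => e _; rewrite chr1_sym. Qed.

Lemma chr_dotsr x i j k l : U x -> chr_dot x i j k l = chr_dot x i j l k.
Proof. by move=> Ux; apply: eq_bigr => e _; rewrite christoffel_sym. Qed.

Lemma lower_pder_christoffel x a c d b : U x ->
  \sum_e G x a e * pder c (Gam e d b) x =
  pder c (chr1 a d b) x - \sum_e (chr1 a c e x + chr1 e c a x) * Gam e d b x.
Proof.
move=> Ux.
have -> : pder c (chr1 a d b) x = pder c (fun y => \sum_e G y a e * Gam e d b y) x.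
  by apply: (pder_ext c Uo Ux) => y Uy; rewrite lower_christoffel.
rewrite pder_sum; last first.
  move=> e; apply: derivable_fM; first by have h := Ck_derivable c (Gsmooth 1 a e) Ux; exact: h.
  by have h := Ck_derivable c (christoffel_smooth 1 e d b) Ux; exact: h.
rewrite -sumrB; apply: eq_bigr => e _.
have h1 := Ck_derivable c (Gsmooth 1 a e) Ux.
have h2 := Ck_derivable c (christoffel_smooth 1 e d b) Ux.
rewrite (pderM h1 h2) metric_compat//.
by rewrite addrAC subrr add0r.
Qed.

(** Lowering the index of [d Gamma] produces derivatives of the metric, which
    metric compatibility trades for products of symbols; these combine with
    the quadratic part of the curvature. *)
Lemma riemannE x a b c d : U x -> riemann G x a b c d =
  pder c (chr1 a d b) x - pder d (chr1 a c b) x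
  + (chr_dot x d a c b - chr_dot x c a d b).
Proof.
move=> Ux.
have E1 c' d' : \sum_e G x a e * \sum_f Gam e c' f x * Gam f d' b x =
    \sum_f chr1 a c' f x * Gam f d' b x.
  under eq_bigr do rewrite mulr_sumr; rewrite exchange_big; apply: eq_bigr => f _ /=.
  rewrite -(lower_christoffel _ _ _ Ux) mulr_suml; apply: eq_bigr => e _; ring.
rewrite /riemann.
transitivity (\sum_e G x a e * pder c (Gam e d b) x - \sum_e G x a e * pder d (Gam e c b) x
   + (\sum_e G x a e * \sum_f Gam e c f x * Gam f d b x
      - \sum_e G x a e * \sum_f Gam e d f x * Gam f c b x)).
  rewrite -!sumrB -big_split; apply: eq_bigr => e _ /=.
  by rewrite sumrB !mulrDr !mulrN.
transitivity
  ((pder c (chr1 a d b) x - \sum_e (chr1 a c e x + chr1 e c a x) * Gam e d b x)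
   - (pder d (chr1 a c b) x - \sum_e (chr1 a d e x + chr1 e d a x) * Gam e c b x)
   + (\sum_f chr1 a c f x * Gam f d b x - \sum_f chr1 a d f x * Gam f c b x)).
  congr (_ - _ + (_ - _)).
  - exact: lower_pder_christoffel.
  - exact: lower_pder_christoffel.
  - exact: E1.
  - exact: E1.
rewrite /chr_dot.
set A := \sum_e (_ + _) * _; set B := \sum_e (_ + _) * _.
have -> : A = \sum_f chr1 a c f x * Gam f d b x + \sum_e chr1 e c a x * Gam e d b x.
  by rewrite /A -big_split; apply: eq_bigr => e _; rewrite mulrDl.
have -> : B = \sum_f chr1 a d f x * Gam f c b x + \sum_e chr1 e d a x * Gam e c b x.
  by rewrite /B -big_split; apply: eq_bigr => e _; rewrite mulrDl.
move: (pder _ _ x) (pder _ _ x) (\sum_f _) (\sum_f _) (\sum_e _) (\sum_e _) => p q s1 s2 s3 s4.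
ring.
Qed.

Lemma pder_chr1 x c l i j : U x -> pder c (chr1 l i j) x =
  2^-1 * (pder c (pder i (fun y => G y j l)) x + pder c (pder j (fun y => G y i l)) x
          - pder c (pder l (fun y => G y i j)) x).
Proof.
move=> Ux.
have dd i' j' k' : derivable (pder i' (fun y => G y j' k')) x (delta_mx 0 c).
  by have h := Ck_derivable c (Ck_pder i' (Gsmooth 2 j' k')) Ux; exact: h.
have [_ E] : is_derive x (delta_mx 0 c : 'rV[R]_n) (chr1 l i j)
   (2^-1 * (pder c (pder i (fun y => G y j l)) x + pder c (pder j (fun y => G y i l)) x
          - pder c (pder l (fun y => G y i j)) x)); last exact: E.
apply: is_derive_cmul; apply: is_deriveB; last exact/derivableP.
by apply: is_deriveD; exact/derivableP.
Qed.

(** The curvature consists of second derivatives of the metric and of the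
    symmetric form [chr_dot], and both parts have the symmetries of a
    curvature operator. *)
Lemma riemann_sym x : U x -> op_symmetric (riemann G x).
Proof.
move=> Ux.
have [H HE] : exists H : 'I_n -> 'I_n -> 'I_n -> 'I_n -> R, forall c d i j,
    pder c (pder d (fun y => G y i j)) x = H c d i j.
  by exists (fun c d i j => pder c (pder d (fun y => G y i j)) x).
have H1 c d i j : H c d i j = H d c i j.
  by rewrite -!HE; have h := pderC c d Uo (Gsmooth 2 i j) Ux; exact: h.
have H2 c d i j : H c d i j = H c d j i by rewrite -!HE; exact: pder2_metricC.
have [C CE] : exists C : 'I_n -> 'I_n -> 'I_n -> 'I_n -> R, forall i j k l,
    chr_dot x i j k l = C i j k l by exists (chr_dot x).
have C1 i j k l : C i j k l = C k l i j by rewrite -!CE; exact: chr_dotC.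
have C2 i j k l : C i j k l = C j i k l by rewrite -!CE; exact: chr_dotsl.
have C3 i j k l : C i j k l = C i j l k by rewrite -!CE; exact: chr_dotsr.
have RE a b c d : riemann G x a b c d =
   2^-1 * (H b c a d - H a c b d - H b d a c + H a d b c) + (C a d b c - C a c b d).
  rewrite riemannE// !pder_chr1// !HE !CE (C2 d a) (C3 a d) (C2 c a) (C3 a c).
  rewrite (H1 c d) (H1 c b) (H1 c a) (H1 d b) (H1 d a).
  rewrite (H2 b c d a) (H2 a c d b) (H2 b d c a) (H2 a d c b); ring.
split=> a b c d; rewrite !RE.
- by rewrite (C1 b d a c) (C1 b c a d); ring.
- by ring.
rewrite (C1 c b d a) (C1 c a d b) (C2 d a) (C3 a d) (C2 d b) (C3 b d) (C1 b d a c).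
rewrite (H1 d a) (H1 c a) (H1 d b) (H1 c b).
rewrite (H2 a d c b) (H2 a c d b) (H2 b d c a) (H2 b c d a); ring.
Qed.

End Curvature.

(** * Smoothness of a solution of the Gauss equation *)

Section GaussRoot.
Context {R : realType} {n : nat}.
Implicit Types (h : 'M[R]_n) (a b c : 'I_n).

Lemma delta_form h a b : ((delta_mx 0 a : 'rV[R]_n) *m h *m (delta_mx 0 b : 'rV[R]_n)^T) 0 0 = h a b.
Proof. by rewrite trmx_delta -rowE -colE !mxE. Qed.

Lemma triple_form h a b c (p q r : R) :
  let v := p *: delta_mx 0 a + q *: delta_mx 0 b + r *: delta_mx 0 c : 'rV[R]_n in
  (v *m h *m v^T) 0 0 = p * (p * h a a + q * h b a + r * h c a)
   + q * (p * h a b + q * h b b + r * h c b) + r * (p * h a c + q * h b c + r * h c c).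
Proof.
move=> v; have -> : v^T = p *: (delta_mx 0 a : 'rV[R]_n)^T + q *: (delta_mx 0 b : 'rV[R]_n)^T
    + r *: (delta_mx 0 c : 'rV[R]_n)^T by rewrite /v !raddfD /= !linearZ.
rewrite !mulmxDr -!scalemxAr /v !mulmxDl -!scalemxAl.
have E (A B : 'M[R]_1) : (A + B) 0 0 = A 0 0 + B 0 0 by rewrite mxE.
have E' s (A : 'M[R]_1) : (s *: A) 0 0 = s * A 0 0 by rewrite mxE.
by rewrite !(E, E') !delta_form.
Qed.

Lemma posdef_triple h a b c (p q r : R) : posdefmx h -> a != b -> a != c -> b != c ->
  [|| p != 0, q != 0 | r != 0] ->
  0 < p * (p * h a a + q * h b a + r * h c a)
   + q * (p * h a b + q * h b b + r * h c b) + r * (p * h a c + q * h b c + r * h c c).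
Proof.
move=> hp ab ac bc nz; rewrite -triple_form; apply: hp.
set v := _ + _; have va : v 0 a = p.
  by rewrite !mxE !eqxx (negbTE ab) (negbTE ac) !mulr0 !addr0 mulr1.
have vb : v 0 b = q.
  by rewrite !mxE !eqxx eq_sym (negbTE ab) (negbTE bc) !mulr0 addr0 add0r mulr1.
have vc : v 0 c = r.
  by rewrite !mxE !eqxx eq_sym (negbTE ac) eq_sym (negbTE bc) !mulr0 !add0r mulr1.
apply/eqP => v0; move: nz; rewrite -va -vb -vc v0 !mxE eqxx //.
Qed.

Definition minor3 h a b c : R :=
  h a a * (h b b * h c c - h b c ^+ 2) - h a b * (h a b * h c c - h b c * h a c)
  + h a c * (h a b * h b c - h b b * h a c).

(** Testing the form on [e_a], on the vector of cofactors [(- h_ab, h_aa, 0)]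
    and on the third column of the adjugate gives positivity of the three
    leading minors one after the other. *)
Lemma minor3_gt0 h a b c : h^T = h -> posdefmx h -> a != b -> a != c -> b != c ->
  0 < minor3 h a b c.
Proof.
move=> hs hp ab ac bc; have hC i j : h i j = h j i by rewrite -{1}hs mxE.
have P p q r := posdef_triple (p := p) (q := q) (r := r) hp ab ac bc.
move: P; rewrite /minor3 (hC b a) (hC c a) (hC c b).
move: (h a a) (h b b) (h c c) (h b c) (h a c) (h a b) => x y z u v w P.
have x0 : 0 < x by have := P 1 0 0; rewrite oner_eq0 => /(_ isT); lra.
have m0 : 0 < x * y - w ^+ 2.
  rewrite -(pmulr_rgt0 _ x0); have := P (- w) x 0; rewrite (gt_eqF x0) orbT => /(_ isT).
  by congr (0 < _); ring.
rewrite -(pmulr_lgt0 _ m0).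
have := P (w * u - y * v) (w * v - x * u) (x * y - w ^+ 2); rewrite (gt_eqF m0) !orbT => /(_ isT).
by congr (0 < _); ring.
Qed.

(** The Gauss equation determines [h] algebraically, because the adjugate of a
    three by three minor of [h] consists of curvature components and the
    determinant of an adjugate is the square of the determinant; hence [h] is
    as smooth as the curvature. *)
Lemma gauss_root_smooth (U : set 'rV[R]_n) (h : 'rV[R]_n -> 'M[R]_n)
    (K : 'rV[R]_n -> tensor4 (R := R) (n := n)) k : (3 <= n)%N -> open U ->
  (forall x, U x -> (h x)^T = h x) -> (forall x, U x -> posdefmx (h x)) ->
  (forall x, U x -> forall a b c d, K x a b c d = gauss_tensor (h x) a b c d) ->
  (forall a b c d, Ck k U (fun x => K x a b c d)) ->
  forall a b, Ck k U (fun x => h x a b).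
Proof.
move=> n3 Uo hs hp KE Ks.
have main a b c : a != b -> a != c -> b != c ->
    Ck k U (fun x => h x a a) /\ Ck k U (fun x => h x a b).
  move=> ab ac bc.
  (* The determinant of the adjugate of the minor, hence its square. *)
  pose Q x := K x b c b c * K x a c a c * K x a b a b
    + 2 * K x a c b c * K x a b b c * K x a b a c
    - K x b c b c * K x a b a c ^+ 2 - K x a c a c * K x a b b c ^+ 2
    - K x a b a b * K x a c b c ^+ 2.
  have QE x : U x -> Q x = minor3 (h x) a b c ^+ 2.
    move=> Ux; have hC i j : h x i j = h x j i by rewrite -{1}(hs _ Ux) mxE.
    rewrite /Q !KE// /gauss_tensor /minor3 (hC b a) (hC c a) (hC c b).
    move: (h x a a) (h x b b) (h x c c) (h x b c) (h x a c) (h x a b) => x' y z u v w.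
    ring.
  have D0 x : U x -> 0 < minor3 (h x) a b c.
    by move=> Ux; apply: minor3_gt0; [exact: hs|exact: hp|..].
  have DE x : U x -> Num.sqrt (Q x) = minor3 (h x) a b c.
    by move=> Ux; rewrite QE// sqrtr_sqr ger0_norm// ltW// D0.
  have Q0 x : U x -> 0 < Q x by move=> Ux; rewrite QE// exprn_gt0// D0.
  have Qs : Ck k U Q.
    have E : Q = fun x => K x b c b c * K x a c a c * K x a b a b
      + 2 * K x a c b c * K x a b b c * K x a b a c
      - K x b c b c * (K x a b a c * K x a b a c) - K x a c a c * (K x a b b c * K x a b b c)
      - K x a b a b * (K x a c b c * K x a c b c).
      by apply/funext => x; rewrite /Q !expr2.
    rewrite E; by repeat first [exact: Ks | exact: Ck_cst | apply: CkB => // | apply: CkD => // | apply: CkM => //].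
  have Ss := Ck_sqrt Uo Q0 Qs.
  have S0 x : U x -> Num.sqrt (Q x) != 0 by move=> Ux; rewrite gt_eqF// sqrtr_gt0 Q0.
  have Vs := CkV Uo S0 Ss.
  split.
    apply: (@Ck_ext _ _ _ _ (fun x => (K x a c a c * K x a b a b - K x a b a c * K x a b a c)
       * (Num.sqrt (Q x))^-1)) => //.
      move=> x Ux; apply: canLR (mulfK (S0 _ Ux)) _; rewrite DE// !KE//.
      have hC i j : h x i j = h x j i by rewrite -{1}(hs _ Ux) mxE.
      rewrite /gauss_tensor /minor3 ?(hC b a) ?(hC c a) ?(hC c b).
      move: (h x a a) (h x b b) (h x c c) (h x b c) (h x a c) (h x a b) => x' y z u v w.
      ring.
    by repeat first [exact: Vs | exact: Ks | apply: CkB => // | apply: CkM => //].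
  apply: (@Ck_ext _ _ _ _ (fun x => (K x a c b c * K x a b a b - K x a b b c * K x a b a c)
       * (Num.sqrt (Q x))^-1)) => //.
    move=> x Ux; apply: canLR (mulfK (S0 _ Ux)) _; rewrite DE// !KE//.
    have hC i j : h x i j = h x j i by rewrite -{1}(hs _ Ux) mxE.
    rewrite /gauss_tensor /minor3 ?(hC b a) ?(hC c a) ?(hC c b).
    move: (h x a a) (h x b b) (h x c c) (h x b c) (h x a c) (h x a b) => x' y z u v w.
    ring.
  by repeat first [exact: Vs | exact: Ks | apply: CkB => // | apply: CkM => //].
have pick (s : seq 'I_n) : (size s <= 2)%N -> exists c, c \notin s.
  move=> s2; case: (pickP (fun c => c \notin s)) => [c cs|ns]; first by exists c.
  have : (#|'I_n| <= size s)%N.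
    apply: leq_trans (card_size s); apply: subset_leq_card; apply/fintype.subsetP => c _.
    by have := ns c => /negbFE.
  by rewrite card_ord => /(leq_trans n3) /leq_trans /(_ s2).
move=> a b; case: (eqVneq a b) => [<-|ab].
  have [b' ] := pick [:: a] isT; rewrite inE eq_sym => ab.
  have [c] := pick [:: a; b'] isT; rewrite !inE negb_or => /andP[ca cb].
  by have [] := main a b' c ab; rewrite 1?eq_sym.
have [c] := pick [:: a; b] isT; rewrite !inE negb_or => /andP[ca cb].
by have [] := main a b c ab; rewrite 1?eq_sym.
Qed.

End GaussRoot.

(** * The Gauss and Codazzi equations of a hypersurface *)

(** The tangent space has codimension one, so its orthogonal complement is
    spanned by one vector, which may be normalized. *)
Lemma unit_normal (R : rcfType) n (J : 'M[R]_(n, n.+1)) : J *m J^T \in unitmx ->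
  exists2 N : 'rV[R]_n.+1, (N *m N^T) 0 0 = 1 &
    forall v : 'rV[R]_n.+1, v *m J^T = 0 -> exists k, v = k *: N.
Proof.
move=> Ju; have rJ : \rank J = n.
  apply/eqP; rewrite eqn_leq rank_leq_row /= -[X in (X <= _)%N](mxrank_unit Ju).
  exact: mxrankM_maxl.
have rk : \rank (kermx J^T) = 1%N by rewrite mxrank_ker mxrank_tr rJ subSnn.
have [v0 v0k v0n] : exists2 v : 'rV[R]_n.+1, (v <= kermx J^T)%MS & v != 0.
  exists (nz_row (kermx J^T)); first exact: nz_row_sub.
  by rewrite nz_row_eq0 -mxrank_eq0 rk.
have gen v : v *m J^T = 0 -> exists k, v = k *: v0.
  move=> vJ; have vk : (v <= kermx J^T)%MS by apply/sub_kermxP.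
  apply/sub_rVP; apply: submx_trans vk _.
  have := mxrank_leqif_sup v0k => -[_]; rewrite rk rank_rV v0n eqxx => /esym.
  exact.
have sq : (v0 *m v0^T) 0 0 = \sum_t v0 0 t ^+ 2.
  by rewrite mxE; apply: eq_bigr => t _; rewrite !mxE expr2.
have pos : 0 < (v0 *m v0^T) 0 0.
  rewrite sq lt_neqAle sumr_ge0 ?andbT; last by move=> t _; exact: sqr_ge0.
  rewrite eq_sym psumr_eq0; last by move=> t _; exact: sqr_ge0.
  apply: contra v0n => /allP z; apply/eqP/rowP => t; rewrite mxE; apply/eqP.
  by rewrite -sqrf_eq0; exact: (z t (mem_index_enum t)).
pose s := Num.sqrt ((v0 *m v0^T) 0 0); have s0 : s != 0 by rewrite gt_eqF// sqrtr_gt0.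
exists (s^-1 *: v0).
  have -> : (s^-1 *: v0) *m (s^-1 *: v0)^T = (s^-1 * s^-1) *: (v0 *m v0^T).
    by rewrite linearZ /= -scalemxAl -scalemxAr scalerA.
  have ss : (v0 *m v0^T) 0 0 = s * s by rewrite -expr2 sqr_sqrtr// ltW.
  by rewrite mxE ss; field.
by move=> v /gen[k ->]; exists (k * s); rewrite scalerA mulfK.
Qed.

Lemma is_pder {R : realType} {n} (f : 'rV[R]_n -> R) (U : set 'rV[R]_n) x p :
  U x -> Ck 1 U f -> is_derive x (delta_mx 0 p : 'rV[R]_n) f (pder p f x).
Proof.
move=> Ux fs; have fd : derivable f x (delta_mx 0 p) by have q := Ck_derivable p fs Ux; exact: q.
exact: DeriveDef fd erefl.
Qed.

Lemma is_pder_sumM {R : realType} {n} (I : finType) (F H : I -> 'rV[R]_n -> R) (U : set 'rV[R]_n) c x :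
  U x -> (forall j, Ck 1 U (F j)) -> (forall j, Ck 1 U (H j)) ->
  is_derive x (delta_mx 0 c : 'rV[R]_n) (fun y => \sum_j F j y * H j y)
    (\sum_j (pder c (F j) x * H j x + F j x * pder c (H j) x)).
Proof.
move=> Ux Fs Hs; apply: is_derive_fsum => j.
by apply: is_derive_fM; [exact: is_pder Ux (Fs j)|exact: is_pder Ux (Hs j)].
Qed.

Lemma pder_sumM {R : realType} {n} (I : finType) (F H : I -> 'rV[R]_n -> R) (U : set 'rV[R]_n) c x :
  U x -> (forall j, Ck 1 U (F j)) -> (forall j, Ck 1 U (H j)) ->
  pder c (fun y => \sum_j F j y * H j y) x
  = \sum_j (pder c (F j) x * H j x + F j x * pder c (H j) x).
Proof. by move=> Ux Fs Hs; have [_ E] := is_pder_sumM c Ux Fs Hs; exact: E. Qed.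

(** The half of the covariant derivative [T_ac;p] that survives
    antisymmetrization in [p] and [c]. *)
Definition half_covder {R : realType} {n} (G T : 'rV[R]_n -> 'M[R]_n) p c a x : R :=
  pder p (fun y => T y a c) x - \sum_e christoffel G e p a x * T x e c.

Lemma codazziE {R : realType} {n} (G : 'rV[R]_n -> 'M[R]_n) (U : set 'rV[R]_n)
    (T : 'rV[R]_n -> 'M[R]_n) x a b c : open U -> (forall x, U x -> (G x)^T = G x) -> U x ->
  codazzi G T a b c x = 2^-1 * (half_covder G T c b a x - half_covder G T b c a x).
Proof.
move=> Uo Gsym Ux; rewrite /codazzi /covder !big_split /=.
have cE' : \sum_d christoffel G d c b x * T x a d = \sum_d christoffel G d b c x * T x a d.
  by apply: eq_bigr => e _; rewrite (christoffel_sym Uo Gsym e c b Ux).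
have aux (p q r s v v' : R) : v' = v ->
    2^-1 * (p - (s + v') - (q - (r + v))) = 2^-1 * ((p - s) - (q - r)).
  by move=> ->; ring.
exact: (aux _ _ _ _ _ _ cE').
Qed.

(** The symmetric form in which the Codazzi equation of an immersion arises:
    each side is a normal component of third derivatives of the immersion. *)
Lemma codazzi_eq0 {R : realType} {n} (G : 'rV[R]_n -> 'M[R]_n) (U : set 'rV[R]_n)
    (T : 'rV[R]_n -> 'M[R]_n) x a b c : open U -> (forall x, U x -> (G x)^T = G x) ->
  U x -> (T x)^T = T x ->
  pder c (fun y => T y a b) x + \sum_e christoffel G e a b x * T x c e
  = pder b (fun y => T y a c) x + \sum_e christoffel G e a c x * T x b e ->
  codazzi G T a b c x = 0.
Proof.
move=> Uo Gsym Ux Ts sym; rewrite (codazziE T a b c Uo Gsym Ux) /half_covder.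
have cE b' c' : \sum_d christoffel G d b' a x * T x d c'
    = \sum_e christoffel G e a b' x * T x c' e.
  by apply: eq_bigr => e _; rewrite (christoffel_sym Uo Gsym e b' a Ux) -{1}Ts mxE.
have aux (p q r s r' s' : R) : p + r = q + s -> s' = s -> r' = r ->
    2^-1 * ((p - s') - (q - r')) = 0.
  by move=> E -> ->; move/eqP: E; rewrite -subr_eq => /eqP <-; ring.
exact: (aux _ _ _ _ _ _ sym (cE c b) (cE b c)).
Qed.

Section Immersion.
Context {R : realType} {n : nat}.
Variables (G : 'rV[R]_n -> 'M[R]_n) (U : set 'rV[R]_n).
Hypothesis n3 : (3 <= n)%N.
Hypothesis Uo : open U.
Hypothesis Gsmooth : forall k a b, Ck k U (fun x => G x a b).
Hypothesis Gsym : forall x, U x -> (G x)^T = G x.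
Hypothesis Gpos : forall x, U x -> posdefmx (G x).
Hypothesis Rpos : forall x, U x -> op_posdef (G x) (riemann G x).
Variable u : 'I_n.+1 -> 'rV[R]_n -> R.
Hypothesis us : forall k t, Ck k U (u t).
Hypothesis isom : forall x, U x -> forall a b,
  \sum_t pder a (u t) x * pder b (u t) x = G x a b.
Implicit Types (x : 'rV[R]_n) (a b c d e i j l : 'I_n).

Local Opaque pder christoffel.

Local Notation Gam := (christoffel G).
Local Notation w t a b := (pder a (pder b (u t))).

Let p1 k t a : Ck k U (pder a (u t)).
Proof. exact: Ck_pder (us _ _). Qed.

Let p2 k t a b : Ck k U (w t a b).
Proof. exact: Ck_pder (p1 _ _ _). Qed.

Let wC t a b x : U x -> w t a b x = w t b a x.
Proof. by move=> Ux; have h := pderC a b Uo (us 2 t) Ux; exact: h. Qed.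

Let w3C t a b c x : U x -> pder c (w t a b) x = pder b (w t a c) x.
Proof.
move=> Ux.
transitivity (pder c (w t b a) x).
  by apply: (pder_ext c Uo Ux) => y; exact: wC.
transitivity (pder b (w t c a) x); first by have h := pderC c b Uo (p1 2 t a) Ux; exact: h.
by apply: (pder_ext b Uo Ux) => y; exact: wC.
Qed.

Lemma pder_metric c a b x : U x -> pder c (fun y => G y a b) x =
  \sum_t (w t c a x * pder b (u t) x + pder a (u t) x * w t c b x).
Proof.
move=> Ux; rewrite -(pder_sumM c Ux (fun t => p1 1 t a) (fun t => p1 1 t b)).
by apply: (pder_ext c Uo Ux) => y Uy; rewrite isom.
Qed.

Lemma chr1_immersion l i j x : U x -> chr1 G l i j x = \sum_t w t i j x * pder l (u t) x.
Proof.
move=> Ux; rewrite /chr1 !pder_metric// -big_split -sumrB mulr_sumr.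
apply: eq_bigr => t _ /=; rewrite (wC t l i Ux) (wC t l j Ux) (wC t j i Ux).
move: (w t i l x) (w t j l x) (w t i j x) (pder i _ x) (pder j _ x) (pder l _ x) => A B C p q r.
by field.
Qed.

(** The second fundamental form with values in the ambient space. *)
Definition normal_part t a b x : R := w t a b x - \sum_e Gam e a b x * pder e (u t) x.

Lemma normal_part_sym t a b x : U x -> normal_part t a b x = normal_part t b a x.
Proof.
move=> Ux; rewrite /normal_part (wC t a b Ux); congr (_ - _).
by apply: eq_bigr => e _; rewrite (christoffel_sym Uo Gsym _ _ _ Ux).
Qed.

(** The Christoffel symbols are the tangential components of the second
    derivatives. *)
Lemma normal_part_tangent a b c x : U x ->
  \sum_t normal_part t a b x * pder c (u t) x = 0.
Proof.
move=> Ux; under eq_bigr do rewrite mulrBl mulr_suml.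
rewrite sumrB -chr1_immersion// exchange_big /= -(lower_christoffel Gpos c a b Ux).
rewrite -sumrB big1// => e _; rewrite -(isom Ux) mulr_suml -sumrB big1// => t _.
move: (Gam e a b x) (pder c _ x) (pder e _ x) => p q r; ring.
Qed.

Lemma normal_part_dot a b c d x : U x ->
  \sum_t normal_part t a b x * normal_part t c d x =
  \sum_t w t a b x * w t c d x - chr_dot G x a b c d.
Proof.
move=> Ux.
transitivity (\sum_t normal_part t a b x * w t c d x).
  rewrite -[RHS]subr0 -[X in _ = _ - X](_ : \sum_e Gam e c d x *
    (\sum_t normal_part t a b x * pder e (u t) x) = 0); last first.
    by rewrite big1// => e _; rewrite normal_part_tangent// mulr0.
  under [X in _ = _ - X]eq_bigr do rewrite mulr_sumr.
  rewrite [X in _ = _ - X]exchange_big -sumrB; apply: eq_bigr => t _ /=.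
  rewrite [X in _ * X = _]/normal_part mulrBr; congr (_ - _).
  by rewrite mulr_sumr; apply: eq_bigr => e _; rewrite mulrCA.
rewrite (chr_dotC Gsym a b c d Ux) /chr_dot.
under eq_bigr do rewrite mulrBl mulr_suml.
rewrite sumrB; congr (_ - _); rewrite exchange_big /=; apply: eq_bigr => e _.
rewrite chr1_immersion// mulr_suml; apply: eq_bigr => t _.
move: (Gam e a b x) (w t c d x) (pder e _ x) => p q r; ring.
Qed.

(** The Gauss equation. The third derivatives of the immersion are symmetric
    and drop out, and the quadratic Christoffel terms are the tangential part
    of the products of second derivatives. *)
Lemma riemann_immersion a b c d x : U x -> riemann G x a b c d =
  \sum_t (normal_part t a c x * normal_part t b d x - normal_part t a d x * normal_part t b c x).
Proof.
move=> Ux; rewrite (riemannE Uo Gsmooth Gsym Gpos _ _ _ _ Ux) sumrB !normal_part_dot//.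
have E c' d' : pder c' (chr1 G a d' b) x =
    \sum_t (pder c' (w t d' b) x * pder a (u t) x + w t d' b x * w t c' a x).
  rewrite -(pder_sumM c' Ux (fun t => p2 1 t d' b) (fun t => p1 1 t a)).
  by apply: (pder_ext c' Uo Ux) => y Uy; rewrite chr1_immersion.
transitivity (\sum_t (pder c (w t d b) x * pder a (u t) x + w t d b x * w t c a x)
    - \sum_t (pder d (w t c b) x * pder a (u t) x + w t c b x * w t d a x)
    + (chr_dot G x d a c b - chr_dot G x c a d b)).
  by congr (_ - _ + _); exact: E.
have -> : \sum_t (pder c (w t d b) x * pder a (u t) x + w t d b x * w t c a x)
    - \sum_t (pder d (w t c b) x * pder a (u t) x + w t c b x * w t d a x)
    = \sum_t w t a c x * w t b d x - \sum_t w t a d x * w t b c x.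
  rewrite -!sumrB; apply: eq_bigr => t _.
  have h := pderC d c Uo (p1 2 t b) Ux.
  rewrite h (wC t d b Ux) (wC t c a Ux) (wC t c b Ux) (wC t d a Ux).
  move: (pder c (w t d b) x) (pder a (u t) x) (w t a c x) (w t b d x) (w t a d x) (w t b c x).
  by move=> p q r s v z; ring.
rewrite (chr_dotsl Uo Gsym d a c b Ux) (chr_dotsr Uo Gsym a d c b Ux).
rewrite (chr_dotsl Uo Gsym c a d b Ux) (chr_dotsr Uo Gsym a c d b Ux).
have aux (p q s v : R) : p - q + (s - v) = p - v - (q - s) by ring.
exact: aux.
Qed.

(** The normal is chosen so that the second fundamental form is positive
    definite. Since [R] is its Gauss product, the logarithm of [R] is the
    Kulkarni-Nomizu product of [g] and [ln h]; its Weyl part is zero and its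
    Schouten tensor is [ln h], so that [h] is recovered as the exponential. *)
Lemma hypersurface_form x : U x -> exists N : 'I_n.+1 -> R,
  [/\ \sum_t N t * N t = 1,
      forall e, \sum_t N t * pder e (u t) x = 0,
      forall t a b, normal_part t a b x = exp_schouten_star G x a b * N t,
      (exp_schouten_star G x)^T = exp_schouten_star G x /\ posdefmx (exp_schouten_star G x) &
      riemann G x = gauss_tensor (exp_schouten_star G x) /\ forall a b c d, weyl_star G x a b c d = 0].
Proof.
move=> Ux; have [gs gp] := (Gsym Ux, Gpos Ux).
pose J : 'M[R]_(n, n.+1) := \matrix_(a, t) pder a (u t) x.
have JJ : J *m J^T = G x.
  by apply/matrixP => a b; rewrite -isom// mxE; apply: eq_bigr => t _; rewrite !mxE.
have [|N NN Nk] := @unit_normal R n J; first by rewrite JJ posdefmx_unit.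
have Jn a b : (\row_t normal_part t a b x) *m J^T = 0.
  apply/rowP => c; rewrite !mxE -[RHS](normal_part_tangent a b c Ux).
  by apply: eq_bigr => t _; rewrite !mxE.
pose k : 'M[R]_n := \matrix_(a, b) \sum_t normal_part t a b x * N 0 t.
have NN' : \sum_t N 0 t * N 0 t = 1.
  by rewrite -NN mxE; apply: eq_bigr => t _; rewrite mxE.
have nk t a b : normal_part t a b x = k a b * N 0 t.
  have [s sE] := Nk _ (Jn a b).
  have sE' t' : normal_part t' a b x = s * N 0 t' by have /rowP/(_ t') := sE; rewrite !mxE.
  rewrite sE'; congr (_ * _); rewrite mxE; under eq_bigr do rewrite sE' -mulrA.
  by rewrite -mulr_sumr NN' mulr1.
have ks : k^T = k.
  by apply/matrixP => a b; rewrite !mxE; apply: eq_bigr => t _; rewrite normal_part_sym.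
have Rk a b c d : riemann G x a b c d = gauss_tensor k a b c d.
  rewrite riemann_immersion// /gauss_tensor; under eq_bigr do rewrite !nk.
  transitivity (\sum_t (k a c * k b d - k a d * k b c) * (N 0 t * N 0 t)).
    apply: eq_bigr => t _; move: (N 0 t) (k a c) (k b d) (k a d) (k b c) => p q r s v; ring.
  by rewrite -mulr_sumr NN' mulr1.
have [h [N' [hs hp hR hN NN2]]] : exists (h : 'M[R]_n) (N' : 'I_n.+1 -> R),
   [/\ h^T = h, posdefmx h, riemann G x = gauss_tensor h,
    (forall t a b, normal_part t a b x = h a b * N' t) & \sum_t N' t * N' t = 1].
  have [kp|kp] := gauss_definite n3 gs gp ks Rk (Rpos Ux).
    by exists k, (N 0); split=> //; do 4 apply/funext => ?; exact: Rk.
  exists (- k), (fun t => - N 0 t); split=> //.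
  - by rewrite linearN /= ks.
  - by do 4 apply/funext => ?; rewrite gauss_tensorN; exact: Rk.
  - by move=> t a b; rewrite mxE mulrNN.
  - by under eq_bigr do rewrite mulrNN.
have hop : op_posdef (G x) (gauss_tensor h) by rewrite -hR; exact: Rpos.
have [S [Ss LS eS]] := log_gauss_tensor gs gp hs hp hop.
have logE : log_riemann G x = kulkarni (G x) S by rewrite /log_riemann hR.
have sE : schouten_star G x = S by rewrite /schouten_star logE schouten_kulkarni.
have hE : exp_schouten_star G x = h by rewrite /exp_schouten_star sE.
exists N'; rewrite hE; split=> //.
- move=> e; have i0 : 'I_n by exact: e.
  have h0 : 0 < h e e.
    rewrite -delta_form; apply: hp; apply/eqP => /rowP/(_ e); rewrite !mxE !eqxx.
    by move/eqP; rewrite oner_eq0.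
  apply: (mulfI (lt0r_neq0 h0)); rewrite mulr0 -[RHS](normal_part_tangent e e e Ux) mulr_sumr.
  by apply: eq_bigr => t _; rewrite hN mulrA.
- split=> // a b c d; rewrite /weyl_star logE.
  have -> : weyl_of (G x) (kulkarni (G x) S) a b c d =
     kulkarni (G x) S a b c d - kulkarni (G x) (schouten_of (G x) (kulkarni (G x) S)) a b c d by [].
  by rewrite schouten_kulkarni// subrr.
Qed.

(** The unit normal as a quotient that shows its smoothness. *)
Let Nf (i0 : 'I_n) t x := normal_part t i0 i0 x * (exp_schouten_star G x i0 i0)^-1.

Lemma exp_schouten_smooth k a b : Ck k U (fun x => exp_schouten_star G x a b).
Proof.
apply: (@gauss_root_smooth _ _ U (exp_schouten_star G) (riemann G)) => //.
- by move=> x Ux; have [N [_ _ _ []]] := hypersurface_form Ux.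
- by move=> x Ux; have [N [_ _ _ []]] := hypersurface_form Ux.
- by move=> x Ux a' b' c' d'; have [N [_ _ _ _ [{1}-> _]]] := hypersurface_form Ux.
- by move=> a' b' c' d'; exact: riemann_smooth.
Qed.

(** The normal component of the third derivatives of the immersion is
    [h_ab,c + Gamma^e_ab h_ce], because the derivative of the unit normal is
    tangential; third derivatives are symmetric. *)
Lemma immersion_codazzi x : U x -> forall a b c, codazzi G (exp_schouten_star G) a b c x = 0.
Proof.
set h := exp_schouten_star G; move=> Ux a0.
have hd y i : U y -> 0 < h y i i.
  move=> Uy; have [_ [_ _ _ [_ hp] _]] := hypersurface_form Uy.
  rewrite -delta_form; apply: hp; apply/eqP => /rowP/(_ i); rewrite !mxE !eqxx.
  by move/eqP; rewrite oner_eq0.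
have hs y a b : U y -> h y a b = h y b a.
  by move=> Uy; have [_ [_ _ _ [hs _] _]] := hypersurface_form Uy; rewrite /h -{1}hs mxE.
pose N t := Nf a0 t.
have NE y : U y -> [/\ \sum_t N t y * N t y = 1, forall e, \sum_t N t y * pder e (u t) y = 0
    & forall t a b, normal_part t a b y = h y a b * N t y].
  move=> Uy; have [N' [NN Nu nE _ _]] := hypersurface_form Uy.
  have E t : N t y = N' t.
    by rewrite /N /Nf nE mulrC mulKf// lt0r_neq0// hd.
  split.
  - by rewrite -[RHS]NN; apply: eq_bigr => t _; rewrite E.
  - by move=> e; rewrite -[RHS](Nu e); apply: eq_bigr => t _; rewrite E.
  - by move=> t a b; rewrite nE E.
have nps k t a b : Ck k U (normal_part t a b).
  have -> : normal_part t a b = fun x => w t a b x - \sum_e Gam e a b x * pder e (u t) x by [].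
  apply: CkB => //.
  apply: Ck_sum => // e _; apply: CkM => //.
  by have q := christoffel_smooth Uo Gsmooth Gpos k e a b; exact: q.
have Ns k t : Ck k U (N t).
  apply: CkM => //.
  apply: CkV => //; last exact: exp_schouten_smooth.
  by move=> y Uy; rewrite lt0r_neq0// hd.
have NdN c : \sum_t N t x * pder c (N t) x = 0.
  have : pder c (fun y => \sum_t N t y * N t y) x = 0.
    transitivity (pder c (fun=> 1) x); last exact: pder_cst.
    apply: (pder_ext c Uo Ux) => y Uy.
    by have [] := NE y Uy.
  rewrite (pder_sumM c Ux (Ns 1) (Ns 1)).
  have aux (s : R) : s + s = 0 -> s = 0 by move=> ?; lra.
  move=> E; apply: aux; rewrite -[RHS]E -big_split; apply: eq_bigr => t _ /=.
  by rewrite [X in X + _]mulrC.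
have key a b c : \sum_t N t x * pder c (w t a b) x
    = pder c (fun y => h y a b) x + \sum_e Gam e a b x * h x c e.
  have [NN Nu nE] := NE x Ux.
  have E t : pder c (w t a b) x = \sum_e (pder c (Gam e a b) x * pder e (u t) x
      + Gam e a b x * w t c e x)
      + (pder c (fun y => h y a b) x * N t x + h x a b * pder c (N t) x).
    have gs e : Ck 1 U (Gam e a b).
      by have q := christoffel_smooth Uo Gsmooth Gpos 1 e a b; exact: q.
    have hds := Ck_derivable c (exp_schouten_smooth 1 a b) Ux.
    have Nds := Ck_derivable c (Ns 1 t) Ux.
    rewrite -(pderM hds Nds) -(pder_sumM c Ux gs (fun e => p1 1 t e)) -pderD; last 2 first.
    - have q : Ck 1 U (fun y => \sum_e Gam e a b y * pder e (u t) y).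
        apply: Ck_sum; [exact: Uo|move=> e _]; have q1 := gs e; have q2 := p1 1 t e.
        exact: CkM Uo q1 q2.
      by have qd := Ck_derivable c q Ux; exact: qd.
    - by have qd := derivable_fM hds Nds; exact: qd.
    apply: (pder_ext c Uo Ux) => y Uy; have [_ _ nEy] := NE y Uy.
    by rewrite -(nEy t a b) /normal_part addrC subrK.
  have Nw e : \sum_t N t x * w t c e x = h x c e.
    transitivity (\sum_t (h x c e * (N t x * N t x)
        + \sum_f Gam f c e x * (N t x * pder f (u t) x))).
      apply: eq_bigr => t _.
      have -> : w t c e x = normal_part t c e x + \sum_f Gam f c e x * pder f (u t) x.
        by rewrite /normal_part subrK.
      rewrite nE mulrDr mulrCA; congr (_ + _).
      by rewrite mulr_sumr; apply: eq_bigr => f _; rewrite mulrCA.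
    rewrite big_split -mulr_sumr NN mulr1 exchange_big /= [X in _ + X]big1 ?addr0// => f _.
    by rewrite -mulr_sumr Nu mulr0.
  transitivity (\sum_t (\sum_e (pder c (Gam e a b) x * (N t x * pder e (u t) x)
      + Gam e a b x * (N t x * w t c e x))
      + (pder c (fun y => h y a b) x * (N t x * N t x) + h x a b * (N t x * pder c (N t) x)))).
    apply: eq_bigr => t _; rewrite E mulrDr; congr (_ + _).
      rewrite mulr_sumr; apply: eq_bigr => e _; rewrite mulrDr; congr (_ + _); exact: mulrCA.
    rewrite mulrDr; congr (_ + _); exact: mulrCA.
  rewrite big_split /= addrC; congr (_ + _).
    by rewrite big_split /= -!mulr_sumr NN NdN mulr1 mulr0 addr0.
  rewrite exchange_big /=; apply: eq_bigr => e _.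
  by rewrite big_split /= -!mulr_sumr Nu mulr0 add0r Nw.
move=> b c.
have sym : pder c (fun y => h y a0 b) x + \sum_e Gam e a0 b x * h x c e
    = pder b (fun y => h y a0 c) x + \sum_e Gam e a0 c x * h x b e.
  apply: etrans (esym (key a0 b c)) (etrans _ (key a0 c b)).
  apply: eq_bigr => t _; apply: (congr1 (fun z => N t x * z)).
  exact: w3C.
apply: (codazzi_eq0 Uo Gsym Ux _ sym).
by have [_ [_ _ _ [hsx _] _]] := hypersurface_form Ux.
Qed.

End Immersion.

(** * The Codazzi equation from the Gauss equation *)

Section Bianchi.
Context {R : comNzRingType} {n : nat}.

(** The second Bianchi identity for the curvature [dA + A /\ A] of a connection
    matrix [A], expressed through the first derivatives [B c d] of [A d] and
    the second derivatives [S p c d]. *)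
Lemma bianchi_identity (A : 'I_n -> 'M[R]_n) (B : 'I_n -> 'I_n -> 'M[R]_n)
    (S : 'I_n -> 'I_n -> 'I_n -> 'M[R]_n) (p c d : 'I_n) :
  (forall p c d, S p c d = S c p d) ->
  let Om c d := B c d - B d c + (A c *m A d - A d *m A c) in
  let D p c d := S p c d - S p d c
    + (B p c *m A d + A c *m B p d - (B p d *m A c + A d *m B p c))
    + (A p *m Om c d - Om c d *m A p) in
  D p c d + D c d p + D d p c = 0.
Proof.
move=> SC Om D; rewrite /D /Om (SC d p c) (SC c d p) (SC c p d).
rewrite !(mulmxDl, mulmxDr, mulmxBl, mulmxBr, mulNmx, mulmxN) !mulmxA.
move: (B p c *m A d) (A c *m B p d) (B p d *m A c) (A d *m B p c).
move: (B c d *m A p) (A d *m B c p) (B c p *m A d) (A p *m B c d).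
move: (B d p *m A c) (A p *m B d c) (B d c *m A p) (A c *m B d p).
move: (A p *m A c *m A d) (A p *m A d *m A c) (A c *m A d *m A p) (A d *m A c *m A p).
move: (A c *m A p *m A d) (A d *m A p *m A c).
move: (S p c d) (S p d c) (S d c p) => s1 s2 s3.
move=> y1 y2 y3 y4 y5 y6 y7 y8 y9 z1 z2 z3 z4 z5 z6 z7 z8 z9.
by apply/matrixP => e b; rewrite !mxE; ring.
Qed.

End Bianchi.

(** The Bianchi identity when the curvature is the product of [eta] and [h]:
    [gam] is the connection, [dgam] and [ddgam] are its derivatives, [eta] is
    [h] with one index raised by [G], and [deta] and [k] are the derivatives
    of [eta] and [h]. Lowering the free index turns the identity into one
    between [h] and the antisymmetrized covariant derivative [T] of [h]. *)
Lemma bianchi_gauss {R : comNzRingType} {n : nat} (G h : 'I_n -> 'I_n -> R)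
    (gam : 'I_n -> 'I_n -> 'I_n -> R) (dgam : 'I_n -> 'I_n -> 'I_n -> 'I_n -> R)
    (ddgam : 'I_n -> 'I_n -> 'I_n -> 'I_n -> 'I_n -> R) (eta : 'I_n -> 'I_n -> R)
    (deta k dh : 'I_n -> 'I_n -> 'I_n -> R) :
  (forall p c e d b, ddgam p c e d b = ddgam c p e d b) ->
  (forall e b c d, dgam c e d b - dgam d e c b
     + \sum_f (gam e c f * gam f d b - gam e d f * gam f c b)
     = eta c e * h b d - eta d e * h b c) ->
  (forall p e b c d, ddgam p c e d b - ddgam p d e c b
     + (\sum_f (dgam p e c f * gam f d b + gam e c f * dgam p f d b)
        - \sum_f (dgam p e d f * gam f c b + gam e d f * dgam p f c b))
     = (deta p c e * h b d + eta c e * k p b d) - (deta p d e * h b c + eta d e * k p b c)) ->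
  (forall a c, \sum_e G a e * eta c e = h a c) ->
  (forall p c a, \sum_e G a e * (deta p c e + \sum_f gam e p f * eta c f) = dh p c a) ->
  (forall p c a, dh p c a = k p a c - \sum_f gam f p a * h f c) ->
  let T a p c := dh p c a - dh c p a in
  forall a b p c d, T a p c * h b d + T a d p * h b c + T a c d * h b p
    + h a c * T b p d + h a d * T b c p + h a p * T b d c = 0.
Proof.
move=> ddC gauss dgauss eta_low deta_low dhE T a b p c d.
pose A c : 'M[R]_n := \matrix_(e, b) gam e c b.
pose B p c : 'M[R]_n := \matrix_(e, b) dgam p e c b.
pose S p c d : 'M[R]_n := \matrix_(e, b) ddgam p c e d b.
have SC p' c' d' : S p' c' d' = S c' p' d' by apply/matrixP => e f; rewrite !mxE ddC.
pose Om c d := B c d - B d c + (A c *m A d - A d *m A c).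
pose D p c d := S p c d - S p d c
    + (B p c *m A d + A c *m B p d - (B p d *m A c + A d *m B p c))
    + (A p *m Om c d - Om c d *m A p).
have Dcyc : D p c d + D c d p + D d p c = 0 by exact: (bianchi_identity A B p c d SC).
have OmE c' d' e f : Om c' d' e f = eta c' e * h f d' - eta d' e * h f c'.
  by rewrite -gauss sumrB !mxE; do 2!congr (_ + _);
    [|congr (- _)]; apply: eq_bigr => i _; rewrite !mxE.
have DE p' c' d' e f : D p' c' d' e f =
   (deta p' c' e + \sum_i gam e p' i * eta c' i) * h f d' + eta c' e * dh p' d' f
   - ((deta p' d' e + \sum_i gam e p' i * eta d' i) * h f c' + eta d' e * dh p' c' f).
  have E1 : (A p' *m Om c' d') e f = (\sum_i gam e p' i * eta c' i) * h f d'
      - (\sum_i gam e p' i * eta d' i) * h f c'.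
    rewrite mxE !mulr_suml -sumrB; apply: eq_bigr => i _; rewrite OmE mxE.
    by rewrite mulrBr !mulrA.
  have E2 : (Om c' d' *m A p') e f = eta c' e * (\sum_i gam i p' f * h i d')
      - eta d' e * (\sum_i gam i p' f * h i c').
    rewrite mxE !mulr_sumr -sumrB; apply: eq_bigr => i _; rewrite OmE mxE.
    by rewrite mulrBl; congr (_ - _); rewrite -mulrA [h _ _ * _]mulrC.
  have E3 : (S p' c' d' - S p' d' c' + (B p' c' *m A d' + A c' *m B p' d'
      - (B p' d' *m A c' + A d' *m B p' c'))) e f
    = (deta p' c' e * h f d' + eta c' e * k p' f d')
    - (deta p' d' e * h f c' + eta d' e * k p' f c').
    rewrite -dgauss !big_split !mxE.
    by congr (_ + (_ + _ - (_ + _))); apply: eq_bigr => i _; rewrite !mxE.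
  have -> : D p' c' d' e f = (S p' c' d' - S p' d' c' + (B p' c' *m A d' + A c' *m B p' d'
      - (B p' d' *m A c' + A d' *m B p' c'))) e f
      + ((A p' *m Om c' d') e f - (Om c' d' *m A p') e f) by rewrite ![in LHS]mxE ![in RHS]mxE.
  rewrite E3 E1 E2 !dhE.
  move: (\sum_i _) (\sum_i _) (\sum_i _) (\sum_i _) (deta _ _ _) (deta _ _ _) (k _ _ _) (k _ _ _).
  move: (eta c' e) (eta d' e) (h f d') (h f c') => t1 t2 t3 t4 t5 t6 t7 t8 t9 s1 s2 s3.
  ring.
have low p' c' d' : \sum_e G a e * D p' c' d' e b =
   dh p' c' a * h b d' + h a c' * dh p' d' b
   - (dh p' d' a * h b c' + h a d' * dh p' c' b).
  rewrite -(deta_low p' c' a) -(deta_low p' d' a) -(eta_low a c') -(eta_low a d') !mulr_suml -!big_split -sumrB.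
  have aux (g q r s t h1 h2 h3 h4 : R) : g * (q * h1 + r * h2 - (s * h3 + t * h4))
      = g * q * h1 + g * r * h2 - (g * s * h3 + g * t * h4) by ring.
  by apply: eq_bigr => e _ /=; rewrite DE aux.
have : \sum_e G a e * (D p c d + D c d p + D d p c) e b = 0.
  by rewrite Dcyc big1// => e _; rewrite mxE mulr0.
have -> : \sum_e G a e * (D p c d + D c d p + D d p c) e b
   = \sum_e G a e * D p c d e b + \sum_e G a e * D c d p e b + \sum_e G a e * D d p c e b.
  by rewrite -!big_split; apply: eq_bigr => e _ /=; rewrite -!mulrDr !mxE.
rewrite !low /T => e; rewrite -[RHS]e; move: (dh p c a) (dh c p a) (dh p d a) (dh d p a).
move: (dh c d a) (dh d c a) (dh p c b) (dh c p b) (dh p d b) (dh d p b).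
move: (dh c d b) (dh d c b) (h a c) (h a d) (h a p) (h b c) (h b d) (h b p).
move=> t1 t2 t3 t4 t5 t6 t7 t8 t9 s1 s2 s3 s4 s5 s6 s7 s8 s9; ring.
Qed.

(** Contracting the identity with the inverse of [h] leaves [(n - 3) T] as a
    pure trace, and contracting once more kills the trace. *)
Lemma bianchi_contraction {R : realType} {n} (h : 'M[R]_n) (T : 'I_n -> 'I_n -> 'I_n -> R) :
  (3 < n)%N -> h^T = h -> h \in unitmx -> (forall a p c, T a p c = - T a c p) ->
  (forall a b p c d, T a p c * h b d + T a d p * h b c + T a c d * h b p
    + h a c * T b p d + h a d * T b c p + h a p * T b d c = 0) ->
  forall a p c, T a p c = 0.
Proof.
have aux (z : R) : 3 < z -> 2 * (z - 2) != 0 /\ z - 3 != 0.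
  by move=> z3; split; apply/eqP => z0; lra.
move=> n3 hs hu Tanti Tid; pose k := invmx h.
have kh d c : \sum_b k d b * h b c = (d == c)%:R.
  by have /matrixP/(_ d c) := mulVmx hu; rewrite !mxE.
have hk a b : \sum_d h a d * k d b = (a == b)%:R.
  by have /matrixP/(_ a b) := mulmxV hu; rewrite !mxE.
pose s p := \sum_b \sum_d k d b * T b p d.
have c1 (V : 'I_n -> R) c : \sum_b \sum_d k d b * (V d * h b c) = V c.
  rewrite exchange_big /= -[RHS]sum_delta; apply: eq_bigr => d _.
  rewrite eq_sym -kh mulr_suml; apply: eq_bigr => b _; ring.
have c0 (t : R) : \sum_b \sum_d k d b * (t * h b d) = n%:R * t.
  rewrite exchange_big /=.
  transitivity (\sum_(d < n) t); last by rewrite sumr_const card_ord mulr_natl.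
  apply: eq_bigr => d _; rewrite -[RHS]mul1r.
  transitivity ((d == d)%:R * t); last by rewrite eqxx.
  rewrite -kh mulr_suml; apply: eq_bigr => b _; ring.
have E a p c : n%:R * T a p c + 3 * T a c p + h a c * s p - h a p * s c = 0.
  have : \sum_b \sum_d k d b * (T a p c * h b d + T a d p * h b c + T a c d * h b p
    + h a c * T b p d + h a d * T b c p + h a p * T b d c) = 0.
    by rewrite big1// => b _; rewrite big1// => d _; rewrite Tid mulr0.
  have -> : \sum_b \sum_d k d b * (T a p c * h b d + T a d p * h b c + T a c d * h b p
      + h a c * T b p d + h a d * T b c p + h a p * T b d c)
    = \sum_b \sum_d k d b * (T a p c * h b d) + \sum_b \sum_d k d b * (T a d p * h b c)
      + \sum_b \sum_d k d b * (T a c d * h b p) + \sum_b \sum_d k d b * (h a c * T b p d)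
      + \sum_b \sum_d k d b * (h a d * T b c p) + \sum_b \sum_d k d b * (h a p * T b d c).
    rewrite -!big_split; apply: eq_bigr => b _ /=; rewrite -!big_split; apply: eq_bigr => d _ /=.
    by rewrite !mulrDr.
  rewrite c0 (c1 (fun d => T a d p)) (c1 (fun d => T a c d)).
  have -> : \sum_b \sum_d k d b * (h a c * T b p d) = h a c * s p.
    rewrite /s mulr_sumr; apply: eq_bigr => b _; rewrite mulr_sumr; apply: eq_bigr => d _; ring.
  have -> : \sum_b \sum_d k d b * (h a d * T b c p) = T a c p.
    rewrite -[RHS](sum_delta a (fun b => T b c p)); apply: eq_bigr => b _.
    rewrite -hk mulr_suml; apply: eq_bigr => d _; ring.
  have -> : \sum_b \sum_d k d b * (h a p * T b d c) = - (h a p * s c).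
    rewrite /s mulr_sumr -sumrN; apply: eq_bigr => b _; rewrite mulr_sumr -sumrN.
    apply: eq_bigr => d _; rewrite (Tanti b d c); ring.
  by move: (s p) (s c) => sp sc e; rewrite -[RHS]e; ring.
have E' a p c : (n%:R - 3) * T a p c = s c * h a p - s p * h a c.
  by move: (E a p c); rewrite (Tanti a c p) => e; rewrite -[LHS]subr0 -[in LHS]e; ring.
have [nz1 nz2] : 2 * (n%:R - 2) != 0 :> R /\ n%:R - 3 != 0 :> R by apply: aux; rewrite ltr_nat.
have s0 p : s p = 0.
  have : \sum_b \sum_d k d b * ((n%:R - 3) * T b p d)
       = \sum_b \sum_d k d b * (s d * h b p) - \sum_b \sum_d k d b * (s p * h b d).
    rewrite -sumrB; apply: eq_bigr => b _; rewrite -sumrB; apply: eq_bigr => d _.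
    by rewrite E' mulrBr.
  rewrite c0 c1.
  have -> : \sum_b \sum_d k d b * ((n%:R - 3) * T b p d) = (n%:R - 3) * s p.
    rewrite /s mulr_sumr; apply: eq_bigr => b _; rewrite mulr_sumr; apply: eq_bigr => d _; ring.
  move=> e; have /eqP : (2 * (n%:R - 2)) * s p = 0.
    have -> : (2 * (n%:R - 2)) * s p = (n%:R - 3) * s p - (s p - n%:R * s p) by ring.
    by rewrite e subrr.
  by rewrite mulf_eq0 (negbTE nz1) => /eqP.
move=> a p c; have /eqP := E' a p c; rewrite !s0 !mul0r subrr mulf_eq0 (negbTE nz2).
by move/eqP.
Qed.

Section Shape.
Context {R : realType} {n : nat}.
Variables (G h : 'rV[R]_n -> 'M[R]_n) (U : set 'rV[R]_n).
Hypothesis Uo : open U.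
Hypothesis Gsmooth : forall k a b, Ck k U (fun x => G x a b).
Hypothesis Gsym : forall x, U x -> (G x)^T = G x.
Hypothesis Gpos : forall x, U x -> posdefmx (G x).
Hypothesis hsmooth : forall k a b, Ck k U (fun x => h x a b).
Implicit Types (x : 'rV[R]_n) (a b c d e f p : 'I_n).

Local Opaque pder christoffel.
Local Notation Gam := (christoffel G).

(** The shape operator [h_c^e]; the lower index comes first. *)
Definition shape_op c e x : R := \sum_a invmx (G x) e a * h x a c.

Lemma shape_smooth m c e : Ck m U (shape_op c e).
Proof.
apply: Ck_sum; [exact: Uo|move=> a _]; apply: CkM; [exact: Uo| |exact: hsmooth].
by have q := invmx_smooth Uo Gsmooth Gpos m e a; exact: q.
Qed.

Lemma lower_shape x a c : U x -> \sum_e G x a e * shape_op c e x = h x a c.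
Proof. by move=> Ux; exact: (lower_raise Gpos (fun a => h x a c) a Ux). Qed.

(** The index [e] may be lowered, which turns both sides into the Gauss
    equation. *)
Lemma mixed_gauss x e b c d : U x -> riemann G x = gauss_tensor (h x) ->
  pder c (Gam e d b) x - pder d (Gam e c b) x
   + \sum_f (Gam e c f x * Gam f d b x - Gam e d f x * Gam f c b x)
  = shape_op c e x * h x b d - shape_op d e x * h x b c.
Proof.
move=> Ux gauss; move: e; apply: (lower_inj Gpos Ux) => a.
transitivity (riemann G x a b c d); first by [].
rewrite gauss /gauss_tensor -!(lower_shape a _ Ux) !mulr_suml -sumrB.
by apply: eq_bigr => e _; rewrite mulrBr !mulrA.
Qed.

(** Lowering commutes with covariant differentiation. *)
Lemma lower_dshape x p c a : U x ->
  \sum_e G x a e * (pder p (shape_op c e) x + \sum_f Gam e p f x * shape_op c f x)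
  = half_covder G h p c a x.
Proof.
move=> Ux.
have E : pder p (fun y => h y a c) x = \sum_e (pder p (fun y => G y a e) x * shape_op c e x
    + G x a e * pder p (shape_op c e) x).
  rewrite -(pder_sumM p Ux (fun e => Gsmooth 1 a e) (fun e => shape_smooth 1 c e)).
  by apply: (pder_ext p Uo Ux) => y Uy; rewrite (lower_shape a c Uy).
have E1 : \sum_f Gam f p a x * h x f c = \sum_e chr1 G e p a x * shape_op c e x.
  under eq_bigr do rewrite -(lower_shape _ c Ux) mulr_sumr.
  rewrite exchange_big /=; apply: eq_bigr => e _.
  rewrite -(lower_christoffel Gpos e p a Ux) mulr_suml; apply: eq_bigr => f _.
  by rewrite mulrA (metricC Gsym _ _ Ux) [_ * G _ _ _]mulrC.
have E2 : \sum_e G x a e * \sum_f Gam e p f x * shape_op c f x = \sum_e chr1 G a p e x * shape_op c e x.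
  under eq_bigr do rewrite mulr_sumr.
  rewrite exchange_big /=; apply: eq_bigr => f _.
  rewrite -(lower_christoffel Gpos a p f Ux) mulr_suml; apply: eq_bigr => e _.
  by rewrite mulrA.
rewrite /half_covder E E1 -sumrB.
under eq_bigr do rewrite mulrDr.
rewrite big_split /= E2 -big_split /=; apply: eq_bigr => e _.
rewrite (metric_compat Uo Gsym a e p Ux).
move: (chr1 G a p e x) (chr1 G e p a x) (shape_op c e x) (G x a e) (pder p (shape_op c e) x).
move=> t1 t2 t3 t4 t5; ring.
Qed.

End Shape.

Section GaussImpliesCodazzi.
Context {R : realType} {n : nat}.
Variables (G h : 'rV[R]_n -> 'M[R]_n) (U : set 'rV[R]_n).
Hypothesis n4 : (3 < n)%N.
Hypothesis Uo : open U.
Hypothesis Gsmooth : forall k a b, Ck k U (fun x => G x a b).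
Hypothesis Gsym : forall x, U x -> (G x)^T = G x.
Hypothesis Gpos : forall x, U x -> posdefmx (G x).
Hypothesis hsmooth : forall k a b, Ck k U (fun x => h x a b).
Hypothesis hsym : forall x, U x -> (h x)^T = h x.
Hypothesis hpos : forall x, U x -> posdefmx (h x).
Hypothesis gauss : forall x, U x -> riemann G x = gauss_tensor (h x).
Implicit Types (x : 'rV[R]_n) (a b c d e f p : 'I_n).

Local Opaque pder christoffel.
Local Notation Gam := (christoffel G).

Let Gs m k i j : Ck m U (Gam k i j).
Proof. by have q := christoffel_smooth Uo Gsmooth Gpos m k i j; exact: q. Qed.

Local Notation eta := (shape_op G h).

Let etas m c e : Ck m U (eta c e).
Proof. by have q := shape_smooth Uo Gsmooth Gpos hsmooth m c e; exact: q. Qed.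

Let pGamC x p c e d b : U x ->
  pder p (pder c (Gam e d b)) x = pder c (pder p (Gam e d b)) x.
Proof. by move=> Ux; have q := pderC p c Uo (Gs 2 e d b) Ux; exact: q. Qed.

Lemma pder_mixed_gauss x p e b c d : U x ->
  pder p (pder c (Gam e d b)) x - pder p (pder d (Gam e c b)) x
   + (\sum_f (pder p (Gam e c f) x * Gam f d b x + Gam e c f x * pder p (Gam f d b) x)
      - \sum_f (pder p (Gam e d f) x * Gam f c b x + Gam e d f x * pder p (Gam f c b) x))
  = (pder p (eta c e) x * h x b d + eta c e x * pder p (fun y => h y b d) x)
    - (pder p (eta d e) x * h x b c + eta d e x * pder p (fun y => h y b c) x).
Proof.
move=> Ux.
pose L y := pder c (Gam e d b) y - pder d (Gam e c b) y
   + (\sum_f Gam e c f y * Gam f d b y - \sum_f Gam e d f y * Gam f c b y).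
pose Q y := eta c e y * h y b d - eta d e y * h y b c.
have LQ : pder p L x = pder p Q x.
  by apply: (pder_ext p Uo Ux) => y Uy; rewrite /L /Q -(mixed_gauss Gpos e b c d Uy (gauss Uy)) sumrB.
have LE : is_derive x (delta_mx 0 p : 'rV[R]_n) L
   (pder p (pder c (Gam e d b)) x - pder p (pder d (Gam e c b)) x
   + (\sum_f (pder p (Gam e c f) x * Gam f d b x + Gam e c f x * pder p (Gam f d b) x)
      - \sum_f (pder p (Gam e d f) x * Gam f c b x + Gam e d f x * pder p (Gam f c b) x))).
  apply: is_deriveD; apply: is_deriveB.
  - exact: is_pder Ux (Ck_pder c (Gs 2 e d b)).
  - exact: is_pder Ux (Ck_pder d (Gs 2 e c b)).
  - exact: (is_pder_sumM p Ux (fun f => Gs 1 e c f) (fun f => Gs 1 f d b)).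
  - exact: (is_pder_sumM p Ux (fun f => Gs 1 e d f) (fun f => Gs 1 f c b)).
have QE : is_derive x (delta_mx 0 p : 'rV[R]_n) Q
   ((pder p (eta c e) x * h x b d + eta c e x * pder p (fun y => h y b d) x)
    - (pder p (eta d e) x * h x b c + eta d e x * pder p (fun y => h y b c) x)).
  apply: is_deriveB; apply: is_derive_fM.
  - exact: is_pder Ux (etas 1 c e).
  - exact: is_pder Ux (hsmooth 1 b d).
  - exact: is_pder Ux (etas 1 d e).
  - exact: is_pder Ux (hsmooth 1 b c).
by case: LE => _ <-; case: QE => _ <-; exact: LQ.
Qed.

Let T x a p c := half_covder G h p c a x - half_covder G h c p a x.

Lemma gauss_bianchi x a b p c d : U x ->
  T x a p c * h x b d + T x a d p * h x b c + T x a c d * h x b p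
    + h x a c * T x b p d + h x a d * T x b c p + h x a p * T x b d c = 0.
Proof.
move=> Ux; apply: (bianchi_gauss (G := G x) (h := h x) (gam := fun e c b => Gam e c b x)
  (dgam := fun p e c b => pder p (Gam e c b) x)
  (ddgam := fun p c e d b => pder p (pder c (Gam e d b)) x)
  (eta := fun c e => eta c e x) (deta := fun p c e => pder p (eta c e) x)
  (k := fun p a c => pder p (fun y => h y a c) x) (dh := fun p c a => half_covder G h p c a x)).
- by move=> p' c' e d' b'; exact: pGamC.
- by move=> e b' c' d'; have q := mixed_gauss Gpos e b' c' d' Ux (gauss Ux); exact: q.
- by move=> p' e b' c' d'; exact: pder_mixed_gauss.
- by move=> a' c'; have q := lower_shape h Gpos a' c' Ux; exact: q.
- by move=> p' c' a'; have q := lower_dshape Uo Gsmooth Gsym Gpos hsmooth p' c' a' Ux; exact: q.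
- by [].
Qed.

Lemma gauss_codazzi x : U x -> forall a b c, codazzi G h a b c x = 0.
Proof.
move=> Ux a b c; rewrite (codazziE h a b c Uo Gsym Ux).
have /(_ a c b) T0 : forall a p c, T x a p c = 0.
  apply: (bianchi_contraction (h := h x)) => //; first exact: hsym.
  - by apply: posdefmx_unit; exact: hpos.
  - by move=> a' p' c'; exact: esym (opprB _ _).
  - by move=> a' b' p' c' d'; exact: gauss_bianchi.
by rewrite -[X in _ * X]/(T x a c b) T0 mulr0.
Qed.

End GaussImpliesCodazzi.

(** * The fundamental theorem of hypersurfaces *)

Lemma sum_option (V : nmodType) (T : finType) (f : option T -> V) :
  \sum_k f k = f None + \sum_k f (Some k).
Proof.
rewrite (bigD1 None) //=; congr (_ + _).
rewrite (reindex_omap (@Some T) id) /=; last by case.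
by apply: eq_bigl => t; rewrite eqxx.
Qed.

Section FundamentalTheorem.
Context {R : realType} {n : nat}.
Variables (G h : 'rV[R]_n -> 'M[R]_n) (U : set 'rV[R]_n).
Hypothesis Uo : open U.
Hypothesis Gsmooth : forall k a b, Ck k U (fun x => G x a b).
Hypothesis Gsym : forall x, U x -> (G x)^T = G x.
Hypothesis Gpos : forall x, U x -> posdefmx (G x).
Hypothesis hsmooth : forall k a b, Ck k U (fun x => h x a b).
Hypothesis hsym : forall x, U x -> (h x)^T = h x.
Hypothesis gauss : forall x, U x -> riemann G x = gauss_tensor (h x).
Hypothesis codazzi0 : forall x, U x -> forall a b c, codazzi G h a b c x = 0.
Implicit Types (x : 'rV[R]_n) (a b c d e f p : 'I_n).

Local Opaque pder christoffel.
Local Notation Gam := (christoffel G).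

(** The connection of the trivial bundle spanned by the tangent frame ([Some])
    and the unit normal ([None]) of the hypersurface to be found: the formulas
    of Gauss and Weingarten. *)
Definition frame_coeff c (i j : option 'I_n) x : R :=
  match i, j with
  | Some b, Some e => Gam e c b x
  | Some b, None => h x b c
  | None, Some e => - shape_op G h c e x
  | None, None => 0
  end.

Definition frame_metric (i j : option 'I_n) x : R :=
  match i, j with
  | Some a, Some b => G x a b
  | None, None => 1
  | _, _ => 0
  end.

Lemma frame_coeff_smooth k c i j : Ck k U (frame_coeff c i j).
Proof.
case: i j => [b|] [e|].
- by have q := christoffel_smooth Uo Gsmooth Gpos k e c b; exact: q.
- by have q := hsmooth k b c; exact: q.
- by have q := CkN Uo (shape_smooth Uo Gsmooth Gpos hsmooth k c e); exact: q.
- by have q := Ck_cst k U (0 : R); exact: q.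
Qed.

Lemma frame_metric_smooth k i j : Ck k U (frame_metric i j).
Proof.
case: i j => [b|] [e|]; first by have q := Gsmooth k b e; exact: q.
- by have q := Ck_cst k U (0 : R); exact: q.
- by have q := Ck_cst k U (0 : R); exact: q.
- by have q := Ck_cst k U (1 : R); exact: q.
Qed.

Let hC x a b : U x -> h x a b = h x b a.
Proof. by move=> Ux; rewrite -{1}(hsym Ux) mxE. Qed.

Lemma half_covder_sym x p c a : U x -> half_covder G h p c a x = half_covder G h c p a x.
Proof.
move=> Ux; have := codazzi0 Ux a c p; rewrite (codazziE h a c p Uo Gsym Ux) => /eqP.
by rewrite mulf_eq0 invr_eq0 pnatr_eq0 /= subr_eq0 => /eqP.
Qed.

Lemma shape_adjoint x a b : U x ->
  \sum_k shape_op G h b k x * h x k a = \sum_k shape_op G h a k x * h x k b.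
Proof.
move=> Ux; rewrite /shape_op; under eq_bigr do rewrite mulr_suml.
under [RHS]eq_bigr do rewrite mulr_suml.
rewrite exchange_big /=; apply: eq_bigr => k _; apply: eq_bigr => f _.
by rewrite (inv_metricC Gsym _ _ Ux) mulrAC.
Qed.

(** The four cases are the Gauss equation, the Codazzi equation, the Codazzi
    equation with an index raised, and the self-adjointness of the shape
    operator. *)
Lemma frame_flat x a b i j : U x ->
  pder a (frame_coeff b i j) x + \sum_k frame_coeff b i k x * frame_coeff a k j x =
  pder b (frame_coeff a i j) x + \sum_k frame_coeff a i k x * frame_coeff b k j x.
Proof.
move=> Ux; rewrite !sum_option; case: i j => [d|] [e|] /=.
- have q := mixed_gauss Gpos e d a b Ux (gauss Ux).
  rewrite -[frame_coeff b _ _]/(Gam e b d) -[frame_coeff a _ _]/(Gam e a d).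
  have E c c' : \sum_k Gam k c d x * Gam e c' k x = \sum_f Gam e c' f x * Gam f c d x.
    by apply: eq_bigr => k _; rewrite mulrC.
  rewrite (E a b) (E b a); move: q; rewrite sumrB.
  move: (pder a _ x) (pder b _ x) (\sum_f _) (\sum_f _) (shape_op G h a e x) (shape_op G h b e x).
  move: (h x d a) (h x d b) => h1 h2 p1 p2 s1 s2 e1 e2 q.
  apply/eqP; rewrite -subr_eq0; apply/eqP.
  transitivity ((p1 - p2 + (s2 - s1)) - (e1 * h2 - e2 * h1)); first by ring.
  by rewrite q subrr.
- have q := half_covder_sym a b d Ux; move: q; rewrite /half_covder.
  rewrite -[frame_coeff b _ _]/(fun y => h y d b) -[frame_coeff a _ _]/(fun y => h y d a).
  have E c c' : \sum_k Gam k c d x * h x k c' = \sum_e Gam e c d x * h x e c' by [].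
  move: (pder a _ x) (pder b _ x) (\sum_e _) (\sum_e _) => p1 p2 s1 s2 q.
  apply/eqP; rewrite -subr_eq0; apply/eqP.
  transitivity ((p1 - s2) - (p2 - s1)); first by ring.
  by rewrite q subrr.
- have q : pder a (shape_op G h b e) x + \sum_f Gam e a f x * shape_op G h b f x
         = pder b (shape_op G h a e) x + \sum_f Gam e b f x * shape_op G h a f x.
    move: e; apply: (lower_inj Gpos Ux) => e.
    have l1 := lower_dshape Uo Gsmooth Gsym Gpos hsmooth a b e Ux.
    have l2 := lower_dshape Uo Gsmooth Gsym Gpos hsmooth b a e Ux.
    by apply: etrans l1 (etrans _ (esym l2)); exact: half_covder_sym.
  have E c c' : \sum_k - shape_op G h c k x * Gam e c' k x = - \sum_f Gam e c' f x * shape_op G h c f x.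
    by rewrite -sumrN; apply: eq_bigr => k _; rewrite mulNr mulrC.
  have P c c' : pder c (frame_coeff c' None (Some e)) x = - pder c (shape_op G h c' e) x.
    have sd := Ck_derivable c (shape_smooth Uo Gsmooth Gpos hsmooth 1 c' e) Ux.
    exact: (pderN sd).
  by rewrite !mul0r !add0r !P !E -!opprD q.
- rewrite !mul0r !add0r -[frame_coeff b _ _]/(fun=> 0) -[frame_coeff a _ _]/(fun=> 0).
  rewrite !pder_cst !add0r; under eq_bigr do rewrite mulNr.
  under [RHS]eq_bigr do rewrite mulNr.
  by rewrite !sumrN shape_adjoint.
Qed.

Lemma frame_metric_compat x c i j : U x -> pder c (frame_metric i j) x
  = \sum_k frame_coeff c i k x * frame_metric k j x + \sum_k frame_coeff c j k x * frame_metric i k x.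
Proof.
move=> Ux; rewrite !sum_option; case: i j => [a|] [b|] /=.
- rewrite !mulr0 !add0r -[frame_metric _ _]/(fun y => G y a b) (metric_compat Uo Gsym a b c Ux).
  rewrite addrC; congr (_ + _).
    rewrite -(lower_christoffel Gpos b c a Ux); apply: eq_bigr => k _.
    by rewrite mulrC (metricC Gsym _ _ Ux).
  by rewrite -(lower_christoffel Gpos a c b Ux); apply: eq_bigr => k _; rewrite mulrC.
- rewrite -[frame_metric _ _]/(fun=> 0) pder_cst mulr1 mul0r add0r big1 ?addr0; last first.
    by move=> k _; rewrite mulr0.
  rewrite -(lower_shape h Gpos a c Ux) -big_split big1// => k _ /=.
  by rewrite mulNr mulrC subrr.
- rewrite -[frame_metric _ _]/(fun=> 0) pder_cst mulr1 mul0r add0r [X in _ = _ + (_ + X)]big1 ?addr0.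
    rewrite -(lower_shape h Gpos b c Ux) -big_split big1// => k _ /=.
    by rewrite mulNr (metricC Gsym _ _ Ux) mulrC addNr.
  by move=> k _; rewrite mulr0.
- rewrite -[frame_metric _ _]/(fun=> 1) pder_cst !mul0r !add0r !big1 ?addr0// => k _;
  by rewrite mulr0.
Qed.

Let Dindex := (option 'I_n * option 'I_n)%type.

(** The induced connection on the symmetric square of the frame bundle, under
    which the Gram matrix of a solution evolves. *)
Definition gram_coeff c (i j : Dindex) x : R :=
  frame_coeff c i.1 j.1 x * (i.2 == j.2)%:R + (i.1 == j.1)%:R * frame_coeff c i.2 j.2 x.

Lemma gram_coeff_smooth k c i j : Ck k U (gram_coeff c i j).
Proof.
apply: CkD; [exact: Uo| |].
  have q1 := frame_coeff_smooth k c i.1 j.1; have q2 := Ck_cst k U ((i.2 == j.2)%:R : R).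
  exact: CkM Uo q1 q2.
by have q := CkZ ((i.1 == j.1)%:R : R) Uo (frame_coeff_smooth k c i.2 j.2); exact: q.
Qed.

Lemma sum_gram_coeff c x (i : Dindex) (D : Dindex -> R) :
  \sum_j gram_coeff c i j x * D j
  = \sum_k frame_coeff c i.1 k x * D (k, i.2) + \sum_k frame_coeff c i.2 k x * D (i.1, k).
Proof.
case: i => i1 i2 /=.
transitivity (\sum_k \sum_l gram_coeff c (i1, i2) (k, l) x * D (k, l)).
  by rewrite pair_bigA; apply: eq_bigr => -[k l] _.
transitivity (\sum_k (\sum_l (i2 == l)%:R * (frame_coeff c i1 k x * D (k, l))
    + (i1 == k)%:R * \sum_l frame_coeff c i2 l x * D (k, l))).
  apply: eq_bigr => k _; rewrite mulr_sumr -big_split; apply: eq_bigr => l _ /=.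
  by rewrite /gram_coeff /= mulrDl -!mulrA mulrCA.
rewrite big_split /= sum_delta; congr (_ + _); apply: eq_bigr => k _; exact: sum_delta.
Qed.

Lemma pder_frame_metric x c i : U x -> pder c (frame_metric i.1 i.2) x
  = \sum_j gram_coeff c i j x * frame_metric j.1 j.2 x.
Proof.
move=> Ux; rewrite (frame_metric_compat c i.1 i.2 Ux).
by rewrite (sum_gram_coeff c x i (fun j => frame_metric j.1 j.2 x)).
Qed.

(** A factor [V] of the metric [V V^T] at one point, completed by a unit
    normal. The normal takes the first of the [n.+1] coordinates. *)
Lemma initial_frame x : U x -> exists y : 'I_n.+1 -> option 'I_n -> R,
  forall i j, \sum_t y t i * y t j = frame_metric i j x.
Proof.
move=> Ux; have [W [d [Wu WG _]]] := simultaneous_diag (Gsym Ux) (Gpos Ux) (Gsym Ux).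
pose V := invmx W.
have VV : V *m V^T = G x.
  rewrite -[LHS](_ : V *m (W *m G x *m W^T) *m V^T = _); last by rewrite WG mulmx1.
  by rewrite !mulmxA mulVmx// mul1mx -mulmxA -trmx_mul mulVmx// trmx1 mulmx1.
exists (fun t i => match i, unlift ord0 t with
  | Some a, Some s => V a s | None, None => 1 | _, _ => 0 end) => i j.
rewrite big_ord_recl unlift_none.
have E (F : option 'I_n -> R) : \sum_(s < n) F (unlift ord0 (lift ord0 s)) = \sum_(s < n) F (Some s).
  by apply: eq_bigr => s _; rewrite liftK.
rewrite (E (fun o => (match i, o with Some a, Some s => V a s | None, None => 1 | _, _ => 0 end)
   * (match j, o with Some a, Some s => V a s | None, None => 1 | _, _ => 0 end))).
case: i j => [a|] [b|] /=.
- by rewrite mul0r add0r -VV mxE; apply: eq_bigr => s _; rewrite mxE.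
- by rewrite mul0r add0r big1// => s _; rewrite mulr0.
- by rewrite mulr0 add0r big1// => s _; rewrite mul0r.
- by rewrite mulr1 big1 ?addr0// => s _; rewrite mul0r.
Qed.

(** The frame system with one more unknown ([None]), a coordinate function of
    the immersion, whose differential is the tangent part of the frame. *)
Definition immersion_coeff c (i j : option (option 'I_n)) x : R :=
  match i, j with
  | Some i, Some j => frame_coeff c i j x
  | None, Some (Some e) => (e == c)%:R
  | _, _ => 0
  end.

Lemma immersion_coeff_smooth k c i j : Ck k U (immersion_coeff c i j).
Proof.
have z (r : R) : Ck k U (fun=> r) by exact: Ck_cst.
case: i j => [i|] [j|].
- by have q := frame_coeff_smooth k c i j; exact: q.
- exact: z.
- by case: j => [e|]; exact: z.
- exact: z.
Qed.

Lemma sum_immersion_None c x (f : option (option 'I_n) -> R) :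
  \sum_k immersion_coeff c None k x * f k = f (Some (Some c)).
Proof.
rewrite !sum_option /= !mul0r !add0r -[RHS](sum_delta c (fun e => f (Some (Some e)))).
by apply: eq_bigr => e _; rewrite eq_sym.
Qed.

Lemma sum_immersion_Some c x i (f : option (option 'I_n) -> R) :
  \sum_k immersion_coeff c (Some i) k x * f k = \sum_k frame_coeff c i k x * f (Some k).
Proof. by rewrite sum_option /= mul0r add0r. Qed.

Lemma immersion_flat x a b i j : U x ->
  pder a (immersion_coeff b i j) x + \sum_k immersion_coeff b i k x * immersion_coeff a k j x =
  pder b (immersion_coeff a i j) x + \sum_k immersion_coeff a i k x * immersion_coeff b k j x.
Proof.
move=> Ux; case: i => [i|].
  rewrite !(sum_immersion_Some _ x i (fun k => immersion_coeff _ k j x)).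
  case: j => [j|]; first exact: frame_flat.
  rewrite -[immersion_coeff b _ _]/(fun=> 0) -[immersion_coeff a _ _]/(fun=> 0) !pder_cst.
  by rewrite !big1// => k _; exact: mulr0.
rewrite !(sum_immersion_None _ x (fun k => immersion_coeff _ k j x)).
have E c d : pder c (immersion_coeff d None j) x = 0.
  by case: j => [[e|]|]; exact: pder_cst.
rewrite !E !add0r {E}; case: j => [[e|]|] //=; last exact: hC.
exact: (christoffel_sym Uo Gsym e a b Ux).
Qed.

(** The frame equations are integrable. Solve them once for each ambient
    coordinate, starting from the frame at [x0]; the Gram matrix of the
    solutions and the prescribed one satisfy the same linear system with the
    same initial value, so they agree. *)
Theorem local_hypersurface x0 : U x0 -> exists2 r : R, 0 < r & box x0 r `<=` U /\
  exists u : 'I_n.+1 -> 'rV[R]_n -> R, (forall k t, Ck k (box x0 r) (u t)) /\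
    forall x, box x0 r x -> forall a b, \sum_t pder a (u t) x * pder b (u t) x = G x a b.
Proof.
move=> Ux0.
have [r r0 [rU sol]] := frobenius Uo (fun c i j => immersion_coeff_smooth 2 c i j)
  (fun x Ux a b i j => immersion_flat a b i j Ux) Ux0.
have [y0 y0E] := initial_frame Ux0.
have /choice[F FP] t := sol (fun i => if i is Some i' then y0 t i' else 0).
have Fs k t i : Ck k (box x0 r) (F t i).
  by have [_ _ q] := FP t; apply: q => a i' j'; exact: immersion_coeff_smooth.
have bo : open (box x0 r) by exact: box_open.
have dF x t c i : box x0 r x -> pder c (F t (Some i)) x = \sum_k frame_coeff c i k x * F t (Some k) x.
  move=> xr; have [_ /(_ x xr c (Some i)) -> _] := FP t.
  exact: (sum_immersion_Some c x i (fun k => F t k x)).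
(* The defect of the Gram matrix; it vanishes at [x0] and obeys a linear
   system. *)
pose D (i : Dindex) x := \sum_t F t (Some i.1) x * F t (Some i.2) x - frame_metric i.1 i.2 x.
have Gs2 c i j : Ck 2 (box x0 r) (gram_coeff c i j) by exact: Ck_sub rU (gram_coeff_smooth _ _ _ _).
have Ms k i j : Ck k (box x0 r) (frame_metric i j) by exact: Ck_sub rU (frame_metric_smooth _ _ _).
have Ds i : Ck 1 (box x0 r) (D i).
  apply: CkB; [exact: bo| |exact: Ms].
  by apply: Ck_sum; [exact: bo|move=> t _; apply: CkM; [exact: bo|exact: Fs|exact: Fs]].
have dD x : box x0 r x -> forall c i, pder c (D i) x = \sum_j gram_coeff c i j x * D j x.
  move=> xr c i.
  have h1 := is_pder_sumM c xr (fun t => Fs 1 t (Some i.1)) (fun t => Fs 1 t (Some i.2)).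
  have h2 := is_pder c xr (Ms 1 i.1 i.2).
  have [_ E] : is_derive x (delta_mx 0 c : 'rV[R]_n) (D i)
     (\sum_t (pder c (F t (Some i.1)) x * F t (Some i.2) x + F t (Some i.1) x * pder c (F t (Some i.2)) x)
      - pder c (frame_metric i.1 i.2) x) by exact: is_deriveB.
  apply: etrans E _; rewrite (pder_frame_metric c i (rU _ xr)).
  have -> : \sum_j gram_coeff c i j x * D j x
    = \sum_j gram_coeff c i j x * (\sum_t F t (Some j.1) x * F t (Some j.2) x)
      - \sum_j gram_coeff c i j x * frame_metric j.1 j.2 x.
    by rewrite -sumrB; apply: eq_bigr => j _; rewrite /D mulrBr.
  congr (_ - _).
  rewrite (sum_gram_coeff c x i (fun j => \sum_t F t (Some j.1) x * F t (Some j.2) x)) /=.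
  rewrite big_split /=; congr (_ + _).
    under [RHS]eq_bigr do rewrite mulr_sumr.
    rewrite [RHS]exchange_big; apply: eq_bigr => t _; rewrite dF// mulr_suml.
    by apply: eq_bigr => k _; rewrite mulrA.
  under [RHS]eq_bigr do rewrite mulr_sumr.
  rewrite [RHS]exchange_big; apply: eq_bigr => t _; rewrite dF// mulr_sumr.
  by apply: eq_bigr => k _; rewrite mulrCA.
have D0 i : D i x0 = 0.
  rewrite /D; have -> : \sum_t F t (Some i.1) x0 * F t (Some i.2) x0 = \sum_t y0 t i.1 * y0 t i.2.
    by apply: eq_bigr => t _; have [q _ _] := FP t; rewrite !q.
  by rewrite y0E subrr.
have [r' r'0 Dz] := frobenius_unique bo Gs2 (box_center _ r0) Ds dD D0.
have m0 : 0 < Num.min r r' by rewrite lt_min r0 r'0.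
have mr x : box x0 (Num.min r r') x -> box x0 r x /\ box x0 r' x.
  by move=> xm; split=> i; have := xm i; rewrite lt_min => /andP[].
exists (Num.min r r') => //; split; first by move=> x /mr[/rU].
exists (fun t => F t None); split.
  by move=> k t; apply: Ck_sub (Fs k t None) => x /mr[].
move=> x /mr[xr xr'] a b.
have dN t c : pder c (F t None) x = F t (Some (Some c)) x.
  have [_ /(_ x xr c None) -> _] := FP t.
  exact: (sum_immersion_None c x (fun k => F t k x)).
under eq_bigr do rewrite !dN.
by have /eqP := Dz x xr' (Some a, Some b); rewrite subr_eq0 => /eqP.
Qed.

End FundamentalTheorem.

(** * From charts to the manifold *)

Section Charts.
Context {R : realType} {n : nat} {M : topologicalType}.
Implicit Types (c : chart R n M) (W : set M) (V : set 'rV[R]_n).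

Lemma chart_invK c x : chart_cod c x -> chart_map c (chart_inv c x) = x.
Proof. by case=> p cp <-; rewrite chart_mapK. Qed.

Lemma chart_inv_dom c x : chart_cod c x -> chart_dom c (chart_inv c x).
Proof. by case=> p cp <-; rewrite chart_mapK. Qed.

Lemma chart_imageP c W x :
  (chart_map c @` (chart_dom c `&` W)) x <-> chart_cod c x /\ W (chart_inv c x).
Proof.
split; first by case=> p [cp Wp] <-; rewrite chart_mapK//; split=> //; exists p.
move=> [cx Wx]; exists (chart_inv c x); last exact: chart_invK.
by split=> //; exact: chart_inv_dom.
Qed.

(** On the image of the chart domain the set is a preimage under the
    continuous inverse of the chart. *)
Lemma chart_image_open c W : open W -> open (chart_map c @` (chart_dom c `&` W)).
Proof.
move=> Wo; rewrite openE => x /chart_imageP[cx Wx].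
have h1 : nbhs x (chart_cod c) by apply: open_nbhs_nbhs; split=> //; exact: chart_cod_open.
have h2 : nbhs x (chart_inv c @^-1` W).
  by apply: (chart_inv_cont cx); apply: open_nbhs_nbhs.
by apply: filterS (filterI h1 h2) => y [cy Wy]; apply/chart_imageP.
Qed.

Lemma chart_preimage_open c V : open V -> open (chart_dom c `&` chart_map c @^-1` V).
Proof.
move=> Vo; rewrite openE => p [cp Vp].
have h1 : nbhs p (chart_dom c) by apply: open_nbhs_nbhs; split=> //; exact: chart_dom_open.
have h2 : nbhs p (chart_map c @^-1` V) by apply: (chart_map_cont cp); apply: open_nbhs_nbhs.
exact: filterI h1 h2.
Qed.

End Charts.

Section Main.
Context {R : realType} {n : nat} {M : manifold R n}.
Variable g : riemannian_metric M.
Hypothesis n3 : (3 <= n)%N.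
Hypothesis hpos : positive_curvature_operator g.

(** Near a point of a chart the immersion is a smooth immersion of an open set
    of coordinates, to which the local results apply. *)
Lemma immersion_curvature (c : chart R n M) x : admits_local_isometric_immersion g n.+1 ->
  atlas c -> chart_cod c x ->
  (forall a b d, codazzi (metric_mx g c) (exp_schouten_star (metric_mx g c)) a b d x = 0) /\
  (forall a b d e, weyl_star (metric_mx g c) x a b d e = 0).
Proof.
move=> imm ac cx; have [W [Wo Wp [u [us uE]]]] := imm (chart_inv c x).
set V := chart_map c @` (chart_dom c `&` W).
have Vx : V x by apply/chart_imageP.
have Vc : V `<=` chart_cod c by move=> y /chart_imageP[].
have Vo : open V by exact: chart_image_open.
have Gs k a b : Ck k V (fun x => metric_mx g c x a b).
  exact: Ck_sub Vc (metric_smooth g ac a b k).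
have Gsym y : V y -> (metric_mx g c y)^T = metric_mx g c y by move=> /Vc; exact: Defs.metric_sym.
have Gpos y : V y -> posdefmx (metric_mx g c y) by move=> /Vc; exact: metric_posdef.
have Rpos y : V y -> op_posdef (metric_mx g c y) (riemann (metric_mx g c) y).
  by move=> /Vc; exact: hpos.
have vs k t : Ck k V (u t \o chart_inv c) by exact: (us t c ac k).
have vE y : V y -> forall a b, \sum_t pder a (u t \o chart_inv c) y * pder b (u t \o chart_inv c) y
    = metric_mx g c y a b by exact: uE.
split.
  exact: (immersion_codazzi n3 Vo Gs Gsym Gpos Rpos vs vE Vx).
by have [_ [_ _ _ _ [_ w0]]] := hypersurface_form n3 Vo Gs Gsym Gpos Rpos vs vE Vx.
Qed.

Hypothesis cod3 : n = 3%N -> exp_schouten_star_codazzi g.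
Hypothesis weyl4 : (3 < n)%N -> weyl_star_vanishes g.

(** Either the Weyl tensor of the logarithm vanishes by hypothesis, or the
    dimension is three. *)
Lemma log_riemann_kulkarni (c : chart R n M) x : atlas c -> chart_cod c x ->
  op_symmetric (riemann (metric_mx g c) x) ->
  log_riemann (metric_mx g c) x = kulkarni (metric_mx g c x) (schouten_star (metric_mx g c) x).
Proof.
move=> ac cx Rsym; have gs := Defs.metric_sym g ac cx; have gp := metric_posdef g ac cx.
have [Lsym _] := op_logP gs gp Rsym (hpos ac cx).
case: (ltngtP 3 n) => [n4|n2|e3].
- do 4 apply/funext => ?; apply/eqP; rewrite -subr_eq0; apply/eqP; exact: weyl4.
- by move: n3; rewrite leqNgt n2.
- rewrite /schouten_star -/(log_riemann _ _) in Lsym *.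
  move: (metric_mx g c x) (log_riemann _ _) gs gp Lsym => G L; clear -e3; subst n.
  exact: kulkarni_schouten_dim3.
Qed.

(** The hypotheses give the Gauss and Codazzi equations for
    [exp_schouten_star] on a chart domain, hence an immersion of a small box
    of coordinates; composing with the chart gives functions on the manifold,
    which the transition maps carry to the other charts. *)
Lemma immersion_exists : admits_local_isometric_immersion g n.+1.
Proof.
move=> p; have [c ac cp] := atlas_cover p.
set G := metric_mx g c; pose U := chart_cod c; pose h := exp_schouten_star G.
have Uo : open U by exact: chart_cod_open.
have Gs k a b : Ck k U (fun x => G x a b) by exact: (metric_smooth g ac a b k).
have Gsym x : U x -> (G x)^T = G x by exact: Defs.metric_sym.
have Gpos x : U x -> posdefmx (G x) by exact: metric_posdef.
have Rsym x : U x -> op_symmetric (riemann G x) by exact: riemann_sym.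
have hP x : U x -> [/\ (h x)^T = h x, posdefmx (h x) & riemann G x = gauss_tensor (h x)].
  move=> Ux; have Ls := (op_logP (Gsym x Ux) (Gpos x Ux) (Rsym x Ux) (hpos ac Ux)).1.
  apply: gauss_tensor_of_log; [exact: Gsym|exact: Gpos|exact: Rsym|exact: hpos| |].
    exact: schouten_sym (Gsym x Ux) Ls.
  by apply: log_riemann_kulkarni => //; exact: Rsym.
have hsym x : U x -> (h x)^T = h x by move=> /hP[].
have hp x : U x -> posdefmx (h x) by move=> /hP[].
have gauss x : U x -> riemann G x = gauss_tensor (h x) by move=> /hP[].
have hs k a b : Ck k U (fun x => h x a b).
  apply: (gauss_root_smooth (K := riemann G)) => //.
    by move=> x Ux a' b' c' d'; rewrite gauss.
  by move=> a' b' c' d'; exact: (riemann_smooth Uo Gs Gpos).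
have hcod x : U x -> forall a b d, codazzi G h a b d x = 0.
  case: (ltngtP 3 n) => [n4|n2|e3].
  - by move=> Ux; exact: (gauss_codazzi n4 Uo Gs Gsym Gpos hs hsym hp gauss Ux).
  - by move: n3; rewrite leqNgt n2.
  - by move=> Ux; exact: (cod3 (esym e3) ac Ux).
have Up : U (chart_map c p) by exists p.
have [r r0 [rU [u [us uE]]]] := local_hypersurface Uo Gs Gsym Gpos hs hsym gauss hcod Up.
have bo : open (box (chart_map c p) r) by exact: box_open.
pose W := chart_dom c `&` chart_map c @^-1` box (chart_map c p) r.
have Wo : open W by exact: chart_preimage_open.
exists W; split=> //; first by split=> //; exact: box_center.
exists (fun t q => u t (chart_map c q)).
have chart_trans (c' : chart R n M) x : (chart_map c' @` (chart_dom c' `&` W)) x ->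
    (chart_map c' @` (chart_dom c' `&` chart_dom c)) x.
  by move=> /chart_imageP[cx [dx _]]; apply/chart_imageP.
have into_box (c' : chart R n M) x : (chart_map c' @` (chart_dom c' `&` W)) x ->
    box (chart_map c p) r (chart_map c (chart_inv c' x)) by move=> /chart_imageP[_ []].
split.
  move=> t c' ac' k; apply: (@Ck_comp R n k n _ (box (chart_map c p) r)
    (fun x => chart_map c (chart_inv c' x)) (u t)) => //.
  - exact: chart_image_open.
  - exact: into_box.
  - by move=> j; apply: Ck_sub (atlas_smooth ac' ac j k); exact: chart_trans.
move=> c' ac' x xW a b; set y := chart_map c (chart_inv c' x).
have yb : box (chart_map c p) r y by exact: into_box.
have dU t e : pder e ((fun q => u t (chart_map c q)) \o chart_inv c') x
    = \sum_j pder j (u t) y * pder e (transition c' c j) x.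
  have td j : derivable (fun z => chart_map c (chart_inv c' z) 0 j) x (delta_mx 0 e).
    by have q := Ck_derivable e (atlas_smooth ac' ac j 1) (chart_trans c' x xW); exact: q.
  by have [_ q] := is_derive_comp_row bo (us 1%N t) yb td; exact: q.
under eq_bigr do rewrite !dU.
rewrite (metric_transform g ac' ac (chart_trans c' x xW)).
transitivity (\sum_i \sum_j pder a (transition c' c i) x * pder b (transition c' c j) x
   * \sum_t pder i (u t) y * pder j (u t) y).
  under [RHS]eq_bigr do under eq_bigr do rewrite mulr_sumr.
  under [RHS]eq_bigr do rewrite exchange_big.
  rewrite [RHS]exchange_big; apply: eq_bigr => t _ /=.
  rewrite mulr_suml; apply: eq_bigr => i _; rewrite mulr_sumr; apply: eq_bigr => j _.
  move: (pder i _ y) (pder j _ y) (pder a _ x) (pder b _ x) => A B C D; ring.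
by apply: eq_bigr => i _; apply: eq_bigr => j _; rewrite uE.
Qed.

End Main.

Theorem theorem5p1 (R : realType) (n : nat) (hn : (3 <= n)%N)
  (M : manifold R n) (g : riemannian_metric M)
  (hpos : positive_curvature_operator g) :
  admits_local_isometric_immersion g n.+1 <->
  ((n = 3%N -> exp_schouten_star_codazzi g) /\
   ((3 < n)%N -> weyl_star_vanishes g)).
Proof.
split=> [imm|[cod3 weyl4]]; last exact: immersion_exists.
split=> _ c ac x cx; first by have [] := immersion_curvature hn hpos imm ac cx.
by have [] := immersion_curvature hn hpos imm ac cx.
Qed.
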